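(* For any constants $C_v>0$, $C_p\ge1$, $C_b>0$, $C_a>0$ and $C_m$, there exists a constant $C$ depending only on $C_v,C_p,C_b,C_a,C_m$ such that the following holds. Let $n\ge3$, $p\ge2$, $B_n\ge1$, $\delta\ge0$, and let $V_1,\dots,V_n,Z_1,\dots,Z_n$ be independent random vectors in $\mathbb R^p$ with $\mathrm E[V_{ij}]=\mathrm E[Z_{ij}]=0$ for all $i=1,\dots,n$, $j=1,\dots,p$, satisfying: (Condition V) for all $j=1,\dots,p$, $\frac1n\sum_{i=1}^n\mathrm E[V_{ij}^4+Z_{ij}^4]\le C_vB_n^2$; (Condition P) for all $i=1,\dots,n$, $\mathrm P(\|V_i\|_\infty\vee\|Z_i\|_\infty>C_pB_n\log(pn))\le1/n^4$; (Condition B) for all $i=1,\dots,n$, $\mathrm E[\|V_i\|_\infty^8+\|Z_i\|_\infty^8]\le C_bB_n^8\log^8(pn)$; (Condition A) for all $(y,t)\in\mathbb R^p\times(0,\infty)$, $$\mathrm P\Big(\frac1{\sqrt n}\sum_{i=1}^nZ_i\le y+t\Big)-\mathrm P\Big(\frac1{\sqrt n}\sum_{i=1}^nZ_i\le y\Big)\le C_a\big(t\sqrt{\log p}+\delta\big).$$ In addition, suppose that $$\max_{1\le j,k\le p}\left|\frac1{\sqrt n}\sum_{i=1}^n(\mathrm E[V_{ij}V_{ik}]-\mathrm E[Z_{ij}Z_{ik}])\right|\le C_mB_n\sqrt{\log(pn)}$$ and $$\max_{1\le j,k,l\le p}\left|\frac1{\sqrt n}\sum_{i=1}^n(\mathrm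 E[V_{ij}V_{ik}V_{il}]-\mathrm E[Z_{ij}Z_{ik}Z_{il}])\right|\le C_mB_n^2\sqrt{\log^3(pn)}.$$ Then $$\sup_{y\in\mathbb R^p}\left|\mathrm P\Big(\frac1{\sqrt n}\sum_{i=1}^nV_i\le y\Big)-\mathrm P\Big(\frac1{\sqrt n}\sum_{i=1}^nZ_i\le y\Big)\right|\le C\left(\left(\frac{B_n^2\log^5(pn)}{n}\right)^{1/4}+\delta\right).$$
   Context: $V_{ij},Z_{ij}$ are the $j$th components of $V_i,Z_i$. For $x,y\in\mathbb R^p$, $x\le y$ means $x_j\le y_j$ for all $j$; for a scalar $t$, $y+t$ is the vector with components $y_j+t$. $\|x\|_\infty=\max_j|x_j|$ and $x\vee y=\max(x,y)$ for scalars. *)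

(* Defs.v *)
From HB Require Import structures.
From mathcomp Require Import all_boot all_order all_algebra.
From mathcomp Require Import all_classical all_reals all_analysis.

Set Implicit Arguments.
Unset Strict Implicit.
Unset Printing Implicit Defensive.

Import Order.TTheory GRing.Theory Num.Theory.
Import numFieldNormedType.Exports.

Local Open Scope classical_set_scope.
Local Open Scope ring_scope.

(* R^p is represented by p.-tuple R: it carries the product sigma-algebra in
   the library, so that {RV P >-> p.-tuple R} is the type of random vectors. *)
Section vectors.
Context {R : realType}.

Definition vec_le p (x y : p.-tuple R) : Prop :=
  forall j : 'I_p, tnth x j <= tnth y j.

Definition vec_shift p (y : p.-tuple R) (t : R) : p.-tuple R :=
  [tuple tnth y j + t | j < p].

Definition sup_norm p (x : p.-tuple R) : R :=
  \big[Num.max/0]_(j < p) `|tnth x j|.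

Definition normalized_sum n p (X : 'I_n -> p.-tuple R) : p.-tuple R :=
  [tuple (Num.sqrt n%:R)^-1 * \sum_(i < n) tnth (X i) j | j < p].

End vectors.

Section probability.
Context {d d' : measure_display} {T : measurableType d} {E : measurableType d'}
  {R : realType} (P : probability T R).

Definition mutually_independent (I : finType) (X : I -> {RV P >-> E}) : Prop :=
  forall (J : {set I}) (A : I -> set E), (forall i, measurable (A i)) ->
    P (\bigcap_(i in [set` J]) (X i @^-1` A i)) =
    (\prod_(i in J) P (X i @^-1` A i))%E.

Definition joint_family (I1 I2 : Type) (X : I1 -> {RV P >-> E})
    (Y : I2 -> {RV P >-> E}) : I1 + I2 -> {RV P >-> E} :=
  fun k => match k with inl i => X i | inr i => Y i end.

End probability.

Definition component {d : measure_display} {T : measurableType d} {R : realType}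
    {P : probability T R} {p : nat} (X : {RV P >-> p.-tuple R}) (j : 'I_p)
    : T -> R :=
  fun w => tnth (X w) j.

Definition sum_le_event {d : measure_display} {T : measurableType d}
    {R : realType} {P : probability T R} {n p : nat}
    (X : 'I_n -> {RV P >-> p.-tuple R}) (y : p.-tuple R) : set T :=
  [set w | vec_le (normalized_sum (fun i => X i w)) y].

(* Main.v *)
Require Import Defs.
From HB Require Import structures.
From mathcomp Require Import all_boot all_order all_algebra.
From mathcomp Require Import ring lra.
From mathcomp Require Import all_classical all_reals all_analysis.
From mathcomp Require Import measurable_realfun.

Set Implicit Arguments.
Unset Strict Implicit.
Unset Printing Implicit Defensive.

Import Order.TTheory GRing.Theory Num.Theory.
Import numFieldNormedType.Exports.

Local Open Scope classical_set_scope.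
Local Open Scope ring_scope.

(** The proof interpolates between the two families of vectors inside the space of
    laws.  For a weight [u] in [0, 1], let the i-th summand have the mixture of the
    laws of [V i] and [Z i] with weights [u] and [1 - u]; at [u = 1] and [u = 0] the
    sum of independent summands has the law of the two sums to be compared.  All
    the hypotheses are linear in the laws, so they hold along the whole path with
    the same constants, and the supremum [rho] over all orthants and all [u] of the
    distance to the endpoint [u = 0] is a finite number for which an inequality can
    be set up.

    The indicator of an orthant is replaced by a smooth function of the soft
    maximum (logarithm of a sum of exponentials) of the coordinates
    ([smooth_orthant]), equal to the indicator outside a strip along the boundary.
    The derivative in [u] of its mean is a sum over i of a difference between the
    laws of [V i] and [Z i], the other summands being mixtures
    ([is_derive_interp]).  Each difference is first averaged over the missing
    mixture as well.  The resulting terms are evaluated at the same random point,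
    hence the second and third order terms of their expansions combine into the
    sums of moment differences that the hypotheses control ([sum_gap_bound]).  The
    correction is a second difference in two independent centred vectors, which
    leaves only terms of order four ([second_difference]).  Fourth derivatives of
    the soft maximum in a direction [v] are bounded by the weighted average of the
    [v_j ^+ 4] under the softmax weights, so that no power of the dimension is lost
    and only fourth moments of single coordinates are needed.

    All derivatives vanish outside the strip.  The bound on the derivative in [u]
    is thus a small constant times the probability of a slightly larger strip under
    the mixture with weight [u], and this probability is at most [2 * rho] plus the
    anti-concentration bound for the sum of the [Z i].  With a smoothing width for
    which the small constant is at most 1/4, the inequality obtained for [rho]
    absorbs [rho] on the right and closes ([interp_comparison]); that width, through
    anti-concentration, is what gives the rate.  If the rate exceeds one there is
    nothing to prove. *)

(** * Calculus on the line *)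

Section calculus.
Context {R : realType}.
Implicit Types f h : R -> R.

Lemma continuous_of_is_derive f (f' : R -> R) :
  (forall t, is_derive (t : R) (1 : R) f (f' t)) -> continuous f.
Proof.
move=> df t; apply: differentiable_continuous; apply/derivable1_diffP.
by have [] := df t.
Qed.

Lemma mean_value f (f' : R -> R) (a b K : R) :
  (forall t, is_derive (t : R) (1 : R) f (f' t)) -> a <= b ->
  (forall t, a <= t <= b -> `|f' t| <= K) -> `|f b - f a| <= K * (b - a).
Proof.
move=> df ab K1; have [c|c + ->] := MVT_segment ab (fun x _ => df x).
  by apply: continuous_subspaceT; exact: continuous_of_is_derive df.
rewrite in_itv/= => /K1 cK; rewrite normrM (ger0_norm (_ : 0 <= b - a)) ?subr_ge0//.
by rewrite ler_wpM2r// subr_ge0.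
Qed.

(** The crude constant 1 in place of 1/24 comes from bounding the successive
    remainders one after the other by the mean value inequality. *)
Lemma taylor_order4 h h1 h2 h3 h4 (K : R) :
  (forall t, is_derive (t : R) (1 : R) h (h1 t)) -> (forall t, is_derive (t : R) (1 : R) h1 (h2 t)) ->
  (forall t, is_derive (t : R) (1 : R) h2 (h3 t)) -> (forall t, is_derive (t : R) (1 : R) h3 (h4 t)) ->
  (forall t, 0 <= t <= 1 -> `|h4 t| <= K) ->
  `|h 1 - h 0 - h1 0 - h2 0 / 2 - h3 0 / 6| <= K.
Proof.
move=> d1 d2 d3 d4 h4K.
have K0 : 0 <= K by rewrite (le_trans _ (h4K 0 _))// lexx ler01.
have step f f' : (forall t, is_derive (t : R) (1 : R) f (f' t)) -> f 0 = 0 ->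
    (forall t, 0 <= t <= 1 -> `|f' t| <= K) ->
    forall t, 0 <= t <= 1 -> `|f t| <= K.
  move=> df f0 fK t /andP[t0 t1]; rewrite -[f t]subr0 -f0.
  apply: (le_trans (@mean_value f f' 0 t K df t0 _)).
    by move=> s /andP[s0 st]; rewrite fK// s0 (le_trans st).
  by rewrite subr0 ler_piMr.
pose r3 t := h3 t - h3 0.
pose r2 t := h2 t - h2 0 - h3 0 * t.
pose r1 t := h1 t - h1 0 - h2 0 * t - h3 0 / 2 * t ^+ 2.
pose r0 t := h t - h 0 - h1 0 * t - h2 0 / 2 * t ^+ 2 - h3 0 / 6 * t ^+ 3.
have r3K : forall t, 0 <= t <= 1 -> `|r3 t| <= K.
  apply: (step _ h4); rewrite /r3 ?subrr// => t.
  by apply: is_derive_eq; rewrite subr0.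
have r2K : forall t, 0 <= t <= 1 -> `|r2 t| <= K.
  apply: (step _ r3) => //; rewrite /r2 ?mulr0 ?subr0 ?subrr// => t.
  by apply: is_derive_eq; rewrite /r3 /GRing.scale/=; ring.
have r1K : forall t, 0 <= t <= 1 -> `|r1 t| <= K.
  apply: (step _ r2) => //; rewrite /r1 ?expr0n/= ?mulr0 ?subr0 ?subrr// => t.
  by apply: is_derive_eq; rewrite /r2 /GRing.scale/=; field.
have r0K : forall t, 0 <= t <= 1 -> `|r0 t| <= K.
  apply: (step _ r1) => //; rewrite /r0 ?expr0n/= ?mulr0 ?subr0 ?subrr// => t.
  by apply: is_derive_eq; rewrite /r1 /GRing.scale/=; field.
by have := r0K 1; rewrite lexx ler01 /r0 !expr1n !mulr1; exact.
Qed.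

Lemma is_derive_quadratic f (t l K : R) :
  (forall s, `|f s - f t - l * (s - t)| <= K * (s - t) ^+ 2) ->
  is_derive (t : R) (1 : R) f l.
Proof.
move=> fK.
suff fl : (fun h : R => h^-1 *: ((f \o shift t) (h *: 1) - f t)) @ 0^' --> l.
  by apply: DeriveDef; [apply/cvg_ex; exists l|exact: cvg_lim].
apply/cvgrPdist_le => e e0.
near=> h.
have h0 : h != 0 by near: h; exact: nbhs_dnbhs_neq.
rewrite /= /GRing.scale/= mulr1.
have := fK (h + t); rewrite addrK => fh.
have -> : l - h^-1 * (f (h + t) - f t) = - (h^-1 * (f (h + t) - f t - l * h)).
  by field.
rewrite normrN normrM normfV ler_pdivrMl ?normr_gt0//.
apply: (le_trans fh); rewrite -(real_normK (num_real h)) expr2 mulrCA.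
rewrite ler_wpM2l//.
have K1 : 0 < `|K| + 1 by rewrite ltr_wpDl.
apply: (@le_trans _ _ ((`|K| + 1) * `|h|)).
  by rewrite ler_wpM2r// (le_trans (ler_norm K))// lerDl.
rewrite -ler_pdivlMl//; near: h; apply: dnbhs0_le.
by rewrite mulr_gt0// invr_gt0.
Unshelve. all: by end_near.
Qed.

Definition clamp01 (t : R) : R :=
  if t <= 0 then 0 else if 1 <= t then 1 else t.

Lemma clamp01_itv t : 0 <= clamp01 t <= 1.
Proof.
by rewrite /clamp01; case: (leP t 0) => ?; [|case: (leP 1 t) => ?]; lra.
Qed.

Lemma clamp01_le0 t : t <= 0 -> clamp01 t = 0.
Proof. by rewrite /clamp01 => ->. Qed.

Lemma clamp01_ge1 t : 1 <= t -> clamp01 t = 1.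
Proof. by rewrite /clamp01 => t1; rewrite t1 leNgt (lt_le_trans ltr01 t1). Qed.

Lemma clamp01_id t : 0 < t < 1 -> clamp01 t = t.
Proof. by rewrite /clamp01 => /andP[t0 t1]; rewrite leNgt t0 leNgt t1. Qed.

Lemma clamp01_lipschitz t s : `|clamp01 s - clamp01 t| <= `|s - t|.
Proof.
have [ts|ts] := leP t s.
  rewrite [leRHS]ger0_norm ?subr_ge0// /clamp01 ler_norml.
  by case: (leP t 0) => ?; case: (leP s 0) => ?; case: (leP 1 t) => ?;
    case: (leP 1 s) => ?; lra.
rewrite [leRHS]ltr0_norm ?subr_lt0// /clamp01 ler_norml.
by case: (leP t 0) => ?; case: (leP s 0) => ?; case: (leP 1 t) => ?;
  case: (leP 1 s) => ?; lra.
Qed.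

Lemma poly_bounded01 (p : {poly R}) :
  exists2 K, 0 <= K & forall t, 0 <= t <= 1 -> `|p.[t]| <= K.
Proof.
exists (\sum_(i < size p) `|p`_i|); first by apply: sumr_ge0.
move=> t /andP[t0 t1]; rewrite horner_coef (le_trans (ler_norm_sum _ _ _))//.
apply: ler_sum => i _; rewrite normrM ler_piMr// normrX exprn_ile1//.
by rewrite ger0_norm.
Qed.

(** Flatness of the polynomial at both ends is what makes the clamped function
    differentiable at the two junctions. *)
Lemma is_derive_clamped_poly (p : {poly R}) t :
  p^`().[0] = 0 -> p^`().[1] = 0 ->
  is_derive (t : R) (1 : R) (fun s => p.[clamp01 s]) p^`().[clamp01 t].
Proof.
move=> p0 p1; have [K K0 KP] := poly_bounded01 p^`()^`().
apply: (@is_derive_quadratic _ _ _ (2 * K)) => s.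
have lip1 a b : 0 <= a -> a <= b -> b <= 1 ->
    `|p^`().[b] - p^`().[a]| <= K * (b - a).
  move=> a0 ab b1; apply: (mean_value (f' := horner p^`()^`())) => // u.
  by move=> /andP[au ub]; rewrite KP// (le_trans a0)//= (le_trans ub).
have lip a b : 0 <= a <= 1 -> 0 <= b <= 1 ->
    `|p^`().[b] - p^`().[a]| <= K * `|b - a|.
  move=> /andP[a0 a1] /andP[b0 b1]; have [ab|/ltW ba] := leP a b.
    by rewrite (ger0_norm (_ : 0 <= b - a)) ?subr_ge0// lip1.
  by rewrite (distrC b) (ger0_norm (_ : 0 <= a - b)) ?subr_ge0// distrC lip1.
have tay a b : 0 <= a <= 1 -> 0 <= b <= 1 ->
    `|p.[b] - p.[a] - p^`().[a] * (b - a)| <= K * `|b - a| ^+ 2.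
  move=> a01 b01; pose g x := p.[x] - p^`().[a] * x.
  have dg x : is_derive (x : R) (1 : R) g (p^`().[x] - p^`().[a]).
    by apply: is_derive_eq; rewrite /GRing.scale/=; ring.
  have -> : p.[b] - p.[a] - p^`().[a] * (b - a) = g b - g a.
    by rewrite /g; ring.
  have [/andP[a0 a1] /andP[b0 b1]] := (a01, b01).
  have [ab|/ltW ba] := leP a b.
    rewrite (ger0_norm (_ : 0 <= b - a)) ?subr_ge0// expr2 mulrA.
    apply: (mean_value dg) => // u /andP[au ub].
    have u01 : 0 <= u <= 1 by lra.
    rewrite (le_trans (lip _ _ a01 u01))// ler_wpM2l// ger0_norm; lra.
  rewrite distrC (distrC b) (ger0_norm (_ : 0 <= a - b)) ?subr_ge0// expr2 mulrA.
  apply: (mean_value dg) => // u /andP[au ub].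
  have u01 : 0 <= u <= 1 by lra.
  rewrite (le_trans (lip _ _ a01 u01))// ler_wpM2l// distrC ger0_norm; lra.
set a := clamp01 t; set b := clamp01 s.
have -> : p.[b] - p.[a] - p^`().[a] * (s - t) =
    (p.[b] - p.[a] - p^`().[a] * (b - a)) + p^`().[a] * ((b - a) - (s - t)).
  by ring.
rewrite (le_trans (ler_normD _ _))// (mulrC 2) mulr_natr mulr2n mulrDl.
have abst : `|b - a| <= `|s - t| := clamp01_lipschitz t s.
rewrite lerD//.
  rewrite (le_trans (tay _ _ (clamp01_itv t) (clamp01_itv s)))// ler_wpM2l//.
  by rewrite -[leRHS]real_normK ?num_real// lerXn2r ?nnegrE.
have [t0|t0] := leP t 0.
  by rewrite /a clamp01_le0// p0 mul0r normr0 mulr_ge0// sqr_ge0.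
have [t1|t1] := leP 1 t.
  by rewrite /a clamp01_ge1// p1 mul0r normr0 mulr_ge0// sqr_ge0.
have at_ : a = t by rewrite /a clamp01_id// t0.
rewrite -[X in K * X]real_normK ?num_real// expr2 mulrA normrM.
have [s0|s0] := leP s 0.
  have -> : b = 0 by rewrite /b clamp01_le0.
  rewrite ler_pM//.
    rewrite -[p^`().[a]]subr0 -p0 (le_trans (lip _ _ _ (clamp01_itv t)))//.
      by rewrite lexx ler01.
    by rewrite ler_wpM2l// -/a at_ [leRHS]ler0_norm ?ler_norml; lra.
  by rewrite at_ [leRHS]ler0_norm ?ler_norml; lra.
have [s1|s1] := leP 1 s.
  have -> : b = 1 by rewrite /b clamp01_ge1.
  rewrite ler_pM//.
    rewrite -[p^`().[a]]subr0 -p1 (le_trans (lip _ _ _ (clamp01_itv t)))//.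
      by rewrite lexx ler01.
    by rewrite ler_wpM2l// -/a at_ [leRHS]ger0_norm ?ler_norml; lra.
  by rewrite at_ [leRHS]ger0_norm ?ler_norml; lra.
have -> : b = s by rewrite /b clamp01_id// s0.
by rewrite at_ subrr normr0 mulr0 !mulr_ge0.
Qed.

End calculus.

(** * A smooth step and the soft maximum *)

Section smooth_step.
Context {R : realType}.

(** The primitive of a multiple of [X^4 (1 - X)^4]: flatness at 0 and at 1 up to
    order four gives its clamped version four derivatives. *)
Definition step_poly : {poly R} :=
  'X^5 * (126%:P - 420 *: 'X + 540 *: 'X^2 - 315 *: 'X^3 + 70 *: 'X^4).

Lemma step_polyE u : step_poly.[u] =
  u ^+ 5 * (126 - 420 * u + 540 * u ^+ 2 - 315 * u ^+ 3 + 70 * u ^+ 4).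
Proof.
by rewrite hornerM !hornerD !hornerN !hornerZ !hornerXn hornerX hornerC.
Qed.

Lemma deriv_step_poly : step_poly^`() = ('X * (1 - 'X)) ^+ 4 * 630%:P.
Proof.
rewrite /step_poly !poly.derivE -!mul_polyC /= !polyCMn polyC1.
ring.
Qed.

(** Differentiation lowers the order of vanishing at both ends by one. *)
Lemma deriv_flat (k : nat) (q : {poly R}) :
  exists r, (('X * (1 - 'X)) ^+ k.+1 * q)^`() = ('X * (1 - 'X)) ^+ k * r.
Proof.
exists ((1 - 'X *+ 2) *+ k.+1 * q + 'X * (1 - 'X) * q^`()).
rewrite derivM deriv_exp.
have -> : ('X * (1 - 'X) : {poly R})^`() = 1 - 'X *+ 2.
  by rewrite !poly.derivE; ring.
rewrite exprS -mulrnAl; set w := 'X * _; ring.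
Qed.

Lemma step_poly_derivn k : (k < 4)%N ->
  exists r, step_poly^`(k.+1) = ('X * (1 - 'X)) ^+ (4 - k) * r.
Proof.
elim: k => [_|k ih k3]; first by exists 630%:P; rewrite derivn1 deriv_step_poly.
have [r rE] := ih (ltnW k3); rewrite derivnS rE.
by rewrite -[(4 - k)%N]prednK ?subn_gt0 ?(ltnW k3)// -subnS; exact: deriv_flat.
Qed.

Lemma step_poly_flat0 k : (k < 4)%N -> step_poly^`(k.+1).[0] = 0.
Proof.
move=> k4; have [r ->] := step_poly_derivn k4.
by rewrite hornerM horner_exp hornerM hornerX mul0r expr0n subn_eq0 leqNgt k4 mul0r.
Qed.

Lemma step_poly_flat1 k : (k < 4)%N -> step_poly^`(k.+1).[1] = 0.
Proof.
move=> k4; have [r ->] := step_poly_derivn k4.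
by rewrite hornerM horner_exp hornerM hornerD hornerN hornerX hornerC subrr
  mulr0 expr0n subn_eq0 leqNgt k4 mul0r.
Qed.

Lemma step_poly0 : step_poly.[0] = 0.
Proof. by rewrite step_polyE expr0n mul0r. Qed.

Lemma step_poly1 : step_poly.[1] = 1.
Proof. by rewrite step_polyE; ring. Qed.

(** The Bernstein form of the polynomial shows its values on [0, 1] at once. *)
Lemma step_poly_itv t : 0 <= t <= 1 -> 0 <= step_poly.[t] <= 1.
Proof.
move=> /andP[t0 t1]; have u0 : 0 <= 1 - t by rewrite subr_ge0.
have S u : step_poly.[u] = u ^+ 5 * (126 * (1 - u) ^+ 4 + 84 * u * (1 - u) ^+ 3
    + 36 * u ^+ 2 * (1 - u) ^+ 2 + 9 * u ^+ 3 * (1 - u) + u ^+ 4).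
  by rewrite !step_polyE; ring.
have Sge0 u : 0 <= u -> 0 <= 1 - u -> 0 <= step_poly.[u].
  move=> u0' u1'; rewrite S mulr_ge0 ?exprn_ge0// !addr_ge0//;
    by rewrite ?mulr_ge0 ?exprn_ge0.
rewrite Sge0//= -subr_ge0.
have -> : 1 - step_poly.[t] = step_poly.[1 - t].
  by rewrite !step_polyE; ring.
by apply: Sge0; rewrite // subKr.
Qed.

(** [gstep l k] is the [k]-th derivative of a function decreasing from 1 to 0
    as its argument goes from [l^-1] to [2 l^-1]. *)
Definition gstep (l : R) (k : nat) (t : R) : R :=
  (k == 0)%:R - l ^+ k * step_poly^`(k).[clamp01 (l * t - 1)].

Lemma is_derive_gstep l k t : (k < 4)%N ->
  is_derive (t : R) (1 : R) (gstep l k) (gstep l k.+1 t).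
Proof.
move=> k4; pose S u := step_poly^`(k).[clamp01 u].
pose aff u : R := l * u - 1.
have dS u : is_derive (u : R) (1 : R) S step_poly^`(k.+1).[clamp01 u].
  by rewrite derivnS; apply: is_derive_clamped_poly; rewrite -derivnS
    ?step_poly_flat0 ?step_poly_flat1.
have daff : is_derive (t : R) (1 : R) aff l.
  by apply: is_derive_eq; rewrite /GRing.scale/= mulr1 subr0.
have dc := @is_derive1_comp _ S aff t _ _ (dS (aff t)) daff.
have -> : gstep l k = (fun u => (k == 0)%:R - l ^+ k * (S \o aff) u) by [].
apply: is_derive_eq; rewrite /gstep /GRing.scale/= exprSr.
rewrite -/(aff t). ring.
Qed.

Lemma gstep_itv l t : 0 <= gstep l 0 t <= 1.
Proof.
have := step_poly_itv (clamp01_itv (l * t - 1)).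
by rewrite /gstep/= expr0 mul1r ?derivn0; lra.
Qed.

Lemma gstep_eq1 l t : l * t <= 1 -> gstep l 0 t = 1.
Proof.
by move=> lt; rewrite /gstep/= expr0 mul1r ?derivn0 clamp01_le0 ?subr_le0//
  step_poly0 subr0.
Qed.

Lemma gstep_eq0 l t : 2 <= l * t -> gstep l 0 t = 0.
Proof.
move=> lt; rewrite /gstep/= expr0 mul1r ?derivn0 clamp01_ge1 ?step_poly1 ?subrr//.
lra.
Qed.

(** The k-th derivative carries the factor [l ^+ k]; as [l <= 1], a single factor
    [l] is kept for all orders. *)
Lemma gstep_deriv_bound : exists2 K : R, 1 <= K &
  forall (l : R) (k : nat) (t : R), 0 < l <= 1 -> (k < 4)%N ->
    `|gstep l k.+1 t| <= K * l * (1 <= l * t <= 2)%R%:R.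
Proof.
pose K k := projT1 (cid2 (poly_bounded01 step_poly^`(k))).
have K0 k : 0 <= K k by rewrite /K; case: cid2.
have KP k t : 0 <= t <= 1 -> `|step_poly^`(k).[t]| <= K k.
  by rewrite /K; case: cid2 => //= x _; exact.
exists (1 + \sum_(k < 5) K k); first by rewrite lerDl sumr_ge0.
move=> l k t /andP[l0 l1] k4.
have Kk : K k.+1 <= 1 + \sum_(i < 5) K i.
  rewrite (bigD1 (Ordinal (k4 : (k.+1 < 5)%N)))//= addrCA lerDl.
  by rewrite addr_ge0// sumr_ge0.
rewrite /gstep -[_%:R]/(0 : R) sub0r normrN normrM ger0_norm ?exprn_ge0 ?(ltW l0)//.
have [/andP[t1 t2]|] := boolP (1 <= l * t <= 2).
  rewrite mulr1 mulrC ler_pM ?exprn_ge0 ?(ltW l0)//.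
    by rewrite (le_trans (KP _ _ (clamp01_itv _))).
  by rewrite exprS ler_piMr ?(ltW l0)// exprn_ile1// ltW.
rewrite negb_and -!ltNge mulr0 => /orP[lt|lt].
  by rewrite clamp01_le0 ?step_poly_flat0 ?normr0 ?mulr0//; lra.
by rewrite clamp01_ge1 ?step_poly_flat1 ?normr0 ?mulr0//; lra.
Qed.

End smooth_step.

Section softmax.
Context {R : realType} {p : nat}.
Implicit Types a b : 'I_p -> R.

Definition sexp a : R := \sum_j expR (a j).
(** The gradient of [ln (sexp a)]. *)
Definition wt a (j : 'I_p) : R := expR (a j) / sexp a.

Hypothesis p0 : (0 < p)%N.

Lemma sexp_gt0 a : 0 < sexp a.
Proof.
rewrite /sexp (bigD1 (Ordinal p0))//= ltr_pwDl ?expR_gt0//.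
by apply: sumr_ge0 => j _; exact: expR_ge0.
Qed.

Lemma wt_ge0 a j : 0 <= wt a j.
Proof. by rewrite divr_ge0 ?expR_ge0// ltW// sexp_gt0. Qed.

Lemma sum_wt a : \sum_j wt a j = 1.
Proof. by rewrite -mulr_suml divff// gt_eqF// sexp_gt0. Qed.

Lemma sexp_perturb a b (r : R) : (forall j, `|b j| <= r) ->
  expR (- r) * sexp a <= sexp (a \+ b) <= expR r * sexp a.
Proof.
move=> br; rewrite /sexp !mulr_sumr; apply/andP; split; apply: ler_sum => j _ /=;
  by rewrite -expRD ler_expR; have := br j; rewrite ler_norml; lra.
Qed.

Lemma ln_sexp_perturb a b (r : R) : (forall j, `|b j| <= r) ->
  `|ln (sexp (a \+ b)) - ln (sexp a)| <= r.
Proof.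
move=> /(sexp_perturb a) /andP[lo hi].
have pos := sexp_gt0.
rewrite ler_norml lerBrDr lerBlDr; apply/andP; split.
  by rewrite -[- r]expRK -lnM ?posrE ?expR_gt0// ler_ln ?posrE ?mulr_gt0 ?expR_gt0.
by rewrite -[r]expRK -lnM ?posrE ?expR_gt0// ler_ln ?posrE ?mulr_gt0 ?expR_gt0.
Qed.

(** Numerator and denominator change by a factor between [expR (- r)] and
    [expR r] each. *)
Lemma wt_perturb a b (r : R) j : (forall j, `|b j| <= r) ->
  wt (a \+ b) j <= expR (2 * r) * wt a j.
Proof.
move=> br; have /andP[lo _] := sexp_perturb a br.
rewrite /wt mulrA ler_pdivrMr ?sexp_gt0// mulrAC.
have -> : expR (2 * r) = expR r * expR r by rewrite -expRD; congr expR; ring.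
rewrite -!mulrA; apply: (@le_trans _ _ (expR r * expR (a j))).
  by rewrite -expRD ler_expR; have := br j; rewrite ler_norml /=; lra.
rewrite ler_wpM2l ?expR_ge0// mulrCA ler_peMr ?expR_ge0//.
rewrite mulrA ler_pdivlMr ?sexp_gt0// mul1r.
by rewrite -ler_pdivrMl ?expR_gt0// -expRN.
Qed.

Lemma wt_perturb_ge a b (r : R) j : (forall j, `|b j| <= r) ->
  wt a j <= expR (2 * r) * wt (a \+ b) j.
Proof.
move=> br; have := @wt_perturb (a \+ b) (\- b) r j.
have -> : (a \+ b) \+ (\- b) = a by apply/funext => i /=; rewrite addrK.
by apply => i; rewrite /= normrN.
Qed.

Lemma ln_sexp_ge a j : a j <= ln (sexp a).
Proof.
rewrite -[leLHS]expRK ler_ln ?posrE ?expR_gt0 ?sexp_gt0//.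
by rewrite /sexp (bigD1 j)//= lerDl; apply: sumr_ge0 => i _; exact: expR_ge0.
Qed.

Lemma ln_sexp_le a (c : R) : (forall j, a j <= c) -> ln (sexp a) <= c + ln p%:R.
Proof.
move=> ac; have p1 : 0 < p%:R :> R by rewrite ltr0n.
rewrite -[X in X + _]expRK -lnM ?posrE ?expR_gt0// ler_ln ?posrE ?sexp_gt0//.
  rewrite (@le_trans _ _ (\sum_(j < p) expR c))//.
    by apply: ler_sum => j _; rewrite ler_expR.
  by rewrite sumr_const card_ord mulr_natr.
by rewrite mulr_gt0 ?expR_gt0.
Qed.

End softmax.

(** * Derivatives of the soft maximum along a line *)

Section weighted_moments.
Context {R : realType} {p : nat}.

Definition mom (w b : 'I_p -> R) (k : nat) : R := \sum_j w j * b j ^+ k.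

Variables (w b : 'I_p -> R).
Hypotheses (w0 : forall j, 0 <= w j) (w1 : \sum_j w j = 1).
Let M := mom w b.

Lemma mom_ge0 k : 0 <= M k.*2.
Proof. by apply: sumr_ge0 => j _; rewrite mulr_ge0// -mul2n exprM exprn_ge0// sqr_ge0. Qed.

Lemma mom_jensen2 : M 1 ^+ 2 <= M 2.
Proof.
rewrite -subr_ge0.
suff H c : 0 <= M 2 - 2 * c * M 1 + c ^+ 2 by have := H (M 1); lra.
have -> : M 2 - 2 * c * M 1 + c ^+ 2 = \sum_j w j * (b j - c) ^+ 2.
  have -> : c ^+ 2 = c ^+ 2 * \sum_j w j by rewrite w1 mulr1.
  rewrite /M /mom !mulr_sumr -sumrB -big_split/=.
  by apply: eq_bigr => j _; ring.
by apply: sumr_ge0 => j _; rewrite mulr_ge0 ?sqr_ge0.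
Qed.

Lemma mom_jensen4 : M 2 ^+ 2 <= M 4.
Proof.
rewrite -subr_ge0.
suff H c : 0 <= M 4 - 2 * c * M 2 + c ^+ 2 by have := H (M 2); lra.
have -> : M 4 - 2 * c * M 2 + c ^+ 2 = \sum_j w j * (b j ^+ 2 - c) ^+ 2.
  have -> : c ^+ 2 = c ^+ 2 * \sum_j w j by rewrite w1 mulr1.
  rewrite /M /mom !mulr_sumr -sumrB -big_split/=.
  by apply: eq_bigr => j _; ring.
by apply: sumr_ge0 => j _; rewrite mulr_ge0 ?sqr_ge0.
Qed.

Lemma mom_square_ge0 s : 0 <= M 4 - 2 * s * M 3 + s ^+ 2 * M 2.
Proof.
have -> : M 4 - 2 * s * M 3 + s ^+ 2 * M 2 =
    \sum_j w j * (b j ^+ 2 - s * b j) ^+ 2.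
  rewrite /M /mom !mulr_sumr -sumrB -big_split/=.
  by apply: eq_bigr => j _; ring.
by apply: sumr_ge0 => j _; rewrite mulr_ge0 ?sqr_ge0.
Qed.

(** All products of moments of total order four are dominated by the fourth
    moment: this is why the fourth derivative only sees [M 4]. *)
Lemma mom_products_le :
  [/\ 0 <= M 1 ^+ 4 <= M 4, 0 <= M 1 ^+ 2 * M 2 <= M 4, 0 <= M 2 ^+ 2 <= M 4
    & - M 4 <= M 1 * M 3 <= M 4].
Proof.
have j2 := mom_jensen2; have j4 := mom_jensen4.
have M2ge0 : 0 <= M 2 := mom_ge0 1.
have M12 : 0 <= M 1 ^+ 2 * M 2 by rewrite mulr_ge0 ?sqr_ge0.
have M122 : M 1 ^+ 2 * M 2 <= M 2 ^+ 2 by rewrite [leRHS]expr2 ler_wpM2r.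
have M14 : M 1 ^+ 4 <= M 1 ^+ 2 * M 2.
  by rewrite (exprD _ 2 2) ler_wpM2l ?sqr_ge0.
have M140 : 0 <= M 1 ^+ 4 by rewrite (exprD _ 2 2) -expr2 sqr_ge0.
have := mom_square_ge0 (M 1); have := mom_square_ge0 (- M 1); rewrite sqrrN.
have -> : M 4 - 2 * - M 1 * M 3 + M 1 ^+ 2 * M 2 =
  M 4 + 2 * (M 1 * M 3) + M 1 ^+ 2 * M 2 by ring.
have -> : M 4 - 2 * M 1 * M 3 + M 1 ^+ 2 * M 2 =
  M 4 - 2 * (M 1 * M 3) + M 1 ^+ 2 * M 2 by ring.
by split; lra.
Qed.

End weighted_moments.

Section fourth_derivative.
Context {R : realType}.

(** The derivatives of order one to four of [G (ln s)], [s] a sum of exponentials, in terms of the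
    derivatives [g_k] of [G] and the moments [m_k] of the exponential weights. *)
Definition dsm1 (g1 m1 : R) := g1 * m1.
Definition dsm2 (g1 g2 m1 m2 : R) := g2 * m1 ^+ 2 + g1 * (m2 - m1 ^+ 2).
Definition dsm3 (g1 g2 g3 m1 m2 m3 : R) :=
  g3 * m1 ^+ 3 + 3 * g2 * (m1 * (m2 - m1 ^+ 2))
  + g1 * (m3 - 3 * m1 * m2 + 2 * m1 ^+ 3).
Definition dsm4 (g1 g2 g3 g4 m1 m2 m3 m4 : R) :=
  g4 * m1 ^+ 4 + 6 * g3 * (m1 ^+ 2 * (m2 - m1 ^+ 2))
  + g2 * (3 * (m2 - m1 ^+ 2) ^+ 2 + 4 * m1 * (m3 - 3 * m1 * m2 + 2 * m1 ^+ 3))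
  + g1 * (m4 - 4 * m1 * m3 - 3 * m2 ^+ 2 + 12 * m1 ^+ 2 * m2 - 6 * m1 ^+ 4).

Lemma dsm4_bound (B g1 g2 g3 g4 m1 m2 m3 m4 : R) :
  `|g1| <= B -> `|g2| <= B -> `|g3| <= B -> `|g4| <= B ->
  [/\ 0 <= m1 ^+ 4 <= m4, 0 <= m1 ^+ 2 * m2 <= m4, 0 <= m2 ^+ 2 <= m4
    & - m4 <= m1 * m3 <= m4] ->
  `|dsm4 g1 g2 g3 g4 m1 m2 m3 m4| <= 60 * B * m4.
Proof.
move=> g1B g2B g3B g4B [/andP[a0 a1] /andP[b0 b1] /andP[c0 c1] /andP[d0 d1]].
have mulB (g x c : R) : `|g| <= B -> `|x| <= c * m4 -> `|g * x| <= c * (B * m4).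
  by move=> gB xc; rewrite normrM (le_trans (ler_pM _ _ gB xc))// mulrCA.
have -> : 60 * B * m4 = 1 * (B * m4) + 6 * (B * m4) + 27 * (B * m4) + 26 * (B * m4).
  by ring.
rewrite /dsm4 (le_trans (ler_normD _ _))// lerD//; last first.
  apply: mulB => //.
  have -> : m4 - 4 * m1 * m3 - 3 * m2 ^+ 2 + 12 * m1 ^+ 2 * m2 - 6 * m1 ^+ 4 =
    m4 - 4 * (m1 * m3) - 3 * (m2 ^+ 2) + 12 * (m1 ^+ 2 * m2) - 6 * (m1 ^+ 4) by ring.
  by rewrite ler_norml; lra.
rewrite (le_trans (ler_normD _ _))// lerD//; last first.
  apply: mulB => //.
  have -> : 3 * (m2 - m1 ^+ 2) ^+ 2 + 4 * m1 * (m3 - 3 * m1 * m2 + 2 * m1 ^+ 3) =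
    3 * m2 ^+ 2 - 18 * (m1 ^+ 2 * m2) + 11 * m1 ^+ 4 + 4 * (m1 * m3) by ring.
  by rewrite ler_norml; lra.
rewrite (le_trans (ler_normD _ _))// lerD//.
  by apply: mulB => //; rewrite mul1r ger0_norm.
rewrite -mulrA [in leLHS]mulrCA; apply: mulB => //.
have -> : 6 * (m1 ^+ 2 * (m2 - m1 ^+ 2)) = 6 * (m1 ^+ 2 * m2) - 6 * m1 ^+ 4 by ring.
by rewrite ler_norml; lra.
Qed.

End fourth_derivative.

Section softmax_derivative.
Context {R : realType} {p : nat}.
Hypothesis p0 : (0 < p)%N.
Variables (a b : 'I_p -> R).

Let line (t : R) : 'I_p -> R := fun j => a j + t * b j.
Let q t := ln (sexp (line t)).
Let W t k := mom (wt (line t)) b k.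

Let is_derive_line j t : is_derive (t : R) (1 : R) (fun t => line t j) (b j).
Proof. by apply: is_derive_eq; rewrite /GRing.scale/=; ring. Qed.

Let is_derive_lse t : is_derive (t : R) (1 : R) q (W t 1%N).
Proof.
have de j : is_derive (t : R) (1 : R) (expR \o (fun t => line t j))
    (expR (line t j) * b j).
  exact: is_derive1_comp.
have ds : is_derive (t : R) (1 : R) (fun t => sexp (line t))
    (\sum_j expR (line t j) * b j).
  have -> : (fun t => sexp (line t)) = \sum_j (expR \o (fun t => line t j)).
    by apply/funext => u; rewrite fct_sumE.
  by apply: is_derive_eq.
have dl := @is_derive1_ln R _ (sexp_gt0 p0 (line t)).
have := @is_derive1_comp _ (@ln R) (fun t => sexp (line t)) t _ _ dl ds.
move=> dq; apply: is_derive_eq; rewrite mulr_sumr /W /mom.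
by apply: eq_bigr => j _; rewrite /wt expr1; ring.
Qed.

Let is_derive_wt j t :
  is_derive (t : R) (1 : R) (fun t => wt (line t) j) (wt (line t) j * (b j - W t 1%N)).
Proof.
have wtE u : wt (line u) j = expR (line u j - q u).
  by rewrite expRD expRN /q lnK// posrE sexp_gt0.
have -> : (fun t => wt (line t) j) = expR \o (fun t => line t j - q t).
  by apply/funext => u /=; rewrite wtE.
rewrite wtE; apply: is_derive1_comp; exact: is_deriveB.
Qed.

Let is_derive_mom k t :
  is_derive (t : R) (1 : R) (fun t => W t k) (W t k.+1 - W t 1%N * W t k).
Proof.
have -> : (fun t => W t k) = \sum_j ((b j ^+ k) \*: (fun t => wt (line t) j)).
  by apply/funext => u; rewrite fct_sumE; apply: eq_bigr => j _;
    rewrite mulrC.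
have dj j := @is_deriveZ _ _ _ _ (b j ^+ k) _ _ _ (is_derive_wt j t).
apply: is_derive_eq; set m1 := W t 1%N; rewrite /W /mom mulr_sumr -sumrB.
by apply: eq_bigr => j _; rewrite /GRing.scale/= exprS; ring.
Qed.

Variable g : nat -> R -> R.
Hypothesis dg : forall k t, (k < 4)%N -> is_derive (t : R) (1 : R) (g k) (g k.+1 t).

Let G t k := g k (q t).

Let is_derive_G k t : (k < 4)%N ->
  is_derive (t : R) (1 : R) (fun t => G t k) (G t k.+1 * W t 1%N).
Proof.
move=> k4.
exact: (@is_derive1_comp _ (g k) q t _ _ (dg (q t) k4) (is_derive_lse t)).
Qed.

Let h1 t := dsm1 (G t 1%N) (W t 1%N).
Let h2 t := dsm2 (G t 1%N) (G t 2%N) (W t 1%N) (W t 2%N).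
Let h3 t := dsm3 (G t 1%N) (G t 2%N) (G t 3%N) (W t 1%N) (W t 2%N) (W t 3%N).
Let h4 t :=
  dsm4 (G t 1%N) (G t 2%N) (G t 3%N) (G t 4%N) (W t 1%N) (W t 2%N) (W t 3%N) (W t 4%N).

(** Along a line the weights satisfy [w_j' = w_j * (b_j - M_1)], hence their moments
    satisfy [M_k' = M_(k+1) - M_1 * M_k], and every derivative is a polynomial in
    moments. *)
Lemma softmax_taylor (K : R) :
  (forall t, 0 <= t <= 1 -> `|h4 t| <= K) ->
  `|g 0%N (ln (sexp (a \+ b))) - g 0%N (ln (sexp a)) - h1 0 - h2 0 / 2 - h3 0 / 6| <= K.
Proof.
have dG0 t := @is_derive_G 0%N t isT; have dG1 t := @is_derive_G 1%N t isT.
have dG2 t := @is_derive_G 2%N t isT; have dG3 t := @is_derive_G 3%N t isT.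
have dW1 := is_derive_mom 1%N; have dW2 := is_derive_mom 2%N.
have dW3 := is_derive_mom 3%N.
move=> h4K.
have := @taylor_order4 _ (fun t => G t 0%N) h1 h2 h3 h4 K _ _ _ _ h4K.
have -> : G 1 0%N = g 0%N (ln (sexp (a \+ b))).
  by rewrite /G /q /line; congr (g 0%N (ln (sexp _))); apply/funext => j; rewrite mul1r.
have -> : G 0 0%N = g 0%N (ln (sexp a)).
  by rewrite /G /q /line; congr (g 0%N (ln (sexp _))); apply/funext => j; rewrite mul0r addr0.
apply.
- by move=> t; rewrite /h1 /dsm1; apply: is_derive_eq; rewrite /h2 /dsm2 /GRing.scale/=; ring.
- by move=> t; rewrite /h2 /dsm2; apply: is_derive_eq; rewrite /h3 /dsm3 /GRing.scale/=; ring.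
- by move=> t; rewrite /h3 /dsm3; apply: is_derive_eq; rewrite /h4 /dsm4 /GRing.scale/=; ring.
Qed.

End softmax_derivative.

(** * Smooth approximation of the indicator of an orthant *)

Section smooth_orthant.
Context {R : realType}.

Lemma sum_dirac (p : nat) (j : 'I_p) (F : 'I_p -> R) :
  \sum_k (j == k)%:R * F k = F j.
Proof.
rewrite (bigD1 j)//= eqxx mul1r big1 ?addr0// => k kj.
by rewrite eq_sym (negbTE kj) mul0r.
Qed.

(** A smoothed version of the indicator of [a <= 0] whose transition zone has
    width of order [l^-1]. *)
Definition smooth_orthant (p : nat) (l : R) (a : 'I_p -> R) : R :=
  gstep l 0 (ln (sexp a)).

(** The transition zone, enlarged by [r]. *)
Definition strip (p : nat) (l r : R) (a : 'I_p -> R) : R :=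
  (l^-1 - r <= ln (sexp a) <= 2 * l^-1 + r)%R%:R.

Definition poly3 (p : nat) (c1 : 'I_p -> R) (c2 : 'I_p -> 'I_p -> R)
    (c3 : 'I_p -> 'I_p -> 'I_p -> R) (b : 'I_p -> R) : R :=
  \sum_j c1 j * b j + \sum_j \sum_k c2 j k * (b j * b k)
  + \sum_j \sum_k \sum_m c3 j k m * (b j * b k * b m).

Lemma strip_ge0 p l r (a : 'I_p -> R) : 0 <= strip l r a.
Proof. exact: ler0n. Qed.

Lemma strip_le1 p l r (a : 'I_p -> R) : strip l r a <= 1.
Proof. by rewrite /strip lern1; case: (_ && _). Qed.

Lemma strip_perturb p (l r s : R) (a b : 'I_p -> R) : (0 < p)%N ->
  (forall j, `|b j| <= s) -> strip l r (a \+ b) <= strip l (r + s) a.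
Proof.
move=> p0 bs; have := ln_sexp_perturb p0 a bs.
rewrite ler_norml => /andP[h1 h2]; rewrite /strip.
case: (boolP (_ <= ln (sexp (_ \+ _)) <= _)) => [/andP[h3 h4]|_]; last exact: ler0n.
by rewrite ler_nat lt0b; apply/andP; split; lra.
Qed.

Lemma strip_perturb_ge p (l r s : R) (a b : 'I_p -> R) : (0 < p)%N ->
  (forall j, `|b j| <= s) -> strip l r a <= strip l (r + s) (a \+ b).
Proof.
move=> p0 bs; have := @strip_perturb p l r s (a \+ b) (\- b) p0.
have -> : (a \+ b) \+ (\- b) = a by apply/funext => i /=; rewrite addrK.
by apply => j; rewrite /= normrN.
Qed.

Section taylor_coefficients.
Variables (p : nat) (w : 'I_p -> R) (g1 g2 g3 : R).
Hypotheses (w0 : forall j, 0 <= w j) (w1 : \sum_j w j = 1).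

(** Second and third order terms written as forms in the increment: in this shape
    the moments of a random increment can be pulled out. *)
Definition coef2 (j k : 'I_p) : R :=
  (g2 * (w j * w k) + g1 * ((j == k)%:R * w j - w j * w k)) / 2.

Definition coef3 (j k m : 'I_p) : R :=
  (g3 * (w j * w k * w m) + 3 * g2 * (w j * ((k == m)%:R * w k - w k * w m))
   + g1 * ((j == k)%:R * ((k == m)%:R * w j)
           - 3 * (w j * ((k == m)%:R * w k)) + 2 * (w j * w k * w m))) / 6.

Lemma sum_coef2 b : \sum_j \sum_k coef2 j k * (b j * b k) =
  dsm2 g1 g2 (mom w b 1) (mom w b 2) / 2.
Proof.
set M1 := mom w b 1.
transitivity (\sum_j w j * b j * ((g2 - g1) / 2 * M1 + g1 / 2 * b j)).
  apply: eq_bigr => j _.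
  rewrite -[X in _ + _ * X](sum_dirac j b) /M1 /mom !mulr_sumr -big_split/=.
  by rewrite mulr_sumr; apply: eq_bigr => k _; rewrite /coef2; field.
transitivity ((g2 - g1) / 2 * M1 * M1 + g1 / 2 * mom w b 2).
  rewrite {2}/M1 /mom !mulr_sumr -big_split/=.
  by apply: eq_bigr => j _; ring.
by rewrite /dsm2; field.
Qed.

Lemma sum_coef3 b : \sum_j \sum_k \sum_m coef3 j k m * (b j * b k * b m) =
  dsm3 g1 g2 g3 (mom w b 1) (mom w b 2) (mom w b 3) / 6.
Proof.
set M1 := mom w b 1; set M2 := mom w b 2.
pose A := (g3 - 3 * g2 + 2 * g1) / 6; pose C := (3 * g2 - 3 * g1) / 6.
transitivity (\sum_j \sum_k w j * b j * (A * (w k * b k) * M1 +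
    C * (w k * b k ^+ 2)) + \sum_j \sum_k (j == k)%:R * (g1 / 6 * (w j * b j * b k ^+ 2))).
  rewrite -big_split/=; apply: eq_bigr => j _.
  rewrite -big_split/=; apply: eq_bigr => k _.
  pose al := A * (w j * w k).
  pose be := C * (w j * w k) + (j == k)%:R * (g1 / 6 * w j).
  transitivity (\sum_m (b j * b k * al * (w m * b m ^+ 1) +
      b j * b k * be * ((k == m)%:R * b m))).
    by apply: eq_bigr => m _; rewrite /coef3 /al /be /A /C; field.
  rewrite big_split/= -!mulr_sumr sum_dirac -/(mom w b 1) -/M1 /al /be.
  by ring.
under [X in _ + X]eq_bigr do rewrite sum_dirac.
transitivity (\sum_j (w j * b j * (A * M1 * M1 + C * M2 + g1 / 6 * b j ^+ 2))).
  rewrite -big_split/=; apply: eq_bigr => j _.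
  suff -> : \sum_k w j * b j * (A * (w k * b k) * M1 + C * (w k * b k ^+ 2)) =
      w j * b j * (A * M1 * M1 + C * M2) by ring.
  rewrite -mulr_sumr; congr (_ * _).
  transitivity (\sum_k (A * M1 * (w k * b k ^+ 1) + C * (w k * b k ^+ 2))).
    by apply: eq_bigr => k _; ring.
  rewrite big_split/= -!mulr_sumr -/(mom w b 1) -/(mom w b 2) -/M1 -/M2.
  by ring.
transitivity ((A * M1 * M1 + C * M2) * M1 + g1 / 6 * mom w b 3).
  transitivity (\sum_j ((A * M1 * M1 + C * M2) * (w j * b j ^+ 1)
      + g1 / 6 * (w j * b j ^+ 3))).
    by apply: eq_bigr => j _; ring.
  by rewrite big_split/= -!mulr_sumr.
by rewrite /dsm3 /A /C; field.
Qed.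

Variable B : R.
Hypotheses (g1B : `|g1| <= B) (g2B : `|g2| <= B) (g3B : `|g3| <= B).

Lemma sum_norm_coef2 : \sum_j \sum_k `|coef2 j k| <= 3 * B.
Proof.
have B0 : 0 <= B by rewrite (le_trans _ g1B).
have -> : 3 * B = \sum_j \sum_k (2 * B * (w j * w k) + B * ((j == k)%:R * w j)).
  transitivity (\sum_j (3 * B * w j)); first by rewrite -mulr_sumr w1 mulr1.
  apply: eq_bigr => j _; rewrite big_split/= -!mulr_sumr w1 (sum_dirac j (fun=> w j)).
  by ring.
apply: ler_sum => j _; apply: ler_sum => k _; rewrite /coef2 normrM.
have w00 : 0 <= w j * w k by rewrite mulr_ge0.
have dw : 0 <= (j == k)%:R * w j by rewrite mulr_ge0.
rewrite (ger0_norm (_ : 0 <= 2^-1)) ?invr_ge0// ler_pdivrMr//.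
rewrite (le_trans (ler_normD _ _))// !normrM.
have H1 : `|g2| * (w j * w k) <= B * (w j * w k) by rewrite ler_wpM2r.
have H2 : `|g1| * `|(j == k)%:R * w j - w j * w k| <=
    B * ((j == k)%:R * w j + w j * w k).
  rewrite ler_pM// (le_trans (ler_normB _ _))// (ger0_norm dw) (ger0_norm w00)//.
rewrite !(ger0_norm (w0 _)).
have := mulr_ge0 B0 w00; have := mulr_ge0 B0 dw; lra.
Qed.

Lemma sum_norm_coef3 : \sum_j \sum_k \sum_m `|coef3 j k m| <= 13 * B.
Proof.
have B0 : 0 <= B by rewrite (le_trans _ g1B).
have -> : 13 * B = \sum_j \sum_k \sum_m (6 * B * (w j * w k * w m)
    + 6 * B * (w j * ((k == m)%:R * w k)) + B * ((j == k)%:R * ((k == m)%:R * w j))).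
  transitivity (\sum_j (13 * B * w j)); first by rewrite -mulr_sumr w1 mulr1.
  apply: eq_bigr => j _.
  transitivity (\sum_k (12 * B * (w j * w k) + B * ((j == k)%:R * w j))).
    rewrite big_split/= -!mulr_sumr w1 (sum_dirac j (fun=> w j)).
    by ring.
  apply: eq_bigr => k _; rewrite !big_split/= -!mulr_sumr w1.
  rewrite (sum_dirac k (fun=> w k)) (sum_dirac k (fun=> w j)).
  by ring.
apply: ler_sum => j _; apply: ler_sum => k _; apply: ler_sum => m _.
rewrite /coef3 normrM.
set x := w j * w k * w m; set y := (k == m)%:R * w k.
set z := (j == k)%:R * ((k == m)%:R * w j).
have x0 : 0 <= x by rewrite !mulr_ge0.
have y0 : 0 <= w j * y by rewrite !mulr_ge0.
have z0 : 0 <= z by rewrite !mulr_ge0.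
rewrite (ger0_norm (_ : 0 <= 6^-1)) ?invr_ge0// ler_pdivrMr//.
have mulB (g u v : R) : `|g| <= B -> `|u| <= v -> `|g * u| <= B * v.
  by move=> gB uv; rewrite normrM ler_pM.
have H1 : `|g3 * x| <= B * x by rewrite mulB// ger0_norm.
have H2 : `|3 * g2 * (w j * (y - w k * w m))| <= B * (3 * (w j * y + x)).
  rewrite (_ : 3 * _ * _ = g2 * (3 * (w j * y - x))); last by rewrite /x; ring.
  by apply: mulB => //; rewrite ler_norml; lra.
have H3 : `|g1 * (z - 3 * (w j * y) + 2 * x)| <= B * (z + 3 * (w j * y) + 2 * x).
  by apply: mulB => //; rewrite ler_norml; lra.
rewrite (le_trans (ler_normD _ _))// (le_trans (lerD (ler_normD _ _) (lexx _)))//.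
rewrite (le_trans (lerD (lerD H1 H2) H3))//.
have := mulr_ge0 B0 x0; have := mulr_ge0 B0 y0; have := mulr_ge0 B0 z0.
by move=> *; lra.
Qed.

End taylor_coefficients.

(** Along the segment from [a] to [a \+ b] the weights of a small increment [b] stay
    comparable to those at [a], and the strip grows by at most 2.  Therefore the
    remainder is a weighted sum of fourth powers with weights that depend on the
    base point only, and summing it over coordinates costs nothing in the
    dimension. *)
Lemma smooth_orthant_expansion : exists2 C : R, 1 <= C &
  forall (p : nat) (l : R) (a : 'I_p -> R), (0 < p)%N -> 0 < l <= 1 ->
  exists c1 c2 c3, [/\
    \sum_j \sum_k `|c2 j k| <= C * l * strip l 0 a,
    \sum_j \sum_k \sum_m `|c3 j k m| <= C * l * strip l 0 a,
    (forall b : 'I_p -> R, (forall j, `|b j| <= 2) ->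
      `|smooth_orthant l (a \+ b) - smooth_orthant l a - poly3 c1 c2 c3 b|
      <= C * l * (strip l 2 a * \sum_j wt a j * b j ^+ 4)) &
    (forall (b : 'I_p -> R) (N : R), (forall j, `|b j| <= N) ->
      `|smooth_orthant l (a \+ b) - smooth_orthant l a - poly3 c1 c2 c3 b|
      <= C * l * N ^+ 4)].
Proof.
have [K K1 Kg] := @gstep_deriv_bound R.
have K0 : 0 <= K by rewrite (le_trans _ K1).
have e4 : 1 <= expR 4 :> R by rewrite -[leLHS]expR0 ler_expR.
have KC c : 0 <= c -> c <= 60 -> c * K <= 60 * K * expR 4.
  by move=> c0 c1; rewrite -[leLHS]mulr1 ler_pM ?mulr_ge0// ler_wpM2r.
exists (60 * K * expR 4); first by rewrite (le_trans K1)// -[leLHS]mul1r KC; lra.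
move=> p l a p0 l01; have /andP[l0 l1] := l01.
have stripE (a' : 'I_p -> R) : (1 <= l * ln (sexp a') <= 2)%R%:R = strip l 0 a' :> R.
  rewrite /strip subr0 addr0; congr ((nat_of_bool (_ && _))%:R).
    by rewrite -[l^-1]mulr1 ler_pdivrMl.
  by rewrite ler_pdivlMr// mulrC.
pose G k (a' : 'I_p -> R) : R := gstep l k (ln (sexp a')).
have GB k (a' : 'I_p -> R) : (k < 4)%N -> `|G k.+1 a'| <= K * l * strip l 0 a'.
  by move=> k4; rewrite -stripE Kg.
have B0 r (a' : 'I_p -> R) : 0 <= K * l * strip l r a'.
  by rewrite !mulr_ge0 ?strip_ge0// ltW.
exists (fun j => G 1%N a * wt a j), (coef2 (wt a) (G 1%N a) (G 2%N a)),
  (coef3 (wt a) (G 1%N a) (G 2%N a) (G 3%N a)).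
have w0 := wt_ge0 p0 a; have w1 := sum_wt p0 a.
have poly3E b : poly3 (fun j => G 1%N a * wt a j) (coef2 (wt a) (G 1%N a) (G 2%N a))
    (coef3 (wt a) (G 1%N a) (G 2%N a) (G 3%N a)) b =
  dsm1 (G 1%N a) (mom (wt a) b 1) +
  dsm2 (G 1%N a) (G 2%N a) (mom (wt a) b 1) (mom (wt a) b 2) / 2 +
  dsm3 (G 1%N a) (G 2%N a) (G 3%N a) (mom (wt a) b 1) (mom (wt a) b 2)
    (mom (wt a) b 3) / 6.
  rewrite /poly3 sum_coef2 sum_coef3; congr (_ + _ + _).
  by rewrite /dsm1 /mom mulr_sumr; apply: eq_bigr => j _; rewrite expr1 mulrA.
pose line (b : 'I_p -> R) t := fun j => a j + t * b j.
have rem b X : (forall t, 0 <= t <= 1 ->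
    60 * (K * l * strip l 0 (line b t)) * mom (wt (line b t)) b 4 <= X) ->
    `|smooth_orthant l (a \+ b) - smooth_orthant l a -
      poly3 (fun j => G 1%N a * wt a j) (coef2 (wt a) (G 1%N a) (G 2%N a))
        (coef3 (wt a) (G 1%N a) (G 2%N a) (G 3%N a)) b| <= X.
  move=> HX.
  have := @softmax_taylor R p p0 a b (gstep l) (fun k t k4 => is_derive_gstep l t k4) X.
  rewrite poly3E (_ : (fun j => a j + 0 * b j) = a); last first.
    by apply/funext => j; rewrite mul0r addr0.
  rewrite !opprD !addrA; apply => t t01.
  apply: (le_trans _ (HX _ t01)).
  apply: dsm4_bound; try exact: GB.
  by apply: mom_products_le; [exact: wt_ge0|exact: sum_wt].
split.
- rewrite (le_trans (sum_norm_coef2 w0 w1 (GB 0%N a isT) (GB 1%N a isT)))//.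
  by rewrite !mulrA ler_wpM2r ?strip_ge0// ler_wpM2r ?(ltW l0)// KC//; lra.
- rewrite (le_trans (sum_norm_coef3 w0 w1 (GB 0%N a isT) (GB 1%N a isT) (GB 2%N a isT)))//.
  by rewrite !mulrA ler_wpM2r ?strip_ge0// ler_wpM2r ?(ltW l0)// KC//; lra.
- move=> b b2; apply: rem => t /andP[t0 t1].
  have tb2 j : `|t * b j| <= 2.
    by rewrite normrM ger0_norm// (le_trans _ (b2 j))// ler_piMl.
  have -> : line b t = a \+ (fun j => t * b j) by [].
  have st := strip_perturb l 0 a p0 tb2; rewrite add0r in st.
  have m4 : mom (wt (a \+ (fun j => t * b j))) b 4 <= expR 4 * \sum_j wt a j * b j ^+ 4.
    rewrite mulr_sumr; apply: ler_sum => j _; rewrite mulrA ler_wpM2r//.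
      by rewrite (exprM _ 2 2) sqr_ge0.
    by rewrite (le_trans (wt_perturb p0 _ _ tb2))// -natrM.
  have m40 : 0 <= mom (wt (a \+ (fun j => t * b j))) b 4.
    by apply: (@mom_ge0 _ _ _ b _ 2) => j; exact: wt_ge0.
  rewrite [leRHS](_ : _ = 60 * (K * l) *
    (strip l 2 a * (expR 4 * \sum_j wt a j * b j ^+ 4))); last by ring.
  rewrite mulrA -[leLHS]mulrA ler_wpM2l ?mulr_ge0 ?(ltW l0)//.
  by rewrite ler_pM ?strip_ge0.
- move=> b N bN; apply: rem => t _.
  have m4 : mom (wt (line b t)) b 4 <= N ^+ 4.
    rewrite -[leRHS]mul1r -(sum_wt p0 (line b t)) mulr_suml.
    apply: ler_sum => j _; rewrite ler_wpM2l ?wt_ge0//.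
    rewrite (_ : b j ^+ 4 = `|b j| ^+ 4); last first.
      by rewrite -normrX ger0_norm// (exprM _ 2 2) sqr_ge0.
    by rewrite lerXn2r ?nnegrE// (le_trans _ (bN j)).
  have m40 : 0 <= mom (wt (line b t)) b 4.
    by apply: (@mom_ge0 _ _ _ b _ 2) => j; exact: wt_ge0.
  rewrite ler_pM ?mulr_ge0 ?strip_ge0 ?(ltW l0)// !mulrA -[leRHS]mulr1 ler_pM ?strip_ge0 ?strip_le1//.
    by rewrite !mulr_ge0 ?(ltW l0).
  by rewrite ler_wpM2r ?(ltW l0)// KC.
Qed.

End smooth_orthant.

(** * Expectations and averaging operators *)

(** Real-valued expectation, locked so that unification never looks inside. *)
HB.lock Definition Ex {d : measure_display} {T : measurableType d} {R : realType}
  (P : probability T R) (f : T -> R) : R := Rintegral P setT f.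
Canonical Ex_unlockable := Unlockable Ex.unlock.

Section expectation.
Context {d : measure_display} {T : measurableType d} {R : realType}.
Variable P : probability T R.
Implicit Types f g : T -> R.

Definition rint f := P.-integrable setT (EFin \o f).

Lemma rint_dom f g : measurable_fun setT f -> (forall w, `|f w| <= g w) ->
  rint g -> rint f.
Proof.
move=> mf fg; apply: le_integrable => //; first exact/measurable_EFinP.
by move=> w _; rewrite lee_fin (le_trans (fg w))// ler_norm.
Qed.

Lemma rint_cst r : rint (fun=> r).
Proof. exact: finite_measure_integrable_cst. Qed.

Lemma rint_bounded f M : measurable_fun setT f -> (forall w, `|f w| <= M) -> rint f.
Proof. by move=> mf fM; apply: (rint_dom mf fM); exact: rint_cst. Qed.

Lemma rintD f g : rint f -> rint g -> rint (fun w => f w + g w).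
Proof. by move=> fi gi; apply: eq_integrable (integrableD measurableT fi gi). Qed.

Lemma rintB f g : rint f -> rint g -> rint (fun w => f w - g w).
Proof. by move=> fi gi; apply: eq_integrable (integrableB measurableT fi gi). Qed.

Lemma rintZ r f : rint f -> rint (fun w => r * f w).
Proof. by move=> fi; apply: eq_integrable (integrableZl measurableT r fi). Qed.

Lemma rint_sum (I : Type) (s : seq I) (F : I -> T -> R) :
  (forall i, rint (F i)) -> rint (fun w => \sum_(i <- s) F i w).
Proof.
move=> Fi; rewrite /rint (_ : _ \o _ = fun w => (\sum_(i <- s) (F i w)%:E)%E).
  apply: (@integrable_sum _ _ _ P setT measurableT I s xpredT (fun i => EFin \o F i)).
  by move=> i _; exact: Fi.
by apply/funext => w /=; rewrite sumEFin.
Qed.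

Lemma Ex_cst r : Ex P (fun=> r) = r.
Proof.
rewrite unlock Rintegral_cst// -[RHS]mulr1; congr (_ * _).
by rewrite -[RHS]/(fine (1%E : \bar R)); congr fine; exact: probability_setT.
Qed.

Lemma ExD f g : rint f -> rint g -> Ex P (fun w => f w + g w) = Ex P f + Ex P g.
Proof. by move=> fi gi; rewrite unlock; exact: RintegralD. Qed.

Lemma ExB f g : rint f -> rint g -> Ex P (fun w => f w - g w) = Ex P f - Ex P g.
Proof. by move=> fi gi; rewrite unlock; exact: RintegralB. Qed.

Lemma ExZ r f : rint f -> Ex P (fun w => r * f w) = r * Ex P f.
Proof. by move=> fi; rewrite unlock; exact: RintegralZl. Qed.

Lemma Ex_sum (I : Type) (s : seq I) (F : I -> T -> R) : (forall i, rint (F i)) ->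
  Ex P (fun w => \sum_(i <- s) F i w) = \sum_(i <- s) Ex P (F i).
Proof.
move=> Fi; elim: s => [|i s ih].
  rewrite big_nil -[RHS](Ex_cst 0); congr Ex; apply/funext => w.
  by rewrite big_nil.
rewrite big_cons -ih -ExD//; last exact: rint_sum.
by congr Ex; apply/funext => w; rewrite big_cons.
Qed.

Lemma le_Ex f g : rint f -> rint g -> (forall w, f w <= g w) -> Ex P f <= Ex P g.
Proof. by move=> fi gi fg; rewrite unlock; apply: le_Rintegral. Qed.

Lemma Ex_ge0 f : (forall w, 0 <= f w) -> 0 <= Ex P f.
Proof. by move=> f0; rewrite unlock; apply: Rintegral_ge0. Qed.

Lemma le_norm_Ex f g : rint f -> rint g -> (forall w, `|f w| <= g w) ->
  `|Ex P f| <= Ex P g.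
Proof.
move=> fi gi fg; rewrite ler_norml -[- Ex P g]mulN1r -ExZ//.
apply/andP; split; apply: le_Ex => //; first exact: rintZ.
  by move=> w; have := fg w; rewrite ler_norml mulN1r => /andP[].
by move=> w; rewrite (le_trans (ler_norm _)).
Qed.

Lemma Ex_indic (A : set T) : measurable A -> Ex P (\1_A) = fine (P A).
Proof. by move=> mA; rewrite unlock /Rintegral integral_indic// setIT. Qed.

Lemma EFin_Ex f : rint f -> ((Ex P f)%:E = \int[P]_w (f w)%:E)%E.
Proof. by move=> fi; rewrite unlock /Rintegral fineK//; exact: integrable_fin_num. Qed.

End expectation.

Section fubini.
Context {d1 d2 : measure_display} {T1 : measurableType d1} {T2 : measurableType d2}.
Context {R : realType}.
Variables (P1 : probability T1 R) (P2 : probability T2 R).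

Lemma product_bounded_integrable (F : T1 * T2 -> R) (M : R) :
  measurable_fun setT F -> (forall z, `|F z| <= M) ->
  (P1 \x P2)%E.-integrable setT (EFin \o F).
Proof.
move=> mF FM; apply: measurable_bounded_integrable => //.
  have e : (P1 \x P2)%E setT = 1%E.
    rewrite -setXTT; etransitivity; first exact: product_measure1E.
    by rewrite -[RHS]mule1; congr (_ * _)%E; exact: probability_setT.
  by apply: (@le_lt_trans _ _ 1%E); [rewrite -e|exact: ltry].
by exists M; split; rewrite ?num_real// => x Mx y _; exact: le_trans (FM y) (ltW Mx).
Qed.

Lemma EFin_Ex_section (F : T1 * T2 -> R) (M : R) x :
  measurable_fun setT F -> (forall z, `|F z| <= M) ->
  (Ex P2 (fun y => F (x, y)))%:E = (\int[P2]_y (F (x, y))%:E)%E.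
Proof.
move=> mF FM; rewrite EFin_Ex//; apply: (@rint_bounded _ _ _ _ _ M) => //.
by apply: measurableT_comp => //; exact: measurable_pair1.
Qed.

Lemma measurable_Ex_section (F : T1 * T2 -> R) (M : R) :
  measurable_fun setT F -> (forall z, `|F z| <= M) ->
  measurable_fun setT (fun x => Ex P2 (fun y => F (x, y))).
Proof.
move=> mF FM; apply/measurable_EFinP.
have := measurable_fubini_F (product_bounded_integrable mF FM).
rewrite (_ : fubini_F _ _ = EFin \o fun x => Ex P2 (fun y => F (x, y)))//.
by apply/funext => x /=; rewrite (EFin_Ex_section x mF FM).
Qed.

Lemma Ex_product (F : T1 * T2 -> R) (M : R) :
  measurable_fun setT F -> (forall z, `|F z| <= M) ->
  (Ex P1 (fun x => Ex P2 (fun y => F (x, y))))%:E = (\int[P1 \x P2]_z (F z)%:E)%E.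
Proof.
move=> mF FM.
have [b bE] : exists b, forall x, `|Ex P2 (fun y => F (x, y))| <= b.
  exists M => x; rewrite -[leRHS](Ex_cst P2 M); apply: le_norm_Ex => //.
    apply: (@rint_bounded _ _ _ _ _ M) => //.
    by apply: measurableT_comp => //; exact: measurable_pair1.
  exact: rint_cst.
rewrite EFin_Ex; last exact: rint_bounded (measurable_Ex_section mF FM) bE.
rewrite -(integral12_prod_meas1 (product_bounded_integrable mF FM)).
by apply: eq_integral => x _; rewrite (EFin_Ex_section x mF FM).
Qed.

End fubini.

Lemma Ex_exchange d1 d2 (T1 : measurableType d1) (T2 : measurableType d2)
    (R : realType) (P1 : probability T1 R) (P2 : probability T2 R)
    (F : T1 -> T2 -> R) (M : R) :
  measurable_fun setT (fun z => F z.1 z.2) -> (forall x y, `|F x y| <= M) ->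
  Ex P1 (fun x => Ex P2 (F x)) = Ex P2 (fun y => Ex P1 (F^~ y)).
Proof.
move=> mF FM; pose F' (z : T1 * T2) := F z.1 z.2.
pose G (z : T2 * T1) := F z.2 z.1.
have mG : measurable_fun setT G.
  rewrite (_ : G = F' \o (fun z => (z.2, z.1)))//; apply: measurableT_comp => //.
  exact: measurable_fun_pair.
have F'M z : `|F' z| <= M by exact: FM.
have GM z : `|G z| <= M by exact: FM.
apply: EFin_inj; rewrite (Ex_product P1 P2 mF F'M).
have /= -> := Ex_product P2 P1 mG GM.
rewrite -(integral12_prod_meas1 (product_bounded_integrable P1 P2 mF F'M)).
rewrite -(integral21_prod_meas1 (product_bounded_integrable P2 P1 mG GM)).
by [].
Qed.

Section averaging.
Context {d : measure_display} {T : measurableType d} {R : realType} {p : nat}.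
Variable P : probability T R.
Local Notation E := (p.-tuple R).
Implicit Types (f g : E -> R) (Y Z : T -> E).

Definition vadd (x y : E) : E := [tuple tnth x j + tnth y j | j < p].
Definition vzero : E := [tuple 0 | j < p].

Lemma tnth_vadd x y j : tnth (vadd x y) j = tnth x j + tnth y j.
Proof. by rewrite tnth_mktuple. Qed.

Lemma vaddA x y z : vadd x (vadd y z) = vadd (vadd x y) z.
Proof. by apply: eq_from_tnth => j; rewrite !tnth_vadd addrA. Qed.

Lemma vaddAC x y z : vadd (vadd x y) z = vadd (vadd x z) y.
Proof. by apply: eq_from_tnth => j; rewrite !tnth_vadd addrAC. Qed.

Lemma vaddC x y : vadd x y = vadd y x.
Proof. by apply: eq_from_tnth => j; rewrite !tnth_vadd addrC. Qed.

Lemma measurable_vadd d' (T' : measurableType d') (X Y : T' -> E) :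
  measurable_fun setT X -> measurable_fun setT Y ->
  measurable_fun setT (fun w => vadd (X w) (Y w)).
Proof.
move=> mX mY; apply/measurable_fun_tnthP => j.
rewrite (_ : _ \o _ = (fun w => tnth (X w) j + tnth (Y w) j)); last first.
  by apply/funext => w /=; rewrite tnth_vadd.
by apply: measurable_funD;
  [exact: (measurableT_comp (measurable_tnth j) mX)
  |exact: (measurableT_comp (measurable_tnth j) mY)].
Qed.

Definition bmeas f := measurable_fun setT f /\ exists M, forall x, `|f x| <= M.

Lemma bmeas_cst r : bmeas (fun=> r).
Proof. by split; [exact: measurable_cst|exists `|r|]. Qed.

Lemma bmeasD f g : bmeas f -> bmeas g -> bmeas (fun x => f x + g x).
Proof.
move=> [mf [M fM]] [mg [N gN]]; split; first exact: measurable_funD.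
by exists (M + N) => x; rewrite (le_trans (ler_normD _ _))// lerD.
Qed.

Lemma bmeasZ r f : bmeas f -> bmeas (fun x => r * f x).
Proof.
move=> [mf [M fM]]; split; first exact: measurable_funM.
by exists (`|r| * M) => x; rewrite normrM ler_wpM2l.
Qed.

Lemma bmeasB f g : bmeas f -> bmeas g -> bmeas (fun x => f x - g x).
Proof.
move=> bf bg; have := bmeasD bf (bmeasZ (-1) bg).
by congr bmeas; apply/funext => x; rewrite mulN1r.
Qed.

Lemma bmeasM f g : bmeas f -> bmeas g -> bmeas (fun x => f x * g x).
Proof.
move=> [mf [M fM]] [mg [N gN]]; split; first exact: measurable_funM.
by exists (M * N) => x; rewrite normrM ler_pM.
Qed.

Lemma bmeas_sum (I : Type) (s : seq I) (F : I -> E -> R) :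
  (forall i, bmeas (F i)) -> bmeas (fun x => \sum_(i <- s) F i x).
Proof.
move=> bF; elim: s => [|i s ih].
  by under eq_fun do rewrite big_nil; exact: bmeas_cst.
by under eq_fun do rewrite big_cons; exact: bmeasD.
Qed.

Lemma bmeas_comp f Y : bmeas f -> measurable_fun setT Y ->
  rint P (fun w => f (Y w)).
Proof.
move=> [mf [M fM]] mY; apply: (@rint_bounded _ _ _ _ _ M) => //.
exact: measurableT_comp.
Qed.

Lemma rint_shift f x Y : bmeas f -> measurable_fun setT Y ->
  rint P (fun w => f (vadd x (Y w))).
Proof.
move=> bf mY; apply: (@bmeas_comp f (fun w => vadd x (Y w))) => //.
exact: measurable_vadd.
Qed.

(** The convolution operator of the law of [Y]. *)
Definition avg Y f : E -> R := fun x => Ex P (fun w => f (vadd x (Y w))).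

Lemma bmeas_avg Y f : measurable_fun setT Y -> bmeas f -> bmeas (avg Y f).
Proof.
move=> mY bf; have [mf [M fM]] := bf; split; last first.
  exists M => x; rewrite -[leRHS](Ex_cst P M); apply: le_norm_Ex => //.
    exact: rint_shift.
  exact: rint_cst.
pose F (z : E * T) := f (vadd z.1 (Y z.2)).
have mF : measurable_fun setT F.
  apply: measurableT_comp => //; apply: measurable_vadd => //.
  exact: measurableT_comp.
move=> mE; apply: (measurable_Ex_section (dirac vzero) P mF) => //.
by move=> z; exact: fM.
Qed.

(** Addition of vectors being commutative, this is Fubini's theorem. *)
Lemma avgC Y Z f x : measurable_fun setT Y -> measurable_fun setT Z -> bmeas f ->
  avg Y (avg Z f) x = avg Z (avg Y f) x.
Proof.
move=> mY mZ [mf [M fM]]; rewrite /avg.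
rewrite (@Ex_exchange _ _ _ _ _ _ _ _ M)//; last first.
  apply: measurableT_comp => //.
  apply: measurable_vadd; last exact: measurableT_comp.
  by apply: measurable_vadd => //; exact: measurableT_comp.
congr Ex; apply/funext => w; congr Ex; apply/funext => w'.
by rewrite vaddAC.
Qed.

Lemma avgD Y f g x : measurable_fun setT Y -> bmeas f -> bmeas g ->
  avg Y (fun x => f x + g x) x = avg Y f x + avg Y g x.
Proof. by move=> mY bf bg; apply: ExD; exact: rint_shift. Qed.

Lemma avgZ Y r f x : measurable_fun setT Y -> bmeas f ->
  avg Y (fun x => r * f x) x = r * avg Y f x.
Proof. by move=> mY bf; apply: ExZ; exact: rint_shift. Qed.

Lemma avg_cst Y r x : avg Y (fun=> r) x = r.
Proof. exact: Ex_cst. Qed.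

Lemma le_avg Y f g x : measurable_fun setT Y -> bmeas f -> bmeas g ->
  (forall x, f x <= g x) -> avg Y f x <= avg Y g x.
Proof. by move=> mY bf bg fg; apply: le_Ex => //; exact: rint_shift. Qed.

End averaging.

(** * Interpolation between two families of laws *)

Section interpolation.
Context {d : measure_display} {T : measurableType d} {R : realType} {p : nat}.
Variable P : probability T R.
Context {I : eqType}.
Variables (Y Z : I -> T -> p.-tuple R).
Hypotheses (mY : forall i, measurable_fun setT (Y i))
  (mZ : forall i, measurable_fun setT (Z i)).
Implicit Types (f g : p.-tuple R -> R) (u : R) (s : seq I).

Definition mix u i f : p.-tuple R -> R :=
  fun x => u * avg P (Y i) f x + (1 - u) * avg P (Z i) f x.

(** The mean of [f] under the convolution of the mixtures indexed by [s]. *)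
Fixpoint interp u s f : R :=
  if s is i :: s' then interp u s' (mix u i f) else f (vzero).

Definition gap i f : p.-tuple R -> R :=
  fun x => avg P (Y i) f x - avg P (Z i) f x.

Lemma bmeas_mix u i f : bmeas f -> bmeas (mix u i f).
Proof. by move=> bf; apply: bmeasD; apply: bmeasZ; exact: bmeas_avg. Qed.

Lemma bmeas_gap i f : bmeas f -> bmeas (gap i f).
Proof. by move=> bf; apply: bmeasB; exact: bmeas_avg. Qed.

Lemma mixD u i f g : bmeas f -> bmeas g ->
  mix u i (fun x => f x + g x) = (fun x => mix u i f x + mix u i g x).
Proof.
by move=> bf bg; apply/funext => x; rewrite /mix !avgD//; ring.
Qed.

Lemma mixZ u i r f : bmeas f -> mix u i (fun x => r * f x) = (fun x => r * mix u i f x).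
Proof. by move=> bf; apply/funext => x; rewrite /mix !avgZ//; ring. Qed.

Lemma mix_cst u i r : mix u i (fun=> r) = (fun=> r).
Proof. by apply/funext => x; rewrite /mix !avg_cst; ring. Qed.

Lemma avg_mix W u i f x : measurable_fun setT W -> bmeas f ->
  avg P W (mix u i f) x =
  u * avg P W (avg P (Y i) f) x + (1 - u) * avg P W (avg P (Z i) f) x.
Proof.
move=> mW bf; have bY := bmeas_avg P (mY i) bf; have bZ := bmeas_avg P (mZ i) bf.
rewrite /mix avgD//; [|exact: bmeasZ bY|exact: bmeasZ bZ].
by rewrite (avgZ _ _ _ mW bY) (avgZ _ _ _ mW bZ).
Qed.

Lemma mixC u i k f : bmeas f -> mix u i (mix u k f) = mix u k (mix u i f).
Proof.
move=> bf; apply/funext => x; rewrite /mix -/(mix u k f) -/(mix u i f) !avg_mix//.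
rewrite (avgC P x (mY i) (mY k) bf) (avgC P x (mY i) (mZ k) bf).
by rewrite (avgC P x (mZ i) (mY k) bf) (avgC P x (mZ i) (mZ k) bf); ring.
Qed.

Lemma interpD u s f g : bmeas f -> bmeas g ->
  interp u s (fun x => f x + g x) = interp u s f + interp u s g.
Proof.
elim: s f g => [//|i s ih] f g bf bg /=.
by rewrite mixD// ih//; exact: bmeas_mix.
Qed.

Lemma interpZ u s r f : bmeas f -> interp u s (fun x => r * f x) = r * interp u s f.
Proof.
elim: s f => [//|i s ih] f bf /=; rewrite mixZ// ih//; exact: bmeas_mix.
Qed.

Lemma interpB u s f g : bmeas f -> bmeas g ->
  interp u s (fun x => f x - g x) = interp u s f - interp u s g.
Proof.
move=> bf bg; rewrite -[- interp u s g]mulN1r -interpZ// -interpD//; last exact: bmeasZ.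
by congr interp; apply/funext => x; rewrite mulN1r.
Qed.

Lemma interp_cst u s r : interp u s (fun=> r) = r.
Proof. by elim: s => [//|i s ih] /=; rewrite mix_cst. Qed.

Lemma interp_sum u s (J : Type) (r : seq J) (F : J -> p.-tuple R -> R) :
  (forall j, bmeas (F j)) ->
  interp u s (fun x => \sum_(j <- r) F j x) = \sum_(j <- r) interp u s (F j).
Proof.
move=> bF; elim: r => [|j r ih].
  rewrite big_nil -[RHS](interp_cst u s); congr interp.
  by apply/funext => x; rewrite big_nil.
rewrite big_cons -ih -interpD//; last exact: bmeas_sum.
by congr interp; apply/funext => x; rewrite big_cons.
Qed.

Lemma le_mix u i f g x : 0 <= u <= 1 -> bmeas f -> bmeas g ->
  (forall x, f x <= g x) -> mix u i f x <= mix u i g x.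
Proof.
move=> /andP[u0 u1] bf bg fg; rewrite /mix lerD// ler_wpM2l ?subr_ge0//;
  exact: le_avg.
Qed.

Lemma le_interp u s f g : 0 <= u <= 1 -> bmeas f -> bmeas g ->
  (forall x, f x <= g x) -> interp u s f <= interp u s g.
Proof.
move=> u01; elim: s f g => [|i s ih] f g bf bg fg /=; first exact: fg.
by apply: ih => [||x]; [exact: bmeas_mix|exact: bmeas_mix|exact: le_mix].
Qed.

Lemma le_norm_interp u s f g : 0 <= u <= 1 -> bmeas f -> bmeas g ->
  (forall x, `|f x| <= g x) -> `|interp u s f| <= interp u s g.
Proof.
move=> u01 bf bg fg; rewrite ler_norml; apply/andP; split.
  rewrite -[- interp u s g]mulN1r -interpZ//; apply: le_interp => //.
    exact: bmeasZ.
  by move=> x; have := fg x; rewrite ler_norml mulN1r => /andP[].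
by apply: le_interp => // x; exact: le_trans (ler_norm _) (fg x).
Qed.

(** The averaging operators commute, so any of them can be applied first. *)
Lemma interp_rem u s i f : bmeas f -> i \in s ->
  interp u s f = interp u (rem i s) (mix u i f).
Proof.
elim: s f => [//|k s ih] f bf; rewrite inE /= eq_sym.
have [->//|ki /= si] := eqVneq k i.
by rewrite (ih _ (bmeas_mix u k bf) si) (mixC u i k bf).
Qed.

Lemma gap_avgC i k f : bmeas f ->
  gap k (avg P (Y i) f) = avg P (Y i) (gap k f) /\
  gap k (avg P (Z i) f) = avg P (Z i) (gap k f).
Proof.
move=> bf; have key W : measurable_fun setT W ->
    gap k (avg P W f) = avg P W (gap k f).
  move=> mW; apply/funext => x; rewrite /gap.
  rewrite (avgC P x (mY k) mW bf) (avgC P x (mZ k) mW bf).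
  rewrite -[- _]mulN1r -avgZ//; last exact: bmeas_avg.
  rewrite -avgD//; [|exact: bmeas_avg|apply: bmeasZ; exact: bmeas_avg].
  by congr (avg P W _ x); apply/funext => y; rewrite mulN1r.
by split; exact: key.
Qed.

Lemma interp_mix u v s i f : bmeas f -> interp u s (mix v i f) =
  v * interp u s (avg P (Y i) f) + (1 - v) * interp u s (avg P (Z i) f).
Proof.
move=> bf; have bY := bmeas_avg P (mY i) bf; have bZ := bmeas_avg P (mZ i) bf.
by rewrite (interpD _ _ (bmeasZ v bY) (bmeasZ (1 - v) bZ)) !interpZ.
Qed.

(** The interpolated mean is a polynomial in [u]; differentiating it replaces one
    mixture at a time by the difference of the two laws, while all other
    summands keep the same mixing weight. *)
Lemma is_derive_interp s f u : uniq s -> bmeas f ->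
  is_derive (u : R) (1 : R) (fun u => interp u s f)
    (\sum_(i <- s) interp u (rem i s) (gap i f)).
Proof.
elim: s f => [|i s ih] f /=.
  by rewrite big_nil => *; exact: is_derive_cst.
move=> /andP[is_ us] bf.
have bY : bmeas (avg P (Y i) f) by exact: bmeas_avg.
have bZ : bmeas (avg P (Z i) f) by exact: bmeas_avg.
have dY := ih _ us bY; have dZ := ih _ us bZ.
have -> : (fun u => interp u s (mix u i f)) =
    (fun u => u * interp u s (avg P (Y i) f) + (1 - u) * interp u s (avg P (Z i) f)).
  by apply/funext => v; rewrite interp_mix.
apply: is_derive_eq.
rewrite big_cons eqxx (interpB u s bY bZ) /GRing.scale/=.
have -> : \sum_(k <- s) interp u (if i == k then s else i :: rem k s) (gap k f) =
    u * (\sum_(k <- s) interp u (rem k s) (gap k (avg P (Y i) f))) +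
    (1 - u) * (\sum_(k <- s) interp u (rem k s) (gap k (avg P (Z i) f))).
  rewrite !mulr_sumr -big_split; apply: eq_big_seq => k ks.
  case: eqP => [ik|_]; first by rewrite ik ks in is_.
  have [-> ->] := gap_avgC i k bf.
  exact: interp_mix (bmeas_gap k bf).
set a := interp _ _ _; set b := interp _ _ _.
ring.
Qed.

End interpolation.

(** * Averaging a four-term expansion *)

Section sup_norm_facts.
Context {R : realType} {p : nat}.
Implicit Types v w : p.-tuple R.

Lemma sup_norm_ge0 v : 0 <= sup_norm v.
Proof. by rewrite /sup_norm; elim/big_ind: _ => // a b a0 b0; rewrite le_max a0. Qed.

Lemma le_sup_norm v j : `|tnth v j| <= sup_norm v.
Proof. exact: (le_bigmax_cond 0 (fun j => `|tnth v j|)). Qed.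

Lemma sup_norm_le v c : 0 <= c -> (forall j, `|tnth v j| <= c) -> sup_norm v <= c.
Proof. by move=> c0 vc; apply: bigmax_le. Qed.

Lemma sup_norm_vadd v w : sup_norm (vadd v w) <= sup_norm v + sup_norm w.
Proof.
apply: sup_norm_le => [|j]; first by rewrite addr_ge0 ?sup_norm_ge0.
by rewrite tnth_vadd (le_trans (ler_normD _ _))// lerD// le_sup_norm.
Qed.

Lemma measurable_sup_norm d (T : measurableType d) (V : T -> p.-tuple R) :
  measurable_fun setT V -> measurable_fun setT (fun t => sup_norm (V t)).
Proof.
move=> mV; rewrite /sup_norm; elim: (index_enum _) => [|j s ih].
  by under eq_fun do rewrite big_nil; exact: measurable_cst.
under eq_fun do rewrite big_cons; apply: measurable_maxr => //.
apply: measurableT_comp => //.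
exact: (measurableT_comp (measurable_tnth j) mV).
Qed.

Definition tail4 (t : R) v : R := (t < sup_norm v)%R%:R * sup_norm v ^+ 4.

Lemma tail4_ge0 t v : 0 <= tail4 t v.
Proof. by rewrite mulr_ge0 ?exprn_ge0 ?sup_norm_ge0. Qed.

Lemma tail4_le t v : tail4 t v <= sup_norm v ^+ 4.
Proof.
by rewrite ler_piMl ?exprn_ge0 ?sup_norm_ge0// lern1; case: (_ < _).
Qed.

Lemma tail4_mono s t v : s <= t -> tail4 t v <= tail4 s v.
Proof.
move=> st; rewrite /tail4 ler_wpM2r ?exprn_ge0 ?sup_norm_ge0//.
by case: (ltP t) => // tv; rewrite (le_lt_trans st tv).
Qed.

Lemma tail4_vadd v w : tail4 2 (vadd v w) <= 16 * (tail4 1 v + tail4 1 w).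
Proof.
have v0 := sup_norm_ge0 v; have w0 := sup_norm_ge0 w.
have key a b : 0 <= a -> a <= b -> 2 < sup_norm (vadd v w) ->
    sup_norm (vadd v w) <= a + b ->
    sup_norm (vadd v w) ^+ 4 <= 16 * ((1 < b)%R%:R * b ^+ 4).
  move=> a0 ab lt2 le; have -> : (1 < b)%R by lra.
  rewrite mul1r (_ : 16 * _ = (2 * b) ^+ 4); last by ring.
  by rewrite lerXn2r ?nnegrE ?sup_norm_ge0//; lra.
rewrite {1}/tail4; case: ltP => [lt2|_]; last first.
  by rewrite mul0r mulr_ge0// addr_ge0 ?tail4_ge0.
have t1 := tail4_ge0 1 v; have t2 := tail4_ge0 1 w.
have le := sup_norm_vadd v w; rewrite mul1r.
have [vw|/ltW wv] := leP (sup_norm v) (sup_norm w).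
  have := key _ _ v0 vw lt2 le; rewrite -/(tail4 1 w); lra.
have := key _ _ w0 wv lt2; rewrite addrC -/(tail4 1 v) => /(_ le); lra.
Qed.

End sup_norm_facts.

Section averaged_expansion.
Context {d : measure_display} {T : measurableType d} {R : realType} {p : nat}.
Variable P : probability T R.
Local Notation E := (p.-tuple R).
Implicit Types V W : T -> E.

Definition centered4 V := [/\ measurable_fun setT V,
  rint P (fun w => sup_norm (V w) ^+ 4) & forall j, Ex P (fun w => tnth (V w) j) = 0].

Definition mom2 V (j k : 'I_p) := Ex P (fun w => tnth (V w) j * tnth (V w) k).
Definition mom3 V (j k m : 'I_p) :=
  Ex P (fun w => tnth (V w) j * tnth (V w) k * tnth (V w) m).
Definition mom4 V (j : 'I_p) := Ex P (fun w => tnth (V w) j ^+ 4).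
Definition tail V := Ex P (fun w => tail4 1 (V w)).

Lemma mom4_ge0 V j : 0 <= mom4 V j.
Proof. by apply: Ex_ge0 => w; rewrite (exprM _ 2 2) sqr_ge0. Qed.

Lemma tail_ge0 V : 0 <= tail V.
Proof. by apply: Ex_ge0 => w; exact: tail4_ge0. Qed.

Section monomials.
Variable V : T -> E.
Hypothesis cV : centered4 V.

Let N w := sup_norm (V w).

Let mV : measurable_fun setT V. Proof. by case: cV. Qed.

Let mVj j : measurable_fun setT (fun w => tnth (V w) j).
Proof. exact: (measurableT_comp (measurable_tnth j) mV). Qed.

Let N0 w : 0 <= N w. Proof. exact: sup_norm_ge0. Qed.

Let rN : rint P (fun w => 1 + N w ^+ 4).
Proof. by case: cV => _ rV _; apply: rintD => //; exact: rint_cst. Qed.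

Let powle (t : R) k : 0 <= t -> (k <= 4)%N -> t ^+ k <= 1 + t ^+ 4.
Proof.
move=> t0 k4; have [t1|/ltW t1] := leP t 1.
  by rewrite (@le_trans _ _ 1) ?exprn_ile1// lerDl exprn_ge0.
by rewrite (le_trans (ler_weXn2l t1 k4))// lerDr.
Qed.

Lemma rint_tnth j : rint P (fun w => tnth (V w) j).
Proof.
apply: rint_dom rN => // w; apply: (le_trans (le_sup_norm _ _)).
exact: (powle (N0 w) (isT : (1 <= 4)%N)).
Qed.

Lemma rint_tnth2 j k : rint P (fun w => tnth (V w) j * tnth (V w) k).
Proof.
apply: rint_dom rN => [|w]; first exact: measurable_funM.
by rewrite normrM (le_trans _ (powle (N0 w) (isT : (2 <= 4)%N)))// expr2
  ler_pM// le_sup_norm.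
Qed.

Lemma rint_tnth3 j k m : rint P (fun w => tnth (V w) j * tnth (V w) k * tnth (V w) m).
Proof.
apply: rint_dom rN => [|w]; first by do 2! apply: measurable_funM => //.
rewrite !normrM (le_trans _ (powle (N0 w) (isT : (3 <= 4)%N)))// exprSr expr2.
by rewrite !ler_pM ?mulr_ge0// le_sup_norm.
Qed.

Lemma rint_tnth4 j : rint P (fun w => tnth (V w) j ^+ 4).
Proof.
apply: rint_dom rN => [|w]; first exact: measurable_funX.
rewrite normrX (le_trans _ (powle (N0 w) (isT : (4 <= 4)%N)))//.
by rewrite lerXn2r ?nnegrE// le_sup_norm.
Qed.

Lemma rint_tail4 t : rint P (fun w => tail4 t (V w)).
Proof.
apply: rint_dom rN => [|w]; last first.
  by rewrite ger0_norm ?tail4_ge0// (le_trans (tail4_le _ _))// lerDr.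
have mN := measurable_sup_norm mV.
have -> : (fun w => tail4 t (V w)) = fun w =>
    \1_[set w | (t < sup_norm (V w))%R] w * sup_norm (V w) ^+ 4.
  apply/funext => w; rewrite /tail4 indicE; congr ((nat_of_bool _)%:R * _).
  by apply/idP/idP => [h|/set_mem//]; rewrite ?mem_set.
apply: measurable_funM; last exact: measurable_funX.
apply: measurable_indic.
rewrite (_ : [set w | _] = (fun w => sup_norm (V w)) @^-1` `]t, +oo[%classic).
  by rewrite -[X in measurable X]setTI; apply: mN => //; exact: measurable_itv.
by apply/seteqP; split => w /=; rewrite in_itv/= andbT.
Qed.

Lemma Ex_tnth j : Ex P (fun w => tnth (V w) j) = 0.
Proof. by case: cV. Qed.

Variables (c1 : 'I_p -> R) (c2 : 'I_p -> 'I_p -> R) (c3 : 'I_p -> 'I_p -> 'I_p -> R).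

Lemma rint_poly3 : rint P (fun w => poly3 c1 c2 c3 (tnth (V w))).
Proof.
do 2? apply: rintD.
- by apply: rint_sum => j; apply: rintZ; exact: rint_tnth.
- by do 2! apply: rint_sum => ?; apply: rintZ; exact: rint_tnth2.
- by do 3! apply: rint_sum => ?; apply: rintZ; exact: rint_tnth3.
Qed.

Lemma Ex_poly3 : Ex P (fun w => poly3 c1 c2 c3 (tnth (V w))) =
  \sum_j \sum_k c2 j k * mom2 V j k + \sum_j \sum_k \sum_m c3 j k m * mom3 V j k m.
Proof.
have r1 j : rint P (fun w => c1 j * tnth (V w) j) by apply: rintZ; exact: rint_tnth.
have r2 j k : rint P (fun w => c2 j k * (tnth (V w) j * tnth (V w) k)).
  by apply: rintZ; exact: rint_tnth2.
have r3 j k m : rint P (fun w => c3 j k m * (tnth (V w) j * tnth (V w) k * tnth (V w) m)).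
  by apply: rintZ; exact: rint_tnth3.
have r2' j : rint P (fun w => \sum_k c2 j k * (tnth (V w) j * tnth (V w) k)).
  exact: rint_sum.
have r3' j k : rint P (fun w => \sum_m c3 j k m *
    (tnth (V w) j * tnth (V w) k * tnth (V w) m)).
  exact: rint_sum.
have r3'' j : rint P (fun w => \sum_k \sum_m c3 j k m *
    (tnth (V w) j * tnth (V w) k * tnth (V w) m)).
  exact: rint_sum.
rewrite ExD; [|by apply: rintD; exact: rint_sum|exact: rint_sum].
rewrite ExD; [|exact: rint_sum..].
rewrite Ex_sum// big1 ?add0r; last by move=> j _; rewrite ExZ ?Ex_tnth ?mulr0//; exact: rint_tnth.
rewrite Ex_sum// Ex_sum//; congr (_ + _); apply: eq_bigr => j _.
  rewrite Ex_sum//; apply: eq_bigr => k _; rewrite ExZ//; exact: rint_tnth2.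
rewrite Ex_sum//; apply: eq_bigr => k _; rewrite Ex_sum//; apply: eq_bigr => m _.
by rewrite ExZ//; exact: rint_tnth3.
Qed.

End monomials.

Variables (f : E -> R) (x : E) (K : R) (w : 'I_p -> R).
Variables (c1 : 'I_p -> R) (c2 : 'I_p -> 'I_p -> R) (c3 : 'I_p -> 'I_p -> 'I_p -> R).
Hypotheses (bf : bmeas f) (K0 : 0 <= K) (w0 : forall j, 0 <= w j).
Hypothesis expansion : forall v, `|f (vadd x v) - f x - poly3 c1 c2 c3 (tnth v)| <=
  K * (\sum_j w j * tnth v j ^+ 4 + tail4 2 v).

Definition quartic V : R := \sum_j w j * mom4 V j + tail V.

Let rquart V : centered4 V -> rint P (fun t => \sum_j w j * tnth (V t) j ^+ 4).
Proof. by move=> cV; apply: rint_sum => j; apply: rintZ; exact: rint_tnth4. Qed.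

Let Equart V : centered4 V ->
  Ex P (fun t => \sum_j w j * tnth (V t) j ^+ 4) = \sum_j w j * mom4 V j.
Proof.
move=> cV; rewrite Ex_sum => [|j]; last by apply: rintZ; exact: rint_tnth4.
by apply: eq_bigr => j _; rewrite ExZ//; exact: rint_tnth4.
Qed.

Lemma avg_expansion V : centered4 V ->
  `|avg P V f x - f x - (\sum_j \sum_k c2 j k * mom2 V j k +
     \sum_j \sum_k \sum_m c3 j k m * mom3 V j k m)| <= K * quartic V.
Proof.
move=> cV; have [mV _ _] := cV.
rewrite -(Ex_poly3 cV c1) -{1}(Ex_cst P (f x)) -ExB; [|exact: rint_shift|exact: rint_cst].
rewrite -ExB; [|by apply: rintB; [exact: rint_shift|exact: rint_cst]|exact: rint_poly3].
rewrite /quartic -Equart// -ExD ?ExZ//; [|exact: rquart|exact: rint_tail4..].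
rewrite -ExZ; last by apply: rintD; [exact: rquart|exact: rint_tail4].
apply: le_norm_Ex.
- by do 2? apply: rintB; [exact: rint_shift|exact: rint_cst|exact: rint_poly3].
- by apply: rintZ; apply: rintD; [exact: rquart|exact: rint_tail4].
- move=> t; apply: (le_trans (expansion _)); rewrite ler_wpM2l// lerD2l.
  by apply: tail4_mono; lra.
Qed.

Let cross (a b : 'I_p -> R) : R :=
  poly3 c1 c2 c3 (a \+ b) - poly3 c1 c2 c3 a - poly3 c1 c2 c3 b.

Let crossE a b : cross a b =
  \sum_j \sum_k c2 j k * (a j * b k + b j * a k) +
  \sum_j \sum_k \sum_m c3 j k m * (a j * a k * b m + a j * a m * b k + a k * a m * b j
    + (b k * b m * a j + b j * b m * a k + b j * b k * a m)).
Proof.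
rewrite /cross /poly3.
have -> : \sum_j c1 j * (a \+ b) j = \sum_j c1 j * a j + \sum_j c1 j * b j.
  by rewrite -big_split/=; apply: eq_bigr => j _; rewrite mulrDr.
have -> : \sum_j \sum_k c2 j k * ((a \+ b) j * (a \+ b) k) =
    \sum_j \sum_k c2 j k * (a j * a k) + \sum_j \sum_k c2 j k * (b j * b k) +
    \sum_j \sum_k c2 j k * (a j * b k + b j * a k).
  rewrite -!big_split/=; apply: eq_bigr => j _; rewrite -!big_split/=.
  by apply: eq_bigr => k _; ring.
have -> : \sum_j \sum_k \sum_m c3 j k m * ((a \+ b) j * (a \+ b) k * (a \+ b) m) =
    \sum_j \sum_k \sum_m c3 j k m * (a j * a k * a m) +
    \sum_j \sum_k \sum_m c3 j k m * (b j * b k * b m) +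
    \sum_j \sum_k \sum_m c3 j k m * (a j * a k * b m + a j * a m * b k + a k * a m * b j
      + (b k * b m * a j + b j * b m * a k + b j * b k * a m)).
  rewrite -!big_split/=; apply: eq_bigr => j _; rewrite -!big_split/=.
  apply: eq_bigr => k _; rewrite -!big_split/=.
  by apply: eq_bigr => m _; ring.
by ring.
Qed.

(** The average of the cross terms over the first vector is linear in the second
    one, hence averages to zero. *)
Let crosslin V (b : 'I_p -> R) : R := \sum_j \sum_k \sum_m c3 j k m *
  (mom2 V j k * b m + mom2 V j m * b k + mom2 V k m * b j).

Let rint_cross V b : centered4 V -> rint P (fun t => cross (tnth (V t)) b).
Proof.
move=> cV; rewrite (_ : (fun t => _) = fun t => poly3 c1 c2 c3 (tnth (V t) \+ b)
  - poly3 c1 c2 c3 (tnth (V t)) - poly3 c1 c2 c3 b)//.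
have r1 := rint_tnth cV; have r2 := rint_tnth2 cV; have r3 := rint_tnth3 cV.
under eq_fun do rewrite -/(cross _ _) crossE.
apply: rintD.
  do 2! apply: rint_sum => ?; apply: rintZ; apply: rintD.
    by under eq_fun do rewrite mulrC; exact: rintZ.
  exact: rintZ.
do 3! apply: rint_sum => ?; apply: rintZ; apply: rintD.
  by do 2? apply: rintD; under eq_fun do rewrite mulrC; exact: rintZ.
by do 2? apply: rintD; exact: rintZ.
Qed.

Let Ex_cross V b : centered4 V ->
  Ex P (fun t => cross (tnth (V t)) b) = crosslin V b.
Proof.
move=> cV.
have r1 := rint_tnth cV; have r2 := rint_tnth2 cV; have r3 := rint_tnth3 cV.
have e1 j : Ex P (fun t => tnth (V t) j) = 0 := Ex_tnth cV j.
have s2 j k : rint P (fun t => c2 j k * (b k * tnth (V t) j + b j * tnth (V t) k)).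
  by apply: rintZ; apply: rintD; exact: rintZ.
have s3 j k m : rint P (fun t => c3 j k m *
   ((b m * (tnth (V t) j * tnth (V t) k) + b k * (tnth (V t) j * tnth (V t) m)
     + b j * (tnth (V t) k * tnth (V t) m))
    + (b k * b m * tnth (V t) j + b j * b m * tnth (V t) k
       + b j * b k * tnth (V t) m))).
  by apply: rintZ; apply: rintD; do 2? apply: rintD; exact: rintZ.
transitivity (Ex P (fun t =>
  \sum_j \sum_k c2 j k * (b k * tnth (V t) j + b j * tnth (V t) k) +
  \sum_j \sum_k \sum_m c3 j k m *
   ((b m * (tnth (V t) j * tnth (V t) k) + b k * (tnth (V t) j * tnth (V t) m)
     + b j * (tnth (V t) k * tnth (V t) m))
    + (b k * b m * tnth (V t) j + b j * b m * tnth (V t) k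
       + b j * b k * tnth (V t) m)))).
  congr Ex; apply/funext => t; rewrite crossE; congr (_ + _).
    by do 2! apply: eq_bigr => ? _; congr (_ * _); rewrite mulrC.
  do 3! apply: eq_bigr => ? _; congr (_ * (_ + _)).
  by rewrite ![b _ * _]mulrC.
rewrite ExD; [|by do 2! apply: rint_sum => ?|by do 3! apply: rint_sum => ?].
rewrite Ex_sum => [|j]; last by apply: rint_sum.
rewrite big1 ?add0r => [|j _]; last first.
  rewrite Ex_sum// big1// => k _; rewrite ExZ; last by apply: rintD; exact: rintZ.
  by rewrite ExD ?ExZ ?e1 ?mulr0 ?addr0 ?mulr0//; exact: rintZ.
rewrite Ex_sum => [|j]; last by do 2! apply: rint_sum => ?.
apply: eq_bigr => j _; rewrite Ex_sum => [|k]; last by apply: rint_sum => ?.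
apply: eq_bigr => k _; rewrite Ex_sum//; apply: eq_bigr => m _.
have z1 a j' : rint P (fun t => a * tnth (V t) j') by exact: rintZ.
have z2 a j' k' : rint P (fun t => a * (tnth (V t) j' * tnth (V t) k')) by exact: rintZ.
rewrite ExZ; last by apply: rintD; do 2? apply: rintD.
congr (_ * _); rewrite ExD; [|by do 2? apply: rintD|by do 2? apply: rintD].
rewrite [X in _ + X]ExD//; last exact: rintD.
rewrite [X in _ + (X + _)]ExD// !ExZ// !e1 !mulr0 !addr0.
rewrite ExD//; last exact: rintD.
by rewrite ExD// !ExZ// /mom2 ![b _ * _]mulrC.
Qed.

(** In the Taylor polynomial of a second difference every term up to order three is
    linear in one of the two independent centred vectors, and averages to zero;
    only the remainders are left. *)
Lemma second_difference V W : centered4 V -> centered4 W ->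
  `|avg P W (avg P V f) x - avg P W f x - avg P V f x + f x| <=
  17 * K * (quartic V + quartic W).
Proof.
move=> cV cW; have [mV _ _] := cV; have [mW _ _] := cW.
have bV : bmeas (avg P V f) by exact: bmeas_avg.
pose Q (v : E) := \sum_j w j * tnth v j ^+ 4.
have pw v u : `|f (vadd (vadd x u) v) - f (vadd x u) - f (vadd x v) + f x
    - cross (tnth v) (tnth u)| <=
    17 * K * ((Q v + tail4 1 v) + (Q u + tail4 1 u)).
  have eu := expansion u; have ev := expansion v; have euv := expansion (vadd v u).
  have t2v : tail4 2 v <= tail4 1 v by apply: tail4_mono; lra.
  have t2u : tail4 2 u <= tail4 1 u by apply: tail4_mono; lra.
  have tuv := tail4_vadd v u.
  have Quv : Q (vadd v u) <= 8 * (Q v + Q u).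
    rewrite /Q -big_split mulr_sumr /=; apply: ler_sum => j _.
    rewrite [leRHS](_ : _ = w j * (8 * (tnth v j ^+ 4 + tnth u j ^+ 4)));
      last by ring.
    rewrite ler_wpM2l// tnth_vadd.
    set a := tnth v j; set b := tnth u j; rewrite -subr_ge0.
    (* the difference vanishes to second order at [a = b] *)
    have -> : 8 * (a ^+ 4 + b ^+ 4) - (a + b) ^+ 4 =
      (a - b) ^+ 2 * (7 * (a ^+ 2 + b ^+ 2) + 10 * (a * b)) by ring.
    rewrite mulr_ge0 ?sqr_ge0//.
    have -> : 7 * (a ^+ 2 + b ^+ 2) + 10 * (a * b) =
      5 * (a + b) ^+ 2 + 2 * a ^+ 2 + 2 * b ^+ 2 by ring.
    by rewrite !addr_ge0// mulr_ge0// sqr_ge0.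
  have Qv0 : 0 <= Q v.
    by apply: sumr_ge0 => j _; rewrite mulr_ge0// (exprM _ 2 2) sqr_ge0.
  have Qu0 : 0 <= Q u.
    by apply: sumr_ge0 => j _; rewrite mulr_ge0// (exprM _ 2 2) sqr_ge0.
  have tv0 := tail4_ge0 1 v; have tu0 := tail4_ge0 1 u.
  rewrite -/(Q u) in eu; rewrite -/(Q v) in ev; rewrite -/(Q (vadd v u)) in euv.
  have -> : f (vadd (vadd x u) v) - f (vadd x u) - f (vadd x v) + f x
      - cross (tnth v) (tnth u) =
    (f (vadd x (vadd v u)) - f x - poly3 c1 c2 c3 (tnth (vadd v u)))
    - (f (vadd x v) - f x - poly3 c1 c2 c3 (tnth v))
    - (f (vadd x u) - f x - poly3 c1 c2 c3 (tnth u)).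
    have -> : tnth (vadd v u) = tnth v \+ tnth u.
      by apply/funext => j; rewrite tnth_vadd.
    by rewrite (vaddC v u) vaddA /cross; ring.
  apply: (le_trans (ler_normB _ _)).
  apply: (le_trans (lerD (ler_normB _ _) (lexx _))).
  apply: (le_trans (lerD (lerD euv ev) eu)).
  rewrite -!mulrDr [17 * K]mulrC -[leRHS]mulrA. rewrite ler_wpM2l//.
  lra.
have rQ U : centered4 U -> rint P (fun t => Q (U t) + tail4 1 (U t)).
  by move=> cU; apply: rintD; [exact: rquart|exact: rint_tail4].
have EQ U : centered4 U -> Ex P (fun t => Q (U t) + tail4 1 (U t)) = quartic U.
  by move=> cU; rewrite ExD ?Equart//; [exact: rquart|exact: rint_tail4].
have inner u : `|avg P V f (vadd x u) - f (vadd x u) - avg P V f x + f x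
    - crosslin V (tnth u)| <= 17 * K * (quartic V + (Q u + tail4 1 u)).
  pose c := - f (vadd x u) + f x.
  have -> : avg P V f (vadd x u) - f (vadd x u) - avg P V f x + f x
    - crosslin V (tnth u) = Ex P (fun t => (f (vadd (vadd x u) (V t)) -
      f (vadd x (V t)) + c) - cross (tnth (V t)) (tnth u)).
    rewrite ExB; last exact: rint_cross.
      rewrite ExD; [|by apply: rintB; exact: rint_shift|exact: rint_cst].
      rewrite ExB; [|exact: rint_shift..].
      by rewrite Ex_cst Ex_cross// /avg /c; ring.
    by apply: rintD; [apply: rintB; exact: rint_shift|exact: rint_cst].
  have -> : 17 * K * (quartic V + (Q u + tail4 1 u)) = Ex P (fun t =>
      17 * K * ((Q (V t) + tail4 1 (V t)) + (Q u + tail4 1 u))).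
    rewrite ExZ; last by apply: rintD; [exact: rQ|exact: rint_cst].
    by rewrite (ExD (rQ _ cV) (rint_cst P _)) EQ// Ex_cst.
  apply: le_norm_Ex.
  - apply: rintB; last exact: rint_cross.
    by apply: rintD; [apply: rintB; exact: rint_shift|exact: rint_cst].
  - by apply: rintZ; apply: rintD; [exact: rQ|exact: rint_cst].
  - move=> t; apply: (le_trans _ (pw (V t) u)); rewrite le_eqVlt; apply/orP; left.
    by apply/eqP; congr (`|_|); rewrite /c; ring.
have rlin : rint P (fun t => crosslin V (tnth (W t))).
  have r1 := rint_tnth cW.
  by do 3! apply: rint_sum => ?; apply: rintZ; do 2? apply: rintD; exact: rintZ.
have Elin : Ex P (fun t => crosslin V (tnth (W t))) = 0.
  have r1 := rint_tnth cW.
  have z1 a j' : rint P (fun t => a * tnth (W t) j') by exact: rintZ.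
  have s3 j k m : rint P (fun t => c3 j k m * (mom2 V j k * tnth (W t) m +
     mom2 V j m * tnth (W t) k + mom2 V k m * tnth (W t) j)).
    by apply: rintZ; do 2? apply: rintD.
  rewrite Ex_sum => [|j]; last by do 2! apply: rint_sum => ?.
  rewrite big1// => j _; rewrite Ex_sum => [|k]; last by apply: rint_sum => ?.
  rewrite big1// => k _; rewrite Ex_sum// big1// => m _.
  rewrite ExZ; last by do 2? apply: rintD.
  rewrite ExD//; last exact: rintD.
  by rewrite ExD// !ExZ// !(Ex_tnth cW) !mulr0 !addr0 mulr0.
pose c := - avg P V f x + f x.
have r1 : rint P (fun t => avg P V f (vadd x (W t)) - f (vadd x (W t))).
  by apply: rintB; exact: rint_shift.
have -> : avg P W (avg P V f) x - avg P W f x - avg P V f x + f x =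
    Ex P (fun t => (avg P V f (vadd x (W t)) - f (vadd x (W t)) + c)
      - crosslin V (tnth (W t))).
  rewrite ExB//; last by apply: rintD => //; exact: rint_cst.
  rewrite ExD//; last exact: rint_cst.
  rewrite ExB; [|exact: rint_shift..].
  by rewrite Elin Ex_cst subr0 /c addrA.
have -> : 17 * K * (quartic V + quartic W) = Ex P (fun t =>
      17 * K * (quartic V + (Q (W t) + tail4 1 (W t)))).
  rewrite ExZ; last by apply: rintD; [exact: rint_cst|exact: rQ].
  by rewrite (ExD (rint_cst P _) (rQ _ cW)) EQ// Ex_cst.
apply: le_norm_Ex.
- by apply: rintB => //; apply: rintD => //; exact: rint_cst.
- by apply: rintZ; apply: rintD; [exact: rint_cst|exact: rQ].
- move=> t; apply: (le_trans _ (inner (W t))); rewrite le_eqVlt; apply/orP; left.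
  by apply/eqP; congr (`|_|); rewrite /c; ring.
Qed.

End averaged_expansion.

(** * The derivative of the interpolation *)

Section centred_functions.
Context {R : realType} {p : nat}.
Local Notation E := (p.-tuple R).
Hypothesis p0 : (0 < p)%N.
Implicit Types x y v : E.

Definition ctr y x : 'I_p -> R := fun j => tnth x j - tnth y j.

Lemma ctr_vadd y x v : ctr y (vadd x v) = ctr y x \+ tnth v.
Proof. by apply/funext => j; rewrite /ctr tnth_vadd /= addrAC. Qed.

Lemma measurable_ctr y j : measurable_fun setT (fun x => ctr y x j).
Proof. by apply: measurable_funB => //; exact: measurable_tnth. Qed.

Lemma measurable_lse y : measurable_fun setT (fun x => ln (sexp (ctr y x))).
Proof.
have mS : measurable_fun setT (fun x => sexp (ctr y x)).
  apply: measurable_sum => j.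
  exact: (measurableT_comp (@measurable_expR R) (measurable_ctr y j)).
exact: (measurableT_comp (@measurable_ln R) mS).
Qed.

Lemma bmeas_smooth_orthant l y : bmeas (fun x => smooth_orthant l (ctr y x)).
Proof.
split; last first.
  by exists 1 => x; have /andP[g0 g1] := gstep_itv l (ln (sexp (ctr y x)));
    rewrite ger0_norm.
have mg : measurable_fun setT (gstep l 0).
  apply: continuous_measurable_fun.
  by apply: (@continuous_of_is_derive _ _ (gstep l 1)) => t; exact: is_derive_gstep.
exact: (measurableT_comp mg (measurable_lse y)).
Qed.

Lemma bmeas_strip l r y : bmeas (fun x => strip l r (ctr y x)).
Proof.
split; last by exists 1 => x; rewrite ger0_norm ?strip_ge0 ?strip_le1.
set q := fun x => ln (sexp (ctr y x)).
pose A := q @^-1` [set` `[l^-1 - r, 2 * l^-1 + r]].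
have -> : (fun x => strip l r (ctr y x)) = \1_A.
  apply/funext => x; rewrite indicE /strip; congr ((nat_of_bool _)%:R).
  by apply/idP/idP => [h|/set_mem]; rewrite ?in_setE /A /= in_itv//.
apply: measurable_indic; rewrite -[X in measurable X]setTI.
by apply: (measurable_lse y) => //; exact: measurable_itv.
Qed.

Lemma bmeas_wt y j : bmeas (fun x => wt (ctr y x) j).
Proof.
split; last first.
  exists 1 => x; rewrite ger0_norm ?wt_ge0//.
  by rewrite -(sum_wt p0 (ctr y x)) (bigD1 j)//= lerDl sumr_ge0// => i _; exact: wt_ge0.
have -> : (fun x => wt (ctr y x) j) =
    expR \o (fun x => ctr y x j - ln (sexp (ctr y x))).
  by apply/funext => x /=; rewrite expRD expRN lnK// posrE sexp_gt0.
by apply: measurableT_comp => //; apply: measurable_funB;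
  [exact: measurable_ctr|exact: measurable_lse].
Qed.

Lemma strip_mono (l r s : R) (a : 'I_p -> R) : r <= s -> strip l r a <= strip l s a.
Proof.
move=> rs; rewrite /strip ler_nat.
case: (boolP (_ <= _ <= 2 * l^-1 + r)) => // /andP[h1 h2].
by rewrite lt0b; apply/andP; split; lra.
Qed.

End centred_functions.

Section derivative_bound.
Context {d : measure_display} {T : measurableType d} {R : realType} {p : nat}.
Variable P : probability T R.
Local Notation E := (p.-tuple R).
Context {I : finType}.
Variables (Y Z : I -> T -> E).
Hypothesis p0 : (0 < p)%N.
Hypotheses (cY : forall i, centered4 P (Y i)) (cZ : forall i, centered4 P (Z i)).
Hypotheses
  (sY : forall i, 2^-1 <= Ex P (fun t => (sup_norm (Y i t) <= 1)%R%:R))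
  (sZ : forall i, 2^-1 <= Ex P (fun t => (sup_norm (Z i t) <= 1)%R%:R)).
Variables a2 a3 M tau : R.
Hypotheses
  (a2P : forall j k, `|\sum_i (mom2 P (Y i) j k - mom2 P (Z i) j k)| <= a2)
  (a3P : forall j k m, `|\sum_i (mom3 P (Y i) j k m - mom3 P (Z i) j k m)| <= a3)
  (MP : forall j, \sum_i (mom4 P (Y i) j + mom4 P (Z i) j) <= M)
  (tauP : \sum_i (tail P (Y i) + tail P (Z i)) <= tau).

Let mY i : measurable_fun setT (Y i). Proof. by have [] := cY i. Qed.
Let mZ i : measurable_fun setT (Z i). Proof. by have [] := cZ i. Qed.
Let s := index_enum I.

(** The weights hardly change under a bounded increment, and increments are
    bounded with probability at least one half: averaging over the missing
    summand costs only a constant. *)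
Lemma strip_wt_le_avg l y j (V : T -> E) x : measurable_fun setT V ->
  2^-1 <= Ex P (fun t => (sup_norm (V t) <= 1)%R%:R) ->
  strip l 2 (ctr y x) * wt (ctr y x) j <=
  2 * expR 2 * avg P V (fun x => strip l 3 (ctr y x) * wt (ctr y x) j) x.
Proof.
move=> mV sV; set c := strip l 2 (ctr y x) * wt (ctr y x) j.
have c0 : 0 <= c by rewrite mulr_ge0 ?strip_ge0 ?wt_ge0.
have bF : bmeas (fun x => strip l 3 (ctr y x) * wt (ctr y x) j).
  by apply: bmeasM; [exact: bmeas_strip|exact: bmeas_wt].
have mN := measurable_sup_norm mV.
have rS : rint P (fun t => (sup_norm (V t) <= 1)%R%:R : R).
  apply: (@rint_bounded _ _ _ _ _ 1) => [|t]; last first.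
    by rewrite ger0_norm// lern1; case: (_ <= _).
  pose A := (fun t => sup_norm (V t)) @^-1` [set` `]-oo, 1]].
  have -> : (fun t => (sup_norm (V t) <= 1)%R%:R : R) = \1_A.
    apply/funext => t; rewrite indicE; congr ((nat_of_bool _)%:R).
    by apply/idP/idP => [h|/set_mem]; rewrite ?in_setE /A /= in_itv//.
  apply: measurable_indic; rewrite -[X in measurable X]setTI.
  by apply: mN => //; exact: measurable_itv.
have e2 : 0 < expR 2 :> R by exact: expR_gt0.
rewrite -mulrA -ler_pdivrMl// (mulrC 2^-1).
apply: (@le_trans _ _ (c * Ex P (fun t => (sup_norm (V t) <= 1)%R%:R))).
  by rewrite ler_wpM2l.
have rF := rint_shift P x bF mV.
rewrite /avg -(ExZ c rS) -(ExZ (expR 2) rF).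
apply: le_Ex => [||t]; [exact: rintZ|exact: (rintZ (expR 2) rF)|].
case: (leP (sup_norm (V t)) 1) => [V1|_]; last first.
  rewrite mulr0; apply: mulr_ge0; first exact: ltW.
  by apply: mulr_ge0; [exact: strip_ge0|exact: wt_ge0].
have Vj i : `|tnth (V t) i| <= 1 by rewrite (le_trans (le_sup_norm _ _)).
rewrite mulr1 /c ctr_vadd [leRHS]mulrCA ler_pM ?strip_ge0 ?wt_ge0//.
  have := strip_perturb_ge l 2 (ctr y x) p0 Vj.
  by have -> : 2 + 1 = 3 :> R by ring.
by have := wt_perturb_ge p0 (ctr y x) j Vj; rewrite mulr1.
Qed.

Variables (l : R) (y : E) (u : R).
Hypotheses (l01 : 0 < l <= 1) (u01 : 0 <= u <= 1).

Let m x := smooth_orthant l (ctr y x).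
Let S x := strip l 3 (ctr y x).
Let W x j := strip l 2 (ctr y x) * wt (ctr y x) j.
Let SW j x := strip l 3 (ctr y x) * wt (ctr y x) j.
Let bm : bmeas m. Proof. exact: bmeas_smooth_orthant. Qed.
Let bS : bmeas S. Proof. exact: bmeas_strip. Qed.
Let bW j : bmeas (fun x => W x j).
Proof. by apply: bmeasM; [exact: bmeas_strip|exact: bmeas_wt]. Qed.
Let bSW j : bmeas (SW j).
Proof. by apply: bmeasM; [exact: bmeas_strip|exact: bmeas_wt]. Qed.
Let W0 x j : 0 <= W x j.
Proof. by rewrite mulr_ge0 ?strip_ge0 ?wt_ge0. Qed.

Variable C : R.
Hypothesis C1 : 1 <= C.

Hypothesis expansionP : forall x, exists c1 c2 c3, [/\
    \sum_j \sum_k `|c2 j k| <= C * l * strip l 0 (ctr y x),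
    \sum_j \sum_k \sum_m `|c3 j k m| <= C * l * strip l 0 (ctr y x) &
    forall v, `|m (vadd x v) - m x - poly3 c1 c2 c3 (tnth v)| <=
      C * l * (\sum_j W x j * tnth v j ^+ 4 + tail4 2 v)].

Let Cl0 : 0 <= C * l.
Proof. by case/andP: l01 => l0 _; rewrite mulr_ge0 ?(ltW l0)// (le_trans _ C1). Qed.

Let a20 : 0 <= a2. Proof. exact: le_trans (a2P (Ordinal p0) (Ordinal p0)). Qed.
Let a30 : 0 <= a3.
Proof. exact: le_trans (a3P (Ordinal p0) (Ordinal p0) (Ordinal p0)). Qed.
Let M0 : 0 <= M.
Proof.
apply: le_trans (MP (Ordinal p0)); apply: sumr_ge0 => i _.
by rewrite addr_ge0 ?mom4_ge0.
Qed.

Let S_ge0 x : 0 <= S x. Proof. exact: strip_ge0. Qed.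

Let sum_SW x : \sum_j SW j x = S x.
Proof. by rewrite -mulr_sumr sum_wt// mulr1. Qed.

Let sum_W x : \sum_j W x j <= S x.
Proof. by rewrite -mulr_sumr sum_wt// mulr1; apply: strip_mono; lra. Qed.

Let mom_i i j := mom4 P (Y i) j + mom4 P (Z i) j.
Let tau_i i := tail P (Y i) + tail P (Z i).

Let quarticE i x : quartic P (W x) (Y i) + quartic P (W x) (Z i) =
  \sum_j W x j * mom_i i j + tau_i i.
Proof.
rewrite /quartic addrACA -big_split/=; congr (_ + _).
by apply: eq_bigr => j _; rewrite -mulrDr.
Qed.

(** The base point is common to all the summands, so the differences of moments are
    summed before absolute values are taken. *)
Lemma sum_gap_bound x : `|\sum_i gap P Y Z i m x| <=
  C * l * ((a2 + a3 + M) * S x + tau).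
Proof.
have [c1 [c2 [c3 [c2P c3P ex]]]] := expansionP x.
pose q2 V := \sum_j \sum_k c2 j k * mom2 P V j k.
pose q3 V := \sum_j \sum_k \sum_r c3 j k r * mom3 P V j k r.
have gapE i : `|gap P Y Z i m x - ((q2 (Y i) - q2 (Z i)) + (q3 (Y i) - q3 (Z i)))|
    <= C * l * (\sum_j W x j * mom_i i j + tau_i i).
  have eY := avg_expansion bm Cl0 ex (cY i); have eZ := avg_expansion bm Cl0 ex (cZ i).
  rewrite -quarticE mulrDr; apply: le_trans (lerD eY eZ).
  apply: le_trans (ler_normB _ _); rewrite le_eqVlt; apply/orP; left; apply/eqP.
  by congr (`|_|); rewrite /gap -/(q2 _) -/(q3 _) -/(q2 _) -/(q3 _); ring.
have strip0 : strip l 0 (ctr y x) <= S x by apply: strip_mono; lra.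
have s2 : `|\sum_i (q2 (Y i) - q2 (Z i))| <= C * l * (a2 * S x).
  have -> : \sum_i (q2 (Y i) - q2 (Z i)) =
      \sum_j \sum_k c2 j k * \sum_i (mom2 P (Y i) j k - mom2 P (Z i) j k).
    rewrite (eq_bigr (fun i => \sum_j \sum_k c2 j k *
       (mom2 P (Y i) j k - mom2 P (Z i) j k))).
      rewrite exchange_big/=; apply: eq_bigr => j _.
      rewrite exchange_big/=; apply: eq_bigr => k _.
      by rewrite mulr_sumr.
    move=> i _; rewrite /q2 -sumrB; apply: eq_bigr => j _.
    by rewrite -sumrB; apply: eq_bigr => k _; rewrite mulrBr.
  apply: (@le_trans _ _ (\sum_j \sum_k `|c2 j k| * a2)).
    apply: (le_trans (ler_norm_sum _ _ _)); apply: ler_sum => j _.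
    apply: (le_trans (ler_norm_sum _ _ _)); apply: ler_sum => k _.
    by rewrite normrM ler_wpM2l.
  under eq_bigr do rewrite -mulr_suml.
  rewrite -mulr_suml mulrCA mulrC ler_wpM2l// (le_trans c2P)// ler_wpM2l//.
have s3 : `|\sum_i (q3 (Y i) - q3 (Z i))| <= C * l * (a3 * S x).
  have -> : \sum_i (q3 (Y i) - q3 (Z i)) = \sum_j \sum_k \sum_r c3 j k r *
      \sum_i (mom3 P (Y i) j k r - mom3 P (Z i) j k r).
    rewrite (eq_bigr (fun i => \sum_j \sum_k \sum_r c3 j k r *
       (mom3 P (Y i) j k r - mom3 P (Z i) j k r))).
      rewrite exchange_big/=; apply: eq_bigr => j _.
      rewrite exchange_big/=; apply: eq_bigr => k _.
      rewrite exchange_big/=; apply: eq_bigr => r _.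
      by rewrite mulr_sumr.
    move=> i _; rewrite /q3 -sumrB; apply: eq_bigr => j _.
    rewrite -sumrB; apply: eq_bigr => k _.
    by rewrite -sumrB; apply: eq_bigr => r _; rewrite mulrBr.
  apply: (@le_trans _ _ (\sum_j \sum_k \sum_r `|c3 j k r| * a3)).
    apply: (le_trans (ler_norm_sum _ _ _)); apply: ler_sum => j _.
    apply: (le_trans (ler_norm_sum _ _ _)); apply: ler_sum => k _.
    apply: (le_trans (ler_norm_sum _ _ _)); apply: ler_sum => r _.
    by rewrite normrM ler_wpM2l.
  under eq_bigr do under eq_bigr do rewrite -mulr_suml.
  under eq_bigr do rewrite -mulr_suml.
  rewrite -mulr_suml mulrCA mulrC ler_wpM2l// (le_trans c3P)// ler_wpM2l//.
have s4 : `|\sum_i (gap P Y Z i m x - ((q2 (Y i) - q2 (Z i)) + (q3 (Y i) - q3 (Z i))))|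
    <= C * l * (M * S x + tau).
  apply: (le_trans (ler_norm_sum _ _ _)).
  apply: (le_trans (ler_sum _ (fun i _ => gapE i))).
  rewrite -mulr_sumr ler_wpM2l// big_split/= lerD//.
  rewrite exchange_big/=; apply: (@le_trans _ _ (\sum_j W x j * M)).
    by apply: ler_sum => j _; rewrite -mulr_sumr; apply: ler_wpM2l; last exact: MP.
  by rewrite -mulr_suml mulrC ler_wpM2l.
have -> : \sum_i gap P Y Z i m x = \sum_i (q2 (Y i) - q2 (Z i)) +
   \sum_i (q3 (Y i) - q3 (Z i)) + \sum_i (gap P Y Z i m x -
      ((q2 (Y i) - q2 (Z i)) + (q3 (Y i) - q3 (Z i)))).
  by rewrite -!big_split/=; apply: eq_bigr => i _; ring.
apply: (le_trans (ler_normD _ _)).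
apply: (le_trans (lerD (ler_normD _ _) (lexx _))).
apply: (le_trans (lerD (lerD s2 s3) s4)).
by rewrite le_eqVlt; apply/orP; left; apply/eqP; ring.
Qed.

Let mixed_identity (v A B AA AB BA BB m0 : R) :
  A - B - (v * (AA - AB) + (1 - v) * (BA - BB)) =
  - (v * (AA - A - A + m0 - (AB - A - B + m0)) +
     (1 - v) * (BA - B - A + m0 - (BB - B - B + m0))).
Proof. by ring. Qed.

(** Centering of both the difference of the two laws and of the missing summand
    leaves a term of order four. *)
Lemma gap_mix_bound i x : `|gap P Y Z i m x - mix P Y Z u i (gap P Y Z i m) x| <=
  51 * (C * l) * (\sum_j W x j * mom_i i j + tau_i i).
Proof.
have [c1 [c2 [c3 [_ _ ex]]]] := expansionP x.
have sd V1 V2 (h1 : centered4 P V1) (h2 : centered4 P V2) :=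
  second_difference bm Cl0 (W0 x) ex h1 h2.
pose D V1 V2 := avg P V2 (avg P V1 m) x - avg P V2 m x - avg P V1 m x + m x.
have bY : bmeas (avg P (Y i) m) by exact: bmeas_avg.
have bZ : bmeas (avg P (Z i) m) by exact: bmeas_avg.
have avg_gap V : measurable_fun setT V -> avg P V (gap P Y Z i m) x =
    avg P V (avg P (Y i) m) x - avg P V (avg P (Z i) m) x.
  by move=> mV; apply: ExB; exact: rint_shift.
have -> : gap P Y Z i m x - mix P Y Z u i (gap P Y Z i m) x =
    - (u * (D (Y i) (Y i) - D (Z i) (Y i)) + (1 - u) * (D (Y i) (Z i) - D (Z i) (Z i))).
  rewrite /mix (avg_gap _ (mY i)) (avg_gap _ (mZ i)); exact: mixed_identity.
have q0 V : 0 <= quartic P (W x) V.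
  rewrite addr_ge0 ?tail_ge0//; apply: sumr_ge0 => j _.
  by rewrite mulr_ge0 ?mom4_ge0.
have qY := q0 (Y i); have qZ := q0 (Z i).
rewrite -quarticE normrN.
have [u0 u1] := andP u01; have u10 : 0 <= 1 - u by rewrite subr_ge0.
have CY := mulr_ge0 Cl0 qY; have CZ := mulr_ge0 Cl0 qZ.
have b1 : `|D (Y i) (Y i) - D (Z i) (Y i)| <=
    51 * (C * l) * (quartic P (W x) (Y i) + quartic P (W x) (Z i)).
  apply: (le_trans (ler_normB _ _)).
  apply: (le_trans (lerD (sd _ _ (cY i) (cY i)) (sd _ _ (cZ i) (cY i)))).
  set a := quartic _ _ _ in CY *; set b := quartic _ _ _ in CZ *.
  rewrite [leLHS](_ : _ = 51 * (C * l * a) + 17 * (C * l * b)); last by ring.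
  by rewrite [leRHS](_ : _ = 51 * (C * l * a) + 51 * (C * l * b)); [lra|ring].
have b2 : `|D (Y i) (Z i) - D (Z i) (Z i)| <=
    51 * (C * l) * (quartic P (W x) (Y i) + quartic P (W x) (Z i)).
  apply: (le_trans (ler_normB _ _)).
  apply: (le_trans (lerD (sd _ _ (cY i) (cZ i)) (sd _ _ (cZ i) (cZ i)))).
  set a := quartic _ _ _ in CY *; set b := quartic _ _ _ in CZ *.
  rewrite [leLHS](_ : _ = 17 * (C * l * a) + 51 * (C * l * b)); last by ring.
  by rewrite [leRHS](_ : _ = 51 * (C * l * a) + 51 * (C * l * b)); [lra|ring].
set d1 := D (Y i) (Y i) - D (Z i) (Y i) in b1 *.
set d2 := D (Y i) (Z i) - D (Z i) (Z i) in b2 *.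
move: d1 d2 (51 * (C * l) * (quartic P (W x) (Y i) + quartic P (W x) (Z i))) b1 b2.
move=> d1 d2 X b1 b2.
apply: (le_trans (ler_normD _ _)); rewrite !normrM (ger0_norm u0) (ger0_norm u10).
apply: (@le_trans _ _ (u * X + (1 - u) * X)); last by rewrite -mulrDl addrCA subrr addr0 mul1r.
by rewrite lerD// ler_wpM2l.
Qed.

Let k2 : 1 <= expR 2 :> R. Proof. by rewrite -[leLHS]expR0 ler_expR. Qed.

Let interp_rem_W i j : i \in s ->
  interp P Y Z u (rem i s) (fun x => W x j) <= 2 * expR 2 * interp P Y Z u s (SW j).
Proof.
move=> is_; rewrite (interp_rem P mY mZ u (bSW j) is_).
have bX : bmeas (mix P Y Z u i (SW j)) by exact: bmeas_mix.
rewrite -interpZ//; apply: le_interp => // [|x]; first exact: bmeasZ.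
have h1 := strip_wt_le_avg l y j x (mY i) (sY i).
have h2 := strip_wt_le_avg l y j x (mZ i) (sZ i).
have /andP[u0 u1] := u01; have u10 : 0 <= 1 - u by rewrite subr_ge0.
rewrite /mix mulrDr !(mulrCA (2 * expR 2)).
rewrite (_ : W x j = u * W x j + (1 - u) * W x j); last by ring.
by rewrite lerD// ler_wpM2l.
Qed.

(** Every difference is split into its average over the missing mixture and a
    correction: the averages are all taken at the full sum and add up, the
    corrections are of order four. *)
Lemma interp_derivative_bound :
  `|\sum_i interp P Y Z u (rem i s) (gap P Y Z i m)| <=
  (103 * expR 2 * C) * l * ((a2 + a3 + M) * interp P Y Z u s S + tau).
Proof.
have k51 : 0 <= 51 * (C * l) by rewrite mulr_ge0.
have bg i : bmeas (gap P Y Z i m) by exact: bmeas_gap.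
have bmg i : bmeas (mix P Y Z u i (gap P Y Z i m)) by exact: bmeas_mix.
have smem i : i \in s by exact: mem_index_enum.
have split_i i : interp P Y Z u (rem i s) (gap P Y Z i m) =
    interp P Y Z u s (gap P Y Z i m) + interp P Y Z u (rem i s)
      (fun x => gap P Y Z i m x - mix P Y Z u i (gap P Y Z i m) x).
  by rewrite interpB// -(interp_rem P mY mZ u (bg i) (smem i)) addrC subrK.
have part1 : `|\sum_i interp P Y Z u s (gap P Y Z i m)| <=
    C * l * ((a2 + a3 + M) * interp P Y Z u s S + tau).
  rewrite -(interp_sum P mY mZ u s _ bg).
  have -> : C * l * ((a2 + a3 + M) * interp P Y Z u s S + tau) =
      interp P Y Z u s (fun x => C * l * ((a2 + a3 + M) * S x + tau)).
    have b1 : bmeas (fun x => (a2 + a3 + M) * S x) by exact: bmeasZ.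
    have bt := bmeas_cst tau : bmeas (fun _ : E => tau).
    have -> : interp P Y Z u s (fun x => C * l * ((a2 + a3 + M) * S x + tau)) =
      C * l * interp P Y Z u s (fun x => (a2 + a3 + M) * S x + tau).
      exact: (interpZ P mY mZ u s (C * l) (bmeasD b1 bt)).
    have -> : interp P Y Z u s (fun x => (a2 + a3 + M) * S x + tau) =
      interp P Y Z u s (fun x => (a2 + a3 + M) * S x) + interp P Y Z u s (fun=> tau).
      exact: (interpD P mY mZ u s b1 bt).
    by rewrite interp_cst interpZ.
  apply: le_norm_interp => //; first exact: bmeas_sum.
    by apply: bmeasZ; apply: bmeasD; [exact: bmeasZ|exact: bmeas_cst].
  exact: sum_gap_bound.
have part2 i : `|interp P Y Z u (rem i s)
      (fun x => gap P Y Z i m x - mix P Y Z u i (gap P Y Z i m) x)| <=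
    51 * (C * l) * (\sum_j mom_i i j * (2 * expR 2 * interp P Y Z u s (SW j)) + tau_i i).
  have bWm : forall j, bmeas (fun x => mom_i i j * W x j) by move=> j; exact: bmeasZ.
  have bs : bmeas (fun x => \sum_j mom_i i j * W x j) by exact: bmeas_sum.
  have bt : bmeas (fun _ : E => tau_i i) by exact: bmeas_cst.
  have bst : bmeas (fun x => \sum_j mom_i i j * W x j + tau_i i) by exact: bmeasD.
  apply: (@le_trans _ _ (interp P Y Z u (rem i s) (fun x =>
      51 * (C * l) * (\sum_j mom_i i j * W x j + tau_i i)))).
    apply: le_norm_interp => // [||x]; [exact: bmeasB|exact: bmeasZ|].
    apply: (le_trans (gap_mix_bound i x)); rewrite le_eqVlt; apply/orP; left.
    by apply/eqP; congr (_ * (_ + _)); apply: eq_bigr => j _; rewrite mulrC.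
  rewrite (interpZ P mY mZ _ _ _ bst) ler_wpM2l//.
  have -> : interp P Y Z u (rem i s) (fun x => \sum_j mom_i i j * W x j + tau_i i) =
      \sum_j interp P Y Z u (rem i s) (fun x => mom_i i j * W x j) + tau_i i.
    rewrite -(interp_sum P mY mZ u (rem i s) _ bWm).
    rewrite -[X in _ = _ + X](interp_cst P Y Z u (rem i s)).
    exact: interpD.
  rewrite lerD2r.
  apply: ler_sum => j _; rewrite interpZ// ler_wpM2l ?addr_ge0 ?mom4_ge0//.
  exact: interp_rem_W.
rewrite (eq_bigr _ (fun i _ => split_i i)) big_split/=.
apply: (le_trans (ler_normD _ _)).
set Q := interp P Y Z u s S in part1 *.
have Q0 : 0 <= Q.
  rewrite -(interp_cst P Y Z u s 0); apply: le_interp => //; exact: bmeas_cst.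
have part2' : `|\sum_i interp P Y Z u (rem i s)
      (fun x => gap P Y Z i m x - mix P Y Z u i (gap P Y Z i m) x)| <=
    51 * (C * l) * (2 * expR 2 * (M * Q) + tau).
  apply: (le_trans (ler_norm_sum _ _ _)).
  apply: (le_trans (ler_sum _ (fun i _ => part2 i))).
  rewrite -mulr_sumr ler_wpM2l// big_split/= lerD//.
  have -> : Q = \sum_j interp P Y Z u s (SW j).
    rewrite -(interp_sum P mY mZ _ _ _ bSW); congr interp; apply/funext => x.
    by rewrite sum_SW.
  rewrite exchange_big/= 2!mulr_sumr; apply: ler_sum => j _.
  rewrite -mulr_suml mulrCA ler_wpM2l ?mulr_ge0 ?expR_ge0//.
  apply: ler_wpM2r; last exact: MP.
  rewrite -(interp_cst P Y Z u s 0); apply: le_interp => //; first exact: bmeas_cst.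
  by move=> x; rewrite mulr_ge0 ?strip_ge0 ?wt_ge0.
apply: (le_trans (lerD part1 part2')).
have tau0 : 0 <= tau.
  by apply: le_trans tauP; apply: sumr_ge0 => i _; rewrite addr_ge0 ?tail_ge0.
have h1 : 0 <= C * l * (a2 * Q) by rewrite mulr_ge0// mulr_ge0.
have h2 : 0 <= C * l * (a3 * Q) by rewrite mulr_ge0// mulr_ge0.
have h3 : 0 <= C * l * (M * Q) by rewrite mulr_ge0// mulr_ge0.
have h4 : 0 <= C * l * tau by rewrite mulr_ge0.
have up z c : 0 <= z -> c <= 103 * expR 2 -> c * z <= 103 * expR 2 * z.
  by move=> z0 ce; rewrite ler_wpM2r.
have -> : C * l * ((a2 + a3 + M) * Q + tau) +
    51 * (C * l) * (2 * expR 2 * (M * Q) + tau) =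
  1 * (C * l * (a2 * Q)) + 1 * (C * l * (a3 * Q)) +
  (1 + 102 * expR 2) * (C * l * (M * Q)) + 52 * (C * l * tau) by ring.
have -> : 103 * expR 2 * C * l * ((a2 + a3 + M) * Q + tau) =
  103 * expR 2 * (C * l * (a2 * Q)) + 103 * expR 2 * (C * l * (a3 * Q)) +
  103 * expR 2 * (C * l * (M * Q)) + 103 * expR 2 * (C * l * tau) by ring.
have e2 := k2.
by rewrite !lerD// up//; lra.
Qed.

End derivative_bound.

(** The remainder bounds for small and for large increments in a single formula. *)
Lemma merged_expansion (R : realType) : exists2 C : R, 1 <= C &
  forall (p : nat) (l : R) (y x : p.-tuple R), (0 < p)%N -> 0 < l <= 1 ->
  exists c1 c2 c3, [/\
    \sum_j \sum_k `|c2 j k| <= C * l * strip l 0 (ctr y x),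
    \sum_j \sum_k \sum_m `|c3 j k m| <= C * l * strip l 0 (ctr y x) &
    forall v, `|smooth_orthant l (ctr y (vadd x v)) - smooth_orthant l (ctr y x)
        - poly3 c1 c2 c3 (tnth v)| <=
      C * l * (\sum_j (strip l 2 (ctr y x) * wt (ctr y x) j) * tnth v j ^+ 4
               + tail4 2 v)].
Proof.
have [C C1 H] := @smooth_orthant_expansion R; exists C => // p l y x p0 l01.
have [c1 [c2 [c3 [h2 h3 small large]]]] := H p l (ctr y x) p0 l01.
exists c1, c2, c3; split=> // v; rewrite ctr_vadd.
have Cl0 : 0 <= C * l.
  by case/andP: l01 => l0 _; rewrite mulr_ge0 ?(ltW l0)// (le_trans _ C1).
have s0 : 0 <= \sum_j (strip l 2 (ctr y x) * wt (ctr y x) j) * tnth v j ^+ 4.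
  apply: sumr_ge0 => j _; apply: mulr_ge0.
    by apply: mulr_ge0; [exact: strip_ge0|exact: wt_ge0].
  by rewrite (exprM _ 2 2) sqr_ge0.
have [v2|v2] := leP (sup_norm v) 2.
  have vj j : `|tnth v j| <= 2 by exact: le_trans (le_sup_norm _ _) v2.
  apply: (le_trans (small _ vj)); rewrite ler_wpM2l// mulr_sumr.
  under eq_bigr do rewrite mulrA.
  by rewrite lerDl tail4_ge0.
apply: (le_trans (large _ _ (le_sup_norm v))); rewrite ler_wpM2l//.
by rewrite /tail4 v2 mul1r lerDr.
Qed.

(** * Comparison of the two ends of the interpolation *)

Section orthant_indicator.
Context {R : realType} {p : nat}.
Local Notation E := (p.-tuple R).
Implicit Types (x y : E) (l t : R).

Definition orth y x : R := [forall j : 'I_p, (tnth x j <= tnth y j)%R]%:R.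

Lemma orth_itv y x : 0 <= orth y x <= 1.
Proof. by rewrite /orth ler0n lern1; case: [forall _, _]. Qed.

Lemma bmeas_orth y : bmeas (orth y).
Proof.
split; last by exists 1 => x; have /andP[q0 q1] := orth_itv y x; rewrite ger0_norm.
pose A := \bigcap_(j in [set: 'I_p]) ((fun x : E => tnth x j) @^-1` [set` `]-oo, tnth y j]]).
have -> : orth y = \1_A.
  apply/funext => x; rewrite indicE; congr ((nat_of_bool _)%:R).
  apply/forallP/idP => [h|/set_mem h j].
    by rewrite in_setE => j _ /=; rewrite in_itv/=.
  by have := h j I; rewrite /= in_itv.
apply: measurable_indic; apply: fin_bigcap_measurable; first exact: finite_finset.
move=> j _; rewrite -[X in measurable X]setTI.
by apply: measurable_tnth => //; exact: measurable_itv.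
Qed.

Lemma tnth_vec_shift y t j : tnth (vec_shift y t) j = tnth y j + t.
Proof. by rewrite tnth_mktuple. Qed.

Lemma vec_shift0K y t : vec_shift (vec_shift y (- t)) t = y.
Proof. by apply: eq_from_tnth => j; rewrite !tnth_vec_shift subrK. Qed.

Lemma vec_shiftD y s t : vec_shift (vec_shift y s) t = vec_shift y (s + t).
Proof. by apply: eq_from_tnth => j; rewrite !tnth_vec_shift addrA. Qed.

Hypothesis p0 : (0 < p)%N.
Variable l : R.
Hypotheses (l0 : 0 < l) (lnp : ln p%:R <= l^-1).

Lemma orth_le_smooth y x : orth y x <= smooth_orthant l (ctr y x).
Proof.
rewrite /orth; case: forallP => [xy|_]; last by have /andP[] := gstep_itv l (ln (sexp (ctr y x))).
rewrite /smooth_orthant gstep_eq1//.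
have : ln (sexp (ctr y x)) <= 0 + ln p%:R.
  by apply: ln_sexp_le => // j; rewrite /ctr subr_le0.
rewrite add0r => h; rewrite -(mulfV (lt0r_neq0 l0)) ler_wpM2l ?(ltW l0)//.
exact: le_trans h lnp.
Qed.

Lemma smooth_le_orth y x :
  smooth_orthant l (ctr y x) <= orth (vec_shift y (2 * l^-1)) x.
Proof.
rewrite /orth; case: (boolP [forall j, _]) => [_|].
  by have /andP[] := gstep_itv l (ln (sexp (ctr y x))).
rewrite negb_forall => /existsP[j]; rewrite -ltNge tnth_vec_shift => lt.
rewrite /smooth_orthant gstep_eq0// mulrC -ler_pdivrMr//.
by apply: (le_trans _ (ln_sexp_ge p0 (ctr y x) j)); rewrite /ctr; lra.
Qed.

Lemma strip_le_orth y x : strip l 3 (ctr y x) <=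
  orth (vec_shift y (2 * l^-1 + 3)) x - orth (vec_shift y (- 4)) x.
Proof.
have l1 : 0 < l^-1 by rewrite invr_gt0.
rewrite /strip; case: (boolP (_ <= _ <= _)) => [/andP[lo hi]|_]; last first.
  rewrite subr_ge0 /orth ler_nat; case: forallP => [h|//].
  rewrite lt0b; apply/forallP => j; have := h j.
  rewrite !tnth_vec_shift; lra.
have -> : orth (vec_shift y (2 * l^-1 + 3)) x = 1.
  rewrite /orth (_ : [forall j, _] = true)//; apply/forallP => j.
  rewrite tnth_vec_shift -lerBlDl; apply: (le_trans _ hi).
  exact: (ln_sexp_ge p0 (ctr y x) j).
have -> : orth (vec_shift y (- 4)) x = 0; last by rewrite subr0.
rewrite /orth; case: forallP => // h; exfalso.
have up : ln (sexp (ctr y x)) <= - 4 + ln p%:R.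
  by apply: ln_sexp_le => // j; have := h j; rewrite tnth_vec_shift /ctr; lra.
have lnp' := lnp; lra.
Qed.

End orthant_indicator.

Section comparison.
Context {d : measure_display} {T : measurableType d} {R : realType} {p : nat}.
Variable P : probability T R.
Local Notation E := (p.-tuple R).
Context {I : finType}.
Variables (Y Z : I -> T -> E).
Hypothesis p0 : (0 < p)%N.
Hypotheses (cY : forall i, centered4 P (Y i)) (cZ : forall i, centered4 P (Z i)).
Let s := index_enum I.
Let Q u f := interp P Y Z u s f.
Let mY i : measurable_fun setT (Y i). Proof. by have [] := cY i. Qed.
Let mZ i : measurable_fun setT (Z i). Proof. by have [] := cZ i. Qed.

Variables (l A tau alpha delta : R).
Hypotheses (l01 : 0 < l <= 1) (lnp : ln p%:R <= l^-1) (alpha0 : 0 <= alpha)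
  (delta0 : 0 <= delta).
Hypotheses (tau0 : 0 <= tau) (A0 : 0 <= A) (A4 : A <= 4^-1).

Hypothesis derivative_bound : forall y u, 0 <= u <= 1 ->
  `|\sum_i interp P Y Z u (rem i s) (gap P Y Z i (fun x => smooth_orthant l (ctr y x)))|
  <= A * Q u (fun x => strip l 3 (ctr y x)) + tau.

Hypothesis anticoncentration : forall y t, 0 < t ->
  Q 0 (orth (vec_shift y t)) - Q 0 (orth y) <= alpha * t + delta.

Let L := l^-1.
Let L1 : 1 <= L.
Proof. by case/andP: l01 => l0 l1; rewrite /L -invr1 lef_pV2// ?posrE// ltr01. Qed.
Let l0 : 0 < l. Proof. by case/andP: l01. Qed.

Let dist u y := `|Q u (orth y) - Q 0 (orth y)|.
Let dists : set R := [set r | exists u y, 0 <= u <= 1 /\ r = dist u y].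
Let rho := sup dists.

Let Q_itv u y : 0 <= u <= 1 -> 0 <= Q u (orth y) <= 1.
Proof.
move=> u01; have bo : bmeas (orth y : E -> R) by exact: bmeas_orth.
have lo : interp P Y Z u s (fun=> 0) <= Q u (orth y).
  apply: (le_interp P mY mZ s u01 (bmeas_cst 0) bo) => x.
  by have /andP[] := orth_itv y x.
have hi : Q u (orth y) <= interp P Y Z u s (fun=> 1).
  apply: (le_interp P mY mZ s u01 bo (bmeas_cst 1)) => x.
  by have /andP[] := orth_itv y x.
by rewrite interp_cst in lo; rewrite interp_cst in hi; rewrite lo hi.
Qed.

Let Z01 : 0 <= (0 : R) <= 1. Proof. by rewrite lexx ler01. Qed.

Let dist_le_rho u y : 0 <= u <= 1 -> dist u y <= rho.
Proof.
move=> u01; apply: ub_le_sup; last by exists u, y.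
exists 1 => _ [v [z [v01 ->]]]; rewrite /dist.
have := Q_itv z v01; have := Q_itv z Z01; rewrite ler_norml; lra.
Qed.

Let rho0 : 0 <= rho.
Proof. exact: le_trans (normr_ge0 _) (dist_le_rho vzero Z01). Qed.

Let smooth_bound : R := A * (2 * rho + (9 * L * alpha + delta)) + tau.

Let strip_bound u y : 0 <= u <= 1 ->
  Q u (fun x => strip l 3 (ctr y x)) <= 2 * rho + (9 * L * alpha + delta).
Proof.
move=> u01; set y1 := vec_shift y (- 4).
have e : vec_shift y (2 * L + 3) = vec_shift y1 (2 * L + 7).
  by rewrite vec_shiftD; congr vec_shift; ring.
have bo z : bmeas (orth z : E -> R) by exact: bmeas_orth.
apply: (@le_trans _ _ (Q u (orth (vec_shift y (2 * L + 3))) - Q u (orth y1))).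
  rewrite -interpB//; apply: le_interp => //; first exact: bmeas_strip.
    exact: bmeasB.
  by move=> x; exact: strip_le_orth.
have h1 := dist_le_rho (vec_shift y (2 * L + 3)) u01.
have h2 := dist_le_rho y1 u01; rewrite /dist !ler_norml in h1 h2.
have t0 : 0 < 2 * L + 7 by have := L1; lra.
have h3 := anticoncentration y1 t0; rewrite -e in h3.
have h4 : alpha * (2 * L + 7) <= 9 * L * alpha.
  by rewrite [leRHS]mulrC ler_wpM2l//; have := L1; lra.
by lra.
Qed.

Let smooth_le u y : 0 <= u <= 1 ->
  `|Q u (fun x => smooth_orthant l (ctr y x)) - Q 0 (fun x => smooth_orthant l (ctr y x))|
  <= smooth_bound.
Proof.
move=> /andP[u0 u1].
have bm : bmeas (fun x => smooth_orthant l (ctr y x)) by exact: bmeas_smooth_orthant.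
have us : uniq s by exact: index_enum_uniq.
have sb0 : 0 <= smooth_bound.
  rewrite addr_ge0// mulr_ge0//; apply: le_trans (strip_bound y Z01).
  have bS : bmeas (fun x : E => strip l 3 (ctr y x)) by exact: bmeas_strip.
  have := le_interp P mY mZ s Z01 (bmeas_cst 0) bS (fun x => strip_ge0 _ _ _).
  by rewrite interp_cst.
apply: (@le_trans _ _ (smooth_bound * (u - 0))); last by rewrite subr0 ler_piMr.
apply: (mean_value (fun v => is_derive_interp P mY mZ v us bm)) => // v /andP[v0 vu].
have v01 : 0 <= v <= 1 by rewrite v0 (le_trans vu).
apply: (le_trans (derivative_bound y v01)); rewrite lerD2r ler_wpM2l//.
exact: strip_bound.
Qed.

Let dist_le u y : 0 <= u <= 1 -> dist u y <= 2 * L * alpha + delta + smooth_bound.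
Proof.
move=> u01; have bo z : bmeas (orth z : E -> R) by exact: bmeas_orth.
have bm z : bmeas (fun x : E => smooth_orthant l (ctr z x)) by exact: bmeas_smooth_orthant.
have L20 : 0 < 2 * L by have := L1; lra.
have up v z : 0 <= v <= 1 -> Q v (orth z) <= Q v (fun x => smooth_orthant l (ctr z x)).
  by move=> v01; apply: (le_interp P mY mZ s v01 (bo z) (bm z)) => x; exact: orth_le_smooth.
have lo v z : 0 <= v <= 1 ->
    Q v (fun x => smooth_orthant l (ctr z x)) <= Q v (orth (vec_shift z (2 * L))).
  by move=> v01; apply: (le_interp P mY mZ s v01 (bm z) (bo _)) => x; exact: smooth_le_orth.
pose y1 := vec_shift y (- (2 * L)).
have e : vec_shift y1 (2 * L) = y by exact: vec_shift0K.
have a1 := anticoncentration y L20; have a2 := anticoncentration y1 L20.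
have l1 := lo 0 y Z01; have l2 := lo u y1 u01.
rewrite e in a2 l2.
have u1 := up u y u01; have u2 := up 0 y1 Z01.
have s1 := smooth_le y u01; have s2 := smooth_le y1 u01.
rewrite /dist; have -> : 2 * L * alpha = alpha * (2 * L) by ring.
move: a1 a2 l1 l2 u1 u2 s1 s2.
move: (Q u (orth y)) (Q 0 (orth y)) (Q 0 (orth y1)) (Q 0 (orth (vec_shift y (2 * L)))).
move=> r1 r2 r3 r4.
move: (Q u (fun x => smooth_orthant l (ctr y x))) => r5.
move: (Q 0 (fun x => smooth_orthant l (ctr y x))) => r6.
move: (Q u (fun x => smooth_orthant l (ctr y1 x))) => r7.
move: (Q 0 (fun x => smooth_orthant l (ctr y1 x))) => r8.
move: (alpha * (2 * L)) smooth_bound => c b.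
by rewrite !ler_norml; lra.
Qed.

(** The strip probabilities that bound the derivative are controlled by the very
    distance under study; since the constant in front is small, the resulting
    inequality for the supremum over all mixing weights closes up. *)
Lemma interp_comparison y :
  `|Q 1 (orth y) - Q 0 (orth y)| <= 9 * L * alpha + 3 * delta + 2 * tau.
Proof.
have h : rho <= 2 * L * alpha + delta + smooth_bound.
  apply: ge_sup; first by exists (dist 0 y), 0, y.
  by move=> _ [u [z [u01 ->]]]; exact: dist_le.
have L0 : 0 <= L by rewrite (le_trans ler01)//; exact: L1.
have La0 : 0 <= L * alpha by rewrite mulr_ge0.
have X0 : 0 <= 2 * rho + (9 * L * alpha + delta).
  by rewrite !addr_ge0 ?mulr_ge0//; exact: rho0.
have AX := ler_wpM2r X0 A4.
have one01 : 0 <= (1 : R) <= 1 by rewrite ler01 lexx.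
have hr := dist_le_rho y one01; rewrite /smooth_bound in h.
have e9 : 9 * L * alpha = 9 * (L * alpha) by ring.
have e2 : 2 * L * alpha = 2 * (L * alpha) by ring.
apply: (le_trans hr); move: h AX La0 X0 delta0 tau0; rewrite e9 e2.
by move: rho (L * alpha) (A * _) => r x a'; lra.
Qed.

End comparison.

(** * The law of a sum of independent vectors *)

Section packaging.
Context {d d' : measure_display} {T : measurableType d} {T' : measurableType d'}.

Definition mfun_of (f : T -> T') (mf : measurable_fun setT f) : {mfun T >-> T'} :=
  MeasurableFun.Pack (MeasurableFun.Class (isMeasurableFun.Build _ _ _ _ _ mf)).

End packaging.

Section pair_law.
Context {d d1 d2 : measure_display} {T : measurableType d}.
Context {E1 : measurableType d1} {E2 : measurableType d2} {R : realType}.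
Variable P : probability T R.
Variables (S : {mfun T >-> E1}) (X : {mfun T >-> E2}) (H : set T).
Hypothesis mH : measurable H.

Let SX t := (S t, X t).

Let mSX : measurable_fun setT SX.
Proof. exact: measurable_fun_pair. Qed.

(** Intersecting with [H] multiplies the measure of every rectangle by the same
    factor, and rectangles determine a finite measure. *)
Lemma independent_pair_law :
  (forall A B, measurable A -> measurable B ->
    P (S @^-1` A `&` X @^-1` B `&` H) = (P (S @^-1` A) * P (X @^-1` B) * P H)%E) ->
  forall C, measurable C ->
    P (SX @^-1` C `&` H) = ((distribution P S \x distribution P X) C * P H)%E.
Proof.
move=> ind C mC.
have PH : P H = (fine (P H))%:E by rewrite fineK// fin_num_measure.
have PH0 : 0 <= fine (P H) by rewrite fine_ge0.
pose r := NngNum PH0.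
pose m1 : {measure set (E1 * E2) -> \bar R} := pushforward (mrestr P mH) SX.
pose m2 : {measure set (E1 * E2) -> \bar R} :=
  mscale r (distribution P S \x distribution P X)%E.
transitivity (m1 mSX C); first by [].
transitivity (m2 C); last by rewrite /m2 /= /mscale /= -PH muleC.
apply: (measure_unique [set A `*` B | A in measurable & B in measurable]
  (fun=> setT) _ _ _ _ (m1 mSX) m2) => //.
- by rewrite measurable_prod_measurableType.
- move=> _ _ [A1 mA1 [A2 mA2 <-]] [B1 mB1 [B2 mB2 <-]].
  exists (A1 `&` B1); first exact: measurableI.
  by exists (A2 `&` B2); [exact: measurableI|rewrite setXI].
- by move=> _; exists setT => //; exists setT => //; rewrite setXTT.
- by rewrite bigcup_const//; exists 0%N.
- move=> _ [A mA [B mB <-]].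
  transitivity (P (S @^-1` A `&` X @^-1` B `&` H)); first by [].
  rewrite ind// /m2 /= /mscale /= product_measure1E// -PH muleC.
  by rewrite /distribution /pushforward.
- move=> _; apply: (@le_lt_trans _ _ 1%E); last exact: ltry.
  by apply: probability_le1; rewrite preimage_setT; exact: measurableI.
Qed.

End pair_law.

Lemma Ex_independent_pair d d1 d2 (T : measurableType d) (E1 : measurableType d1)
    (E2 : measurableType d2) (R : realType) (P : probability T R)
    (S : {mfun T >-> E1}) (X : {mfun T >-> E2}) (F : E1 * E2 -> R) (M : R) :
  (forall A B, measurable A -> measurable B ->
    P (S @^-1` A `&` X @^-1` B) = (P (S @^-1` A) * P (X @^-1` B))%E) ->
  measurable_fun setT F -> (forall z, `|F z| <= M) ->
  Ex P (fun t => F (S t, X t)) = Ex P (fun t => Ex P (fun t' => F (S t, X t'))).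
Proof.
move=> ind mF FM.
pose SX t := (S t, X t).
have mSX : measurable_fun setT SX by exact: measurable_fun_pair.
have law C : measurable C ->
    P (SX @^-1` C) = ((distribution P S \x distribution P X) C)%E.
  move=> mC; have := @independent_pair_law _ _ _ _ _ _ _ P S X setT measurableT _ C mC.
  rewrite setIT probability_setT mule1; apply => A B mA mB.
  by rewrite setIT ind// mule1.
have bF : forall x, `|Ex (distribution P X) (fun y => F (x, y))| <= M.
  move=> x; rewrite -[leRHS](Ex_cst (distribution P X) M); apply: le_norm_Ex => //.
    apply: (@rint_bounded _ _ _ _ _ M) => //.
    by apply: measurableT_comp => //; exact: measurable_pair1.
  exact: rint_cst.
have Exd d' (E : measurableType d') (V : {mfun T >-> E}) (g : E -> R) N :
    measurable_fun setT g -> (forall x, `|g x| <= N) ->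
    Ex (distribution P V) g = Ex P (fun t => g (V t)).
  move=> mg gN; apply: EFin_inj.
  rewrite EFin_Ex; last exact: rint_bounded mg gN.
  rewrite EFin_Ex; last first.
    by apply: (@rint_bounded _ _ _ _ _ N) => //; exact: measurableT_comp.
  rewrite integral_distribution//; first exact/measurable_EFinP.
  by apply: (@rint_bounded _ _ _ _ _ N) => //; exact: measurableT_comp.
apply: EFin_inj.
transitivity (\int[distribution P S \x distribution P X]_z (F z)%:E)%E.
  rewrite EFin_Ex; last first.
    by apply: (@rint_bounded _ _ _ _ _ M) => //; exact: measurableT_comp.
  rewrite -[LHS]/(\int[P]_t ((EFin \o F) \o (mfun_of mSX)) t)%E.
  rewrite -(@integral_distribution _ _ _ _ _ _ (mfun_of mSX))//; last 2 first.
  - exact/measurable_EFinP.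
  - by apply: (@rint_bounded _ _ _ _ _ M) => //; exact: measurableT_comp.
  apply: eq_measure_integral => C mC _.
  exact: law.
rewrite -(Ex_product (distribution P S) (distribution P X) mF FM).
congr EFin; rewrite (Exd _ _ S _ M)//; last first.
  exact: (measurable_Ex_section (distribution P S) _ mF FM).
congr Ex; apply/funext => t; apply: (Exd _ _ X _ M) => //.
by apply: measurableT_comp => //; exact: measurable_pair1.
Qed.

Section grouping.
Context {d : measure_display} {T : measurableType d} {R : realType} {p : nat}.
Variable P : probability T R.
Local Notation E := (p.-tuple R).
Context {I : finType}.
Variable X : I -> {RV P >-> E}.
Hypothesis indX : mutually_independent X.
Variable c : R.

Definition vscale (v : E) : E := [tuple c * tnth v j | j < p].

Definition scaled (i : I) (t : T) : E := vscale (X i t).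

Fixpoint scaled_sum (s : seq I) (t : T) : E :=
  if s is i :: s' then vadd (scaled_sum s' t) (scaled i t) else vzero.

Lemma measurable_vscale : measurable_fun setT vscale.
Proof.
apply/measurable_fun_tnthP => j.
rewrite (_ : _ \o _ = (fun v : E => c * tnth v j)); last first.
  by apply/funext => v /=; rewrite tnth_mktuple.
by apply: measurable_funM => //; exact: measurable_tnth.
Qed.

Lemma measurable_scaled i : measurable_fun setT (scaled i).
Proof. exact: (measurableT_comp measurable_vscale (measurable_funPT (X i))). Qed.

Lemma measurable_scaled_sum s : measurable_fun setT (scaled_sum s).
Proof.
elim: s => [|i s ih] /=; first exact: measurable_cst.
by apply: measurable_vadd => //; exact: measurable_scaled.
Qed.

Let cyl (J : {set I}) (B : I -> set E) : set T := \bigcap_(i in [set` J]) (X i @^-1` B i).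

Let mcyl J B : (forall i, measurable (B i)) -> measurable (cyl J B).
Proof.
move=> mB; apply: fin_bigcap_measurable; first exact: finite_finset.
by move=> i _; rewrite -[X in measurable X]setTI; exact: (measurable_funPT (X i)).
Qed.

(** One vector is added at a time.  Since the partial sum and the next vector have
    a product law even on an event that involves only the remaining vectors, the
    event splits off from any event of the pair, in particular from one on its sum. *)
Lemma scaled_sum_indep s (J : {set I}) A B : uniq s -> {in s, forall i, i \notin J} ->
  measurable A -> (forall i, measurable (B i)) ->
  P (scaled_sum s @^-1` A `&` cyl J B) = (P (scaled_sum s @^-1` A) * P (cyl J B))%E.
Proof.
elim: s J A B => [|i s ih] J A B /=.
  move=> _ _ mA mB; rewrite preimage_cst; case: ifPn => _.
    by rewrite setTI probability_setT mul1e.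
  by rewrite set0I measure0 mul0e.
move=> /andP[is_ us] sJ mA mB.
have iJ : i \notin J by apply: sJ; rewrite mem_head.
pose S := mfun_of (measurable_scaled_sum s).
pose C := [set z : E * E | A (vadd z.1 (vscale z.2))].
have mC : measurable C.
  have mv : measurable_fun setT (fun z : E * E => vadd z.1 (vscale z.2)).
    apply: measurable_vadd => //.
    exact: (measurableT_comp measurable_vscale measurable_snd).
  by rewrite -[C]setTI; exact: mv.
have law (J' : {set I}) : i \notin J' -> {in s, forall k, k \notin J'} ->
    P ((fun t => (S t, X i t)) @^-1` C `&` cyl J' B) =
    ((distribution P S \x distribution P (X i)) C * P (cyl J' B))%E.
  move=> iJ' sJ'; apply: independent_pair_law => //; first exact: mcyl.
  move=> A1 A2 mA1 mA2.
  pose B' k := if k == i then A2 else B k.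
  have mB' k : measurable (B' k) by rewrite /B'; case: ifP.
  have cylE : X i @^-1` A2 `&` cyl J' B = cyl (i |: J') B'.
    apply/seteqP; split => t /=.
      move=> [tA tB] k /=; rewrite in_setU1 /B'; case: eqP => [->//|_] /= kJ.
      exact: tB.
    move=> h; split.
      by have := h i; rewrite /= setU11 /B' eqxx; apply.
    move=> k /= kJ; have := h k; rewrite /= setU1r// /B'.
    by case: eqP => [ki|_]; [rewrite -ki kJ in iJ'|apply].
  have := ih (i |: J') A1 B' us _ mA1 mB'; rewrite -cylE setIA => ->; last first.
    move=> k ks; rewrite in_setU1 negb_or sJ'// andbT.
    by apply: contraNneq is_ => <-.
  rewrite cylE /cyl indX// big_setU1//= -muleA; congr (_ * (_ * _))%E.
    by rewrite /B' eqxx.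
  rewrite -indX//.
  congr (P _); apply: eq_bigcapr => k /= kJ; rewrite /B'.
  by case: eqP => [ki|//]; rewrite -ki kJ in iJ'.
have sJ0 : {in s, forall k, k \notin J}.
  by move=> k ks; apply: sJ; rewrite inE ks orbT.
pose D := (fun t => (S t, X i t)) @^-1` C.
have lawT : P D = ((distribution P S \x distribution P (X i)) C)%E.
  have := law (@finset.set0 I); rewrite /cyl indX// big_set0 mule1 => <-.
  - congr (P _); rewrite (_ : [set` @finset.set0 I] = set0) ?bigcap_set0 ?setIT//.
    by apply/seteqP; split => k //=; rewrite inE.
  - by rewrite inE.
  - by move=> k _; rewrite inE.
by change (P (D `&` cyl J B) = (P D * P (cyl J B))%E); rewrite lawT law.
Qed.

Lemma Ex_scaled_sum (s : seq I) (f : E -> R) : uniq s -> bmeas f ->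
  Ex P (fun t => f (scaled_sum s t)) = interp P scaled scaled 1 s f.
Proof.
elim: s f => [|i s ih] f /=; first by rewrite Ex_cst.
move=> /andP[is_ us] bf; have [mf [M fM]] := bf.
have -> : mix P scaled scaled 1 i f = avg P (scaled i) f.
  by apply/funext => x; rewrite /mix subrr mul0r addr0 mul1r.
rewrite -ih//; last by apply: bmeas_avg => //; exact: measurable_scaled.
pose S := mfun_of (measurable_scaled_sum s).
pose F (z : E * E) := f (vadd z.1 (vscale z.2)).
have mF : measurable_fun setT F.
  apply: measurableT_comp => //; apply: measurable_vadd => //.
  exact: (measurableT_comp measurable_vscale measurable_snd).
have FM z : `|F z| <= M by exact: fM.
apply: (@Ex_independent_pair _ _ _ _ _ _ _ P S (X i) F M) => // A B mA mB.
pose B' (k : I) := B.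
have cylE : cyl [set i] B' = X i @^-1` B.
  by rewrite /cyl (_ : [set` [set i]%SET] = [set i]) ?bigcap_set1//;
    apply/seteqP; split => k /=; rewrite inE => /eqP.
have := @scaled_sum_indep s [set i]%SET A B' us _ mA; rewrite cylE; apply => //.
by move=> k ks; rewrite inE; apply: contraNneq is_ => <-.
Qed.

End grouping.

Lemma interp_ends d (T : measurableType d) (R : realType) (p : nat)
    (P : probability T R) (I : eqType) (Y Z : I -> T -> p.-tuple R) s f :
  interp P Y Z 1 s f = interp P Y Y 1 s f /\ interp P Y Z 0 s f = interp P Z Z 1 s f.
Proof.
elim: s f => [//|i s ih] f /=; split.
  rewrite (ih _).1; congr (interp P Y Y 1 s _); apply/funext => x.
  by rewrite /mix subrr !mul0r.
rewrite (ih _).2; congr (interp P Z Z 1 s _); apply/funext => x.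
by rewrite /mix subrr !mul0r addr0 add0r subr0 mul1r.
Qed.

Lemma interp_orthant_bound (R : realType) : exists2 C : R, 1 <= C &
  forall (d : measure_display) (T : measurableType d) (P : probability T R) (p : nat)
    (I : finType) (Y Z : I -> T -> p.-tuple R) (l a2 a3 M tau alpha delta : R),
  (0 < p)%N -> 0 < l <= 1 -> ln p%:R <= l^-1 -> 0 <= alpha -> 0 <= delta ->
  (forall i, centered4 P (Y i)) -> (forall i, centered4 P (Z i)) ->
  (forall i, 2^-1 <= Ex P (fun t => (sup_norm (Y i t) <= 1)%R%:R)) ->
  (forall i, 2^-1 <= Ex P (fun t => (sup_norm (Z i t) <= 1)%R%:R)) ->
  (forall j k, `|\sum_i (mom2 P (Y i) j k - mom2 P (Z i) j k)| <= a2) ->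
  (forall j k m, `|\sum_i (mom3 P (Y i) j k m - mom3 P (Z i) j k m)| <= a3) ->
  (forall j, \sum_i (mom4 P (Y i) j + mom4 P (Z i) j) <= M) ->
  \sum_i (tail P (Y i) + tail P (Z i)) <= tau ->
  C * l * (a2 + a3 + M) <= 4^-1 ->
  (forall y t, 0 < t -> interp P Y Z 0 (index_enum I) (orth (vec_shift y t)) -
     interp P Y Z 0 (index_enum I) (orth y) <= alpha * t + delta) ->
  forall y, `|interp P Y Z 1 (index_enum I) (orth y) -
      interp P Y Z 0 (index_enum I) (orth y)| <=
    9 * l^-1 * alpha + 3 * delta + 2 * (C * l * tau).
Proof.
have [C0 C01 ex] := @merged_expansion R.
have e2 : 1 <= expR 2 :> R by rewrite -[leLHS]expR0 ler_expR.
pose C := 103 * expR 2 * C0; exists C.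
  by rewrite /C -[leLHS]mul1r ler_pM// -[leLHS]mulr1 ler_pM//; lra.
move=> d T P p I Y Z l a2 a3 M tau alpha delta p0 l01 lnp al0 de0 cY cZ sY sZ.
move=> a2P a3P MP tauP small anti y.
have C0' : 0 <= C0 by rewrite (le_trans _ C01).
have Cl0 : 0 <= C * l.
  by case/andP: l01 => l0 _; rewrite !mulr_ge0// ?expR_ge0// ltW.
have tau0 : 0 <= tau.
  by apply: le_trans tauP; apply: sumr_ge0 => i _; rewrite addr_ge0 ?tail_ge0.
have a0 : 0 <= a2 + a3 + M.
  rewrite !addr_ge0//.
  - exact: le_trans (a2P (Ordinal p0) (Ordinal p0)).
  - exact: le_trans (a3P (Ordinal p0) (Ordinal p0) (Ordinal p0)).
  - apply: le_trans (MP (Ordinal p0)); apply: sumr_ge0 => i _.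
    by rewrite addr_ge0 ?mom4_ge0.
apply: (@interp_comparison _ _ _ _ P _ Y Z p0 cY cZ l (C * l * (a2 + a3 + M))) => //.
- by rewrite mulr_ge0.
- by rewrite mulr_ge0.
- move=> z u u01; rewrite -mulrA -mulrDr.
  apply: (@interp_derivative_bound _ _ _ _ P _ Y Z p0 cY cZ sY sZ) => // x.
  exact: ex.
Qed.

(** * Moments of the scaled vectors *)

Section scaled_moments.
Context {d : measure_display} {T : measurableType d} {R : realType} {p : nat}.
Variable P : probability T R.
Local Notation E := (p.-tuple R).

Lemma expectation_Ex (f : T -> R) : rint P f -> ('E_P[f] = (Ex P f)%:E)%E.
Proof. by move=> rf; rewrite expectation.unlock EFin_Ex. Qed.

Lemma rint_expectation_le (f : T -> R) (r : R) : measurable_fun setT f ->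
  (forall t, 0 <= f t) -> ('E_P[f] <= r%:E)%E -> rint P f /\ Ex P f <= r.
Proof.
move=> mf f0 Er; have rf : rint P f.
  apply/integrableP; split; first exact/measurable_EFinP.
  apply: (le_lt_trans _ (ltry r)); apply: le_trans Er.
  rewrite expectation.unlock le_eqVlt; apply/orP; left; apply/eqP.
  by apply: eq_integral => t _ /=; rewrite ger0_norm.
by split=> //; rewrite -lee_fin -expectation_Ex.
Qed.

Lemma tnth_vscale c (v : E) j : tnth (vscale c v) j = c * tnth v j.
Proof. by rewrite tnth_mktuple. Qed.

Lemma sup_norm_vscale c (v : E) : 0 <= c -> sup_norm (vscale c v) <= c * sup_norm v.
Proof.
move=> c0; apply: sup_norm_le => [|j]; first by rewrite mulr_ge0 ?sup_norm_ge0.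
by rewrite tnth_vscale normrM ger0_norm// ler_wpM2l// le_sup_norm.
Qed.

Variables (V : T -> E) (c : R).
Hypotheses (mV : measurable_fun setT V) (c0 : 0 <= c).
Hypotheses (V8 : rint P (fun t => sup_norm (V t) ^+ 8))
  (V1 : forall j, Ex P (fun t => tnth (V t) j) = 0).
Let N t := sup_norm (V t).
Let Y t := vscale c (V t).

Let mN : measurable_fun setT N. Proof. exact: measurable_sup_norm. Qed.

Let mY : measurable_fun setT Y.
Proof. exact: (measurableT_comp (measurable_vscale c) mV). Qed.

Lemma centered4_of_moment8 : centered4 P V.
Proof.
split=> //; apply: (@rint_dom _ _ _ P _ (fun t => 1 + N t ^+ 8)).
- exact: measurable_funX.
- have key (x : R) : x <= 1 + x ^+ 2.
    have -> : 1 + x ^+ 2 = (x - 2^-1) ^+ 2 + 3 / 4 + x by field.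
    by rewrite lerDr addr_ge0 ?sqr_ge0.
  move=> t; rewrite normrX ger0_norm ?sup_norm_ge0//.
  by apply: (le_trans (key _)); rewrite -exprM.
- by apply: rintD => //; exact: rint_cst.
Qed.

Let cV := centered4_of_moment8.

Lemma centered4_vscale : centered4 P Y.
Proof.
split=> //.
- apply: (@rint_dom _ _ _ P _ (fun t => c ^+ 4 * N t ^+ 4)).
  + by apply: measurable_funX; exact: measurable_sup_norm.
  + move=> t; rewrite normrX ger0_norm ?sup_norm_ge0// -exprMn.
    by rewrite lerXn2r ?nnegrE ?mulr_ge0 ?sup_norm_ge0//; exact: sup_norm_vscale.
  + by apply: rintZ; case: cV.
- move=> j; rewrite (_ : (fun t => _) = fun t => c * tnth (V t) j).
    by rewrite ExZ ?V1 ?mulr0//; exact: rint_tnth.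
  by apply/funext => t; rewrite tnth_vscale.
Qed.

Lemma mom2_vscale j k : mom2 P Y j k = c ^+ 2 * mom2 P V j k.
Proof.
rewrite /mom2 -ExZ; last exact: rint_tnth2.
by congr Ex; apply/funext => t; rewrite !tnth_vscale; ring.
Qed.

Lemma mom3_vscale j k m : mom3 P Y j k m = c ^+ 3 * mom3 P V j k m.
Proof.
rewrite /mom3 -ExZ; last exact: rint_tnth3.
by congr Ex; apply/funext => t; rewrite !tnth_vscale; ring.
Qed.

Lemma mom4_vscale j : mom4 P Y j = c ^+ 4 * mom4 P V j.
Proof.
rewrite /mom4 -ExZ; last exact: rint_tnth4.
by congr Ex; apply/funext => t; rewrite !tnth_vscale; ring.
Qed.

Variable G : set T.
Hypotheses (mG : measurable G) (VG : forall t, 1 < c * N t -> G t).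

Let rG : rint P (\1_G : T -> R).
Proof.
apply: (@rint_bounded _ _ _ _ _ 1) => [|t]; first exact: measurable_indic.
by rewrite indicE ger0_norm// lern1; case: (_ \in _).
Qed.

(** The product of the fourth power with an indicator is split by the
    arithmetic-geometric inequality, with a free parameter that balances the
    moment of order eight against the probability of the event. *)
Lemma tail_vscale_le sg : 0 < sg ->
  tail P Y <= c ^+ 4 / 2 * (Ex P (fun t => N t ^+ 8) / sg + sg * fine (P G)).
Proof.
move=> sg0; rewrite -Ex_indic// -(ExZ sg rG) mulrC -[X in X + _]mulrC -(ExZ _ V8).
rewrite -ExD; [|exact: rintZ|exact: rintZ].
rewrite [leRHS]mulrC -ExZ; last by apply: rintD; exact: rintZ.
apply: le_Ex.
- exact: rint_tail4 centered4_vscale _.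
- by apply: rintZ; apply: rintD; exact: rintZ.
move=> t; rewrite /tail4.
have N0 : 0 <= N t := sup_norm_ge0 _.
have rhs0 : 0 <= c ^+ 4 / 2 * (sg^-1 * N t ^+ 8 + sg * \1_G t).
  by rewrite !mulr_ge0 ?exprn_ge0 ?addr_ge0 ?mulr_ge0 ?exprn_ge0 ?invr_ge0 ?(ltW sg0)//
    indicE.
case: ltP => [lt1|_]; last by rewrite mul0r.
have Gt : G t by apply: VG; exact: lt_le_trans lt1 (sup_norm_vscale _ c0).
rewrite mul1r indicE mem_set// mulr1.
apply: (@le_trans _ _ (c ^+ 4 * N t ^+ 4)).
  rewrite -exprMn lerXn2r ?nnegrE ?mulr_ge0 ?sup_norm_ge0//.
  exact: sup_norm_vscale.
rewrite -mulrA ler_wpM2l ?exprn_ge0// -subr_ge0.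
have -> : 2^-1 * (sg^-1 * N t ^+ 8 + sg) - N t ^+ 4 =
    2^-1 * (sg^-1 * (N t ^+ 4 - sg) ^+ 2).
  by field; rewrite gt_eqF.
apply: mulr_ge0; first by rewrite invr_ge0.
by apply: mulr_ge0; [rewrite invr_ge0 ltW|exact: sqr_ge0].
Qed.

Lemma small_vscale : fine (P G) <= 2^-1 ->
  2^-1 <= Ex P (fun t => (sup_norm (Y t) <= 1)%R%:R).
Proof.
move=> PG; apply: (@le_trans _ _ (Ex P (fun t => 1 - \1_G t))).
  rewrite ExB ?Ex_cst ?Ex_indic//; last exact: rint_cst.
  lra.
have mYN := measurable_sup_norm mY.
apply: le_Ex.
- by apply: rintB => //; exact: rint_cst.
- apply: (@rint_bounded _ _ _ _ _ 1) => [|t]; last first.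
    by rewrite ger0_norm// lern1; case: (_ <= _).
  pose A := (fun t => sup_norm (Y t)) @^-1` [set` `]-oo, 1]].
  have -> : (fun t => (sup_norm (Y t) <= 1)%R%:R : R) = \1_A.
    apply/funext => t; rewrite indicE; congr ((nat_of_bool _)%:R).
    by apply/idP/idP => [h|/set_mem]; rewrite ?in_setE /A /= in_itv//.
  apply: measurable_indic; rewrite -[X in measurable X]setTI.
  by apply: mYN => //; exact: measurable_itv.
- move=> t; rewrite indicE; case: (leP _ 1) => [_|lt1].
    by rewrite gerBl.
  rewrite mem_set ?subrr//; apply: VG.
  exact: lt_le_trans lt1 (sup_norm_vscale _ c0).
Qed.

End scaled_moments.

Section orthant_events.
Context {d : measure_display} {T : measurableType d} {R : realType} {n p : nat}.
Variable P : probability T R.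
Variable X : 'I_n -> {RV P >-> p.-tuple R}.

Lemma tnth_scaled_sum c s t j :
  tnth (scaled_sum X c s t) j = c * \sum_(i <- s) tnth (X i t) j.
Proof.
elim: s => [|i s ih] /=; first by rewrite big_nil mulr0 tnth_mktuple.
by rewrite tnth_vadd ih big_cons mulrDr addrC /scaled tnth_vscale.
Qed.

Lemma orth_scaled_sum c y : 0 < c -> (0 < n)%N ->
  (fun t => orth (vscale (c * Num.sqrt n%:R) y) (scaled_sum X c (index_enum 'I_n) t)) =
  \1_(sum_le_event X y).
Proof.
move=> c0 n0; have sn0 : 0 < Num.sqrt n%:R :> R by rewrite sqrtr_gt0 ltr0n.
apply/funext => t; rewrite /orth indicE; congr ((nat_of_bool _)%:R).
have le j : (tnth (scaled_sum X c (index_enum 'I_n) t) j <=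
      tnth (vscale (c * Num.sqrt n%:R) y) j) =
    (tnth (normalized_sum (fun i => X i t)) j <= tnth y j).
  rewrite tnth_scaled_sum tnth_vscale -mulrA ler_pM2l// tnth_mktuple.
  by rewrite ler_pdivrMl.
apply/forallP/idP => [h|/set_mem h j].
  by rewrite in_setE => j; rewrite -le.
by rewrite le; exact: h.
Qed.

Lemma measurable_sum_le_event y : (0 < n)%N -> measurable (sum_le_event X y).
Proof.
move=> n0; apply/(@measurable_indicP _ T R); rewrite -(orth_scaled_sum y ltr01 n0).
have [mo _] := bmeas_orth (vscale (1 * Num.sqrt n%:R) y).
by apply: measurableT_comp => //; exact: measurable_scaled_sum.
Qed.

Lemma prob_sum_le_event c y : 0 < c -> (0 < n)%N -> mutually_independent X ->
  P (sum_le_event X y) = (interp P (scaled X c) (scaled X c) 1 (index_enum 'I_n)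
    (orth (vscale (c * Num.sqrt n%:R) y)))%:E.
Proof.
move=> c0 n0 indX.
rewrite -Ex_scaled_sum//; [|exact: index_enum_uniq|exact: bmeas_orth].
have mA := measurable_sum_le_event y n0.
by rewrite (orth_scaled_sum y c0 n0) Ex_indic// fineK// fin_num_measure.
Qed.

End orthant_events.

Lemma joint_family_indep (d d' : measure_display) (T : measurableType d)
    (E : measurableType d') (R : realType) (P : probability T R) (I1 I2 : finType)
    (X : I1 -> {RV P >-> E}) (Y : I2 -> {RV P >-> E}) :
  mutually_independent (joint_family X Y) ->
  mutually_independent X /\ mutually_independent Y.
Proof.
move=> ind; split=> J A mA.
- pose A' (k : I1 + I2) := if k is inl i then A i else setT.
  have mA' k : measurable (A' k) by case: k => i; [exact: mA|exact: measurableT].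
  have := ind (inl @: J)%SET A' mA'.
  rewrite big_imset/=; last by move=> i j _ _ [].
  move=> <-; congr (P _); apply/seteqP; split => t h.
    by move=> k /= /imsetP[i iJ ->]; exact: h.
  by move=> i /= iJ; apply: (h (inl i)); exact: imset_f.
- pose A' (k : I1 + I2) := if k is inr i then A i else setT.
  have mA' k : measurable (A' k) by case: k => i; [exact: measurableT|exact: mA].
  have := ind (inr @: J)%SET A' mA'.
  rewrite big_imset/=; last by move=> i j _ _ [].
  move=> <-; congr (P _); apply/seteqP; split => t h.
    by move=> k /= /imsetP[i iJ ->]; exact: h.
  by move=> i /= iJ; apply: (h (inr i)); exact: imset_f.
Qed.

(** * Choice of the constants *)

Section rates.
Context {R : realType}.
(* [m] and [r] are the square roots of the logarithmic factor and of the sample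
   size, and [th] is the rate to be proved. *)
Variables (m r B th c0 : R).
Hypotheses (m1 : 1 <= m) (B1 : 1 <= B) (r0 : 0 < r) (th0 : 0 < th) (th1 : th <= 1)
  (c00 : 0 < c0) (c01 : c0 <= 1).
Hypothesis rate : th ^+ 2 * r = B * m ^+ 5.

Let m0 : 0 < m. Proof. exact: lt_le_trans ltr01 m1. Qed.
Let B0 : 0 < B. Proof. exact: lt_le_trans ltr01 B1. Qed.
(* After the vectors are multiplied by [c], increments of norm one are the typical
   large ones, the smoothing has width [m ^+ 2], and the terms of order two and
   four are bounded by constants that only depend on [c0]. *)
Let c := c0 * th / (B * m ^+ 2).

Let mN : m != 0. Proof. exact: lt0r_neq0. Qed.
Let BN : B != 0. Proof. exact: lt0r_neq0. Qed.
Let tN : th != 0. Proof. exact: lt0r_neq0. Qed.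

Let rE : r = B * m ^+ 5 / th ^+ 2.
Proof. by rewrite -rate mulrAC mulfV ?mul1r// expf_neq0. Qed.

Lemma rate_scale : c * r = c0 * m ^+ 3 / th.
Proof. by rewrite /c rE; field; rewrite mN BN tN. Qed.

Lemma rate_second K : (m ^+ 2)^-1 * (c ^+ 2 * (r * (K * B * m))) = c0 ^+ 2 * K.
Proof. by rewrite /c rE; field; rewrite mN BN tN. Qed.

Lemma rate_third K : (m ^+ 2)^-1 * (c ^+ 3 * (r * (K * B ^+ 2 * m ^+ 3))) =
  c0 ^+ 3 * th * K.
Proof. by rewrite /c rE; field; rewrite mN BN tN. Qed.

Lemma rate_fourth K : (m ^+ 2)^-1 * (c ^+ 4 * (r ^+ 2 * (K * B ^+ 2))) = c0 ^+ 4 * K.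
Proof. by rewrite /c rE; field; rewrite mN BN tN. Qed.

Lemma rate_coefficients (Cm Cv : R) : 0 <= Cm -> 0 <= Cv ->
  (m ^+ 2)^-1 * (c ^+ 2 * (r * (Cm * B * m)) + c ^+ 3 * (r * (Cm * B ^+ 2 * m ^+ 3))
    + c ^+ 4 * (r ^+ 2 * (Cv * B ^+ 2))) <= c0 * (2 * Cm + Cv).
Proof.
move=> Cm0 Cv0; rewrite !mulrDr rate_second rate_third rate_fourth.
have h k : (0 < k)%N -> c0 ^+ k <= c0.
  by move=> k0; rewrite -[leRHS]expr1 ler_wiXn2l// ltW.
have h3 : c0 ^+ 3 * th <= c0.
  by rewrite (le_trans _ (h 3%N isT))// ler_piMr// exprn_ge0// ltW.
have -> : c0 * (2 * Cm) = c0 * Cm + c0 * Cm by ring.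
by rewrite !lerD// ler_wpM2r// h.
Qed.

Lemma rate_tail K : 0 <= K -> 1 <= r ->
  (m ^+ 2)^-1 * (c ^+ 4 * (r ^+ 2 * (B ^+ 4 * m ^+ 8 / r ^+ 4 * K))) <= K * th.
Proof.
move=> K0 r1.
have rN : r != 0 by exact: lt0r_neq0.
have -> : (m ^+ 2)^-1 * (c ^+ 4 * (r ^+ 2 * (B ^+ 4 * m ^+ 8 / r ^+ 4 * K))) =
    K * th * (c0 ^+ 4 * th ^+ 3 * (m ^+ 2)^-1 * (r ^+ 2)^-1).
  by rewrite /c; field; rewrite mN BN rN.
rewrite ler_piMr ?mulr_ge0 ?(ltW th0)//.
have inv1 (x : R) : 1 <= x -> 0 <= x^-1 <= 1.
  by move=> x1; rewrite invr_ge0 (le_trans ler01 x1)/= invf_le1// (lt_le_trans ltr01).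
have /andP[a0 a1] := inv1 _ (exprn_ege1 2 m1).
have /andP[b0 b1] := inv1 _ (exprn_ege1 2 r1).
have t31 : th ^+ 3 <= 1 by rewrite exprn_ile1// ltW.
have c41 : c0 ^+ 4 <= 1 by rewrite exprn_ile1// ltW.
have t30 : 0 <= th ^+ 3 by rewrite exprn_ge0// ltW.
have c40 : 0 <= c0 ^+ 4 by rewrite exprn_ge0// ltW.
have p1 := mulr_ile1 c40 t30 c41 t31; have p0 := mulr_ge0 c40 t30.
have q1 := mulr_ile1 p0 a0 p1 a1; have q0 := mulr_ge0 p0 a0.
exact: mulr_ile1.
Qed.

End rates.

Lemma ln_ge1 (R : realType) (k : nat) : (6 <= k)%N -> 1 <= ln k%:R :> R.
Proof.
move=> k6; rewrite -[leLHS]expRK ler_ln ?posrE ?expR_gt0 ?ltr0n ?(leq_trans _ k6)//.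
apply: (@le_trans _ _ 4); last by rewrite ler_nat (leq_trans _ k6).
have h : 2^-1 <= expR (- 2^-1) :> R.
  by rewrite (le_trans _ (expR_ge1Dx _))//; lra.
have e0 : 0 < expR (2^-1) :> R := expR_gt0 _.
have e2 : expR (2^-1) <= 2 :> R.
  by rewrite -[leRHS]invrK -[leLHS]invrK lef_pV2 ?posrE ?invr_gt0// -expRN.
have -> : expR 1 = expR (2^-1) * expR (2^-1) :> R by rewrite -expRD; congr expR; field.
by rewrite (_ : 4 = 2 * 2 :> R) ?ler_pM//; ring.
Qed.

(** * The comparison bound *)

Lemma le_bigmaxe (R : realType) (p : nat) (F : 'I_p -> \bar R) (x : \bar R) :
  (\big[maxe/-oo]_(j < p) F j <= x)%E -> forall j, (F j <= x)%E.
Proof. by move=> h j; apply: le_trans h; exact: (le_bigmax -oo%E F j). Qed.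

Lemma Ex_expectation d (T : measurableType d) (R : realType) (P : probability T R)
  (f : T -> R) : Ex P f = fine ('E_P[f])%E.
Proof. by rewrite Ex.unlock expectation.unlock. Qed.

Section assembly.
Context {d : measure_display} {T : measurableType d} {R : realType}.
Variable P : probability T R.
Variables (n p : nat) (B delta : R) (V Z : 'I_n -> {RV P >-> p.-tuple R}).
Variables (Cv Cp Cb Ca Cm : R).
Hypotheses (n3 : (3 <= n)%N) (p2 : (2 <= p)%N) (B1 : 1 <= B) (delta0 : 0 <= delta).
Hypotheses (Cv0 : 0 < Cv) (Cp1 : 1 <= Cp) (Cb0 : 0 < Cb) (Ca0 : 0 < Ca).
Hypotheses (indV : mutually_independent V) (indZ : mutually_independent Z).
Hypothesis mean0 : forall (i : 'I_n) (j : 'I_p),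
  ('E_P[component (V i) j] = 0)%E /\ ('E_P[component (Z i) j] = 0)%E.

Let L : R := ln (p * n)%:R.
Let m : R := Num.sqrt L.
Let r : R := Num.sqrt n%:R.
Let th : R := (B ^+ 2 * L ^+ 5 / n%:R) `^ (4^-1).

Hypothesis condV : forall j : 'I_p,
    (((n%:R)^-1)%:E * \sum_(i < n) 'E_P[fun w =>
        (component (V i) j w ^+ 4 + component (Z i) j w ^+ 4)%R]
     <= (Cv * B ^+ 2)%:E)%E.
Hypothesis condP : forall i : 'I_n,
    (P [set w | (Cp * B * L < Num.max (sup_norm (V i w)) (sup_norm (Z i w)))%R]
     <= ((n%:R ^+ 4)^-1)%:E)%E.
Hypothesis condB : forall i : 'I_n,
    ('E_P[fun w => (sup_norm (V i w) ^+ 8 + sup_norm (Z i w) ^+ 8)%R]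
     <= (Cb * B ^+ 8 * L ^+ 8)%:E)%E.
Hypothesis condA : forall (y : p.-tuple R) (t : R), 0 < t ->
    (P (sum_le_event Z (vec_shift y t)) - P (sum_le_event Z y)
     <= (Ca * (t * Num.sqrt (ln p%:R) + delta))%:E)%E.
Hypothesis cond2 : (\big[maxe/-oo]_(j < p) \big[maxe/-oo]_(k < p)
     `| ((Num.sqrt n%:R)^-1)%:E *
        \sum_(i < n) ('E_P[fun w =>
                         (component (V i) j w * component (V i) k w)%R] -
                      'E_P[fun w =>
                         (component (Z i) j w * component (Z i) k w)%R]) |
   <= (Cm * B * Num.sqrt L)%:E)%E.
Hypothesis cond3 :
  (\big[maxe/-oo]_(j < p) \big[maxe/-oo]_(k < p) \big[maxe/-oo]_(l < p)
     `| ((Num.sqrt n%:R)^-1)%:E *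
        \sum_(i < n)
          ('E_P[fun w => (component (V i) j w * component (V i) k w
                          * component (V i) l w)%R] -
           'E_P[fun w => (component (Z i) j w * component (Z i) k w
                          * component (Z i) l w)%R]) |
   <= (Cm * B ^+ 2 * Num.sqrt (L ^+ 3))%:E)%E.

Let n0 : (0 < n)%N. Proof. exact: leq_trans n3. Qed.
Let p0 : (0 < p)%N. Proof. exact: leq_trans p2. Qed.
Let nR0 : 0 < n%:R :> R. Proof. by rewrite ltr0n. Qed.
Let B0 : 0 < B. Proof. exact: lt_le_trans ltr01 B1. Qed.
Let L1 : 1 <= L. Proof. by apply: ln_ge1; rewrite (@leq_mul 2 3). Qed.
Let L0 : 0 < L. Proof. exact: lt_le_trans ltr01 L1. Qed.
Let m2 : m ^+ 2 = L. Proof. by rewrite sqr_sqrtr// ltW. Qed.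
Let m1 : 1 <= m. Proof. by rewrite -(sqrtr1 R) ler_wsqrtr. Qed.
Let m0 : 0 < m. Proof. exact: lt_le_trans ltr01 m1. Qed.
Let r2 : r ^+ 2 = n%:R. Proof. by rewrite sqr_sqrtr. Qed.
Let r1 : 1 <= r. Proof. by rewrite -(sqrtr1 R) ler_wsqrtr// ler1n. Qed.
Let r0 : 0 < r. Proof. exact: lt_le_trans ltr01 r1. Qed.

Let rate0 : 0 < B ^+ 2 * L ^+ 5 / n%:R.
Proof. by rewrite divr_gt0// mulr_gt0// exprn_gt0. Qed.

Let th0 : 0 < th. Proof. exact: powR_gt0. Qed.

Let th4 : th ^+ 4 = B ^+ 2 * L ^+ 5 / n%:R.
Proof.
rewrite -powR_mulrn ?powR_ge0// -powRrM mulVf ?pnatr_eq0// powRr1//.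
exact: ltW.
Qed.

Let rate : th ^+ 2 * r = B * m ^+ 5.
Proof.
apply/eqP; rewrite -(@eqrXn2 _ 2)// ?mulr_ge0 ?exprn_ge0 ?(ltW th0) ?(ltW r0)
  ?(ltW B0) ?(ltW m0)//.
have -> : (th ^+ 2 * r) ^+ 2 = th ^+ 4 * r ^+ 2 by ring.
have -> : (B * m ^+ 5) ^+ 2 = B ^+ 2 * (m ^+ 2) ^+ 5 by ring.
rewrite r2 m2 th4.
by rewrite mulfVK// gt_eqF.
Qed.

Let sqrtL3 : Num.sqrt (L ^+ 3) = m ^+ 3.
Proof.
by rewrite -m2 -exprM mulnC exprM sqrtr_sqr ger0_norm// exprn_ge0// ltW.
Qed.

Let moment8 i : [/\ rint P (fun t => sup_norm (V i t) ^+ 8),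
  rint P (fun t => sup_norm (Z i t) ^+ 8) &
  Ex P (fun t => sup_norm (V i t) ^+ 8) + Ex P (fun t => sup_norm (Z i t) ^+ 8)
  <= Cb * B ^+ 8 * L ^+ 8].
Proof.
have mV : measurable_fun setT (fun t => sup_norm (V i t) ^+ 8).
  by apply: measurable_funX; exact: measurable_sup_norm.
have mZ : measurable_fun setT (fun t => sup_norm (Z i t) ^+ 8).
  by apply: measurable_funX; exact: measurable_sup_norm.
have V0 t : 0 <= sup_norm (V i t) ^+ 8 by rewrite exprn_ge0 ?sup_norm_ge0.
have Z0 t : 0 <= sup_norm (Z i t) ^+ 8 by rewrite exprn_ge0 ?sup_norm_ge0.
have [rS Sle] := rint_expectation_le (measurable_funD mV mZ)
  (fun t => addr_ge0 (V0 t) (Z0 t)) (condB i).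
have rV : rint P (fun t => sup_norm (V i t) ^+ 8).
  by apply: rint_dom rS => // t; rewrite ger0_norm// lerDl.
have rZ : rint P (fun t => sup_norm (Z i t) ^+ 8).
  by apply: rint_dom rS => // t; rewrite ger0_norm// lerDr.
by split=> //; rewrite -ExD.
Qed.

Let meanV i j : Ex P (fun t => tnth (V i t) j) = 0.
Proof. by rewrite Ex_expectation (mean0 i j).1. Qed.

Let meanZ i j : Ex P (fun t => tnth (Z i t) j) = 0.
Proof. by rewrite Ex_expectation (mean0 i j).2. Qed.

Let cV i : centered4 P (V i).
Proof. by apply: centered4_of_moment8 => //; have [] := moment8 i. Qed.

Let cZ i : centered4 P (Z i).
Proof. by apply: centered4_of_moment8 => //; have [] := moment8 i. Qed.

Let normalized_le (x y : R) (S : \bar R) : S = x%:E ->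
  (`|((Num.sqrt n%:R)^-1)%:E * S| <= y%:E)%E -> `|x| <= r * y.
Proof.
move=> -> ; rewrite -EFinM abse_EFin lee_fin normrM gtr0_norm ?invr_gt0//.
by rewrite ler_pdivrMl.
Qed.

Let sum_mom2 j k :
  `|\sum_i (mom2 P (V i) j k - mom2 P (Z i) j k)| <= r * (`|Cm| * B * m).
Proof.
have h := le_bigmaxe (le_bigmaxe cond2 j) k.
apply: (@le_trans _ _ (r * (Cm * B * m))); last first.
  by rewrite ler_wpM2l ?(ltW r0)// !ler_wpM2r ?(ltW m0) ?(ltW B0)// ler_norm.
apply: (normalized_le _ h); rewrite -sumEFin; apply: eq_bigr => i _.
by rewrite !expectation_Ex//; exact: rint_tnth2.
Qed.

Let sum_mom3 j k l : `|\sum_i (mom3 P (V i) j k l - mom3 P (Z i) j k l)| <=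
  r * (`|Cm| * B ^+ 2 * m ^+ 3).
Proof.
have h := le_bigmaxe (le_bigmaxe (le_bigmaxe cond3 j) k) l.
rewrite sqrtL3 in h.
apply: (@le_trans _ _ (r * (Cm * B ^+ 2 * m ^+ 3))); last first.
  by rewrite ler_wpM2l ?(ltW r0)// !ler_wpM2r ?exprn_ge0 ?(ltW m0) ?(ltW B0)// ler_norm.
apply: (normalized_le _ h); rewrite -sumEFin; apply: eq_bigr => i _.
by rewrite !expectation_Ex//; exact: rint_tnth3.
Qed.

Let sum_mom4 j : \sum_i (mom4 P (V i) j + mom4 P (Z i) j) <= r ^+ 2 * (Cv * B ^+ 2).
Proof.
have := condV j.
have -> : (\sum_(i < n) 'E_P[fun w =>
      (component (V i) j w ^+ 4 + component (Z i) j w ^+ 4)%R])%E =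
    (\sum_i (mom4 P (V i) j + mom4 P (Z i) j))%:E.
  rewrite -sumEFin; apply: eq_bigr => i _.
  have rV := rint_tnth4 (cV i) j; have rZ := rint_tnth4 (cZ i) j.
  by rewrite expectation_Ex ?ExD//; exact: rintD.
by rewrite -EFinM lee_fin ler_pdivrMl// r2.
Qed.

Let G i := [set w | (Cp * B * L < Num.max (sup_norm (V i w)) (sup_norm (Z i w)))%R].

Let mG i : measurable (G i).
Proof.
have mM : measurable_fun setT (fun w => Num.max (sup_norm (V i w)) (sup_norm (Z i w))).
  by apply: measurable_maxr; exact: measurable_sup_norm.
rewrite (_ : G i = (fun w => Num.max (sup_norm (V i w)) (sup_norm (Z i w)))
  @^-1` `]Cp * B * L, +oo[%classic).
  by rewrite -[X in measurable X]setTI; apply: mM => //; exact: measurable_itv.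
by apply/seteqP; split => w /=; rewrite in_itv/= andbT.
Qed.

Let PG i : fine (P (G i)) <= (r ^+ 8)^-1.
Proof.
rewrite -lee_fin fineK ?fin_num_measure//.
by rewrite -[8%N]/(2 * 4)%N exprM r2; exact: condP.
Qed.

Let PG2 i : fine (P (G i)) <= 2^-1.
Proof.
apply: (le_trans (PG i)); rewrite lef_pV2 ?posrE ?exprn_gt0//.
rewrite -[8%N]/(2 * 4)%N exprM r2 exprS.
have n2 : 2 <= n%:R :> R by rewrite ler_nat (leq_trans _ n3).
have n31 : 1 <= n%:R ^+ 3 :> R by rewrite exprn_ege1// ler1n.
by rewrite -[leLHS]mulr1 ler_pM.
Qed.

Variables (C c0 : R).
Hypotheses (C1 : 1 <= C) (c00 : 0 < c0) (c01 : c0 <= 1) (c0p : c0 * Cp <= 1).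
Hypothesis small : C * (c0 * (2 * `|Cm| + Cv)) <= 4^-1.
Hypothesis bound :
  forall (Y W : 'I_n -> T -> p.-tuple R) (l a2 a3 M tau alpha delta : R),
  (0 < p)%N -> 0 < l <= 1 -> ln p%:R <= l^-1 -> 0 <= alpha -> 0 <= delta ->
  (forall i, centered4 P (Y i)) -> (forall i, centered4 P (W i)) ->
  (forall i, 2^-1 <= Ex P (fun t => (sup_norm (Y i t) <= 1)%R%:R)) ->
  (forall i, 2^-1 <= Ex P (fun t => (sup_norm (W i t) <= 1)%R%:R)) ->
  (forall j k, `|\sum_i (mom2 P (Y i) j k - mom2 P (W i) j k)| <= a2) ->
  (forall j k m, `|\sum_i (mom3 P (Y i) j k m - mom3 P (W i) j k m)| <= a3) ->
  (forall j, \sum_i (mom4 P (Y i) j + mom4 P (W i) j) <= M) ->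
  \sum_i (tail P (Y i) + tail P (W i)) <= tau ->
  C * l * (a2 + a3 + M) <= 4^-1 ->
  (forall y t, 0 < t -> interp P Y W 0 (index_enum 'I_n) (orth (vec_shift y t)) -
     interp P Y W 0 (index_enum 'I_n) (orth y) <= alpha * t + delta) ->
  forall y, `|interp P Y W 1 (index_enum 'I_n) (orth y) -
      interp P Y W 0 (index_enum 'I_n) (orth y)| <=
    9 * l^-1 * alpha + 3 * delta + 2 * (C * l * tau).

(** After scaling, all the quantities that enter the comparison are at most a
    constant times the rate. *)
Lemma clt_small_rate y : th <= 1 ->
  `|fine (P (sum_le_event V y)) - fine (P (sum_le_event Z y))| <=
  9 * (Ca / c0) * th + 3 * (Ca * delta) + 2 * (C * ((Cb / 2 + 1) * th)).
Proof.
move=> th1; pose c := c0 * th / (B * m ^+ 2).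
have c_gt0 : 0 < c by rewrite divr_gt0 ?mulr_gt0 ?exprn_gt0.
have c_ge0 := ltW c_gt0.
pose Y := scaled V c; pose W := scaled Z c; pose s := index_enum 'I_n.
pose b := c * r; have b0 : 0 < b by rewrite mulr_gt0.
have bE : b = c0 * m ^+ 3 / th by exact: rate_scale rate.
have PV z : fine (P (sum_le_event V z)) = interp P Y W 1 s (orth (vscale b z)).
  by rewrite (prob_sum_le_event z c_gt0 n0 indV) (interp_ends P Y W s _).1.
have PZ z : P (sum_le_event Z z) = (interp P Y W 0 s (orth (vscale b z)))%:E.
  by rewrite (prob_sum_le_event z c_gt0 n0 indZ) (interp_ends P Y W s _).2.
rewrite PV PZ /=.
have VG i t : 1 < c * sup_norm (V i t) -> G i t.
  move=> lt1; rewrite /G /= lt_max; apply/orP; left; rewrite ltNge; apply/negP => le.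
  move: lt1; rewrite ltNge => /negP; apply.
  apply: (le_trans (ler_wpM2l c_ge0 le)); rewrite -m2.
  have -> : c * (Cp * B * m ^+ 2) = c0 * Cp * th.
    by rewrite /c; field; rewrite !gt_eqF.
  by rewrite mulr_ile1 ?(ltW th0)// mulr_ge0 ?(ltW c00)// (le_trans ler01).
have ZG i t : 1 < c * sup_norm (Z i t) -> G i t.
  move=> lt1; rewrite /G /= lt_max; apply/orP; right; rewrite ltNge; apply/negP => le.
  move: lt1; rewrite ltNge => /negP; apply.
  apply: (le_trans (ler_wpM2l c_ge0 le)); rewrite -m2.
  have -> : c * (Cp * B * m ^+ 2) = c0 * Cp * th.
    by rewrite /c; field; rewrite !gt_eqF.
  by rewrite mulr_ile1 ?(ltW th0)// mulr_ge0 ?(ltW c00)// (le_trans ler01).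
pose a2 := c ^+ 2 * (r * (`|Cm| * B * m)).
pose a3 := c ^+ 3 * (r * (`|Cm| * B ^+ 2 * m ^+ 3)).
pose M := c ^+ 4 * (r ^+ 2 * (Cv * B ^+ 2)).
pose K := Cb / 2 + 1.
pose tau := c ^+ 4 * (r ^+ 2 * (B ^+ 4 * m ^+ 8 / r ^+ 4 * K)).
pose l := (m ^+ 2)^-1.
pose alpha := Ca * Num.sqrt (ln p%:R) / b.
have p1R : 1 <= p%:R :> R by rewrite ler1n.
have lnp0 : 0 <= ln p%:R :> R by exact: ln_ge0.
have lnpL : ln p%:R <= L.
  rewrite /L ler_ln ?posrE ?ltr0n ?muln_gt0 ?p0 ?n0// ler_nat.
  by rewrite leq_pmulr.
have l01 : 0 < l <= 1.
  rewrite /l m2 invr_gt0 L0 /= invf_le1//.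
have alpha0 : 0 <= alpha.
  by rewrite /alpha !mulr_ge0 ?invr_ge0 ?sqrtr_ge0 ?(ltW b0) ?(ltW Ca0).
have K0 : 0 <= K by rewrite /K addr_ge0// divr_ge0// ltW.
have tail_i i : tail P (Y i) + tail P (W i) <= c ^+ 4 * (B ^+ 4 * m ^+ 8 / r ^+ 4 * K).
  have [rV rZ EVZ] := moment8 i.
  (* the value that balances the moments of order eight and the probability of
     the exceptional event *)
  pose sg := B ^+ 4 * m ^+ 8 * r ^+ 4.
  have sg0 : 0 < sg by rewrite /sg !mulr_gt0 ?exprn_gt0.
  have tV := tail_vscale_le (measurable_funPT (V i)) c_ge0 rV (meanV i) (mG i) (VG i) sg0.
  have tZ := tail_vscale_le (measurable_funPT (Z i)) c_ge0 rZ (meanZ i) (mG i) (ZG i) sg0.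
  apply: (le_trans (lerD tV tZ)).
  rewrite [leLHS](_ : _ = c ^+ 4 * (2^-1 * ((Ex P (fun t => sup_norm (V i t) ^+ 8) +
      Ex P (fun t => sup_norm (Z i t) ^+ 8)) / sg +
      sg * (fine (P (G i)) + fine (P (G i)))))); last by ring.
  rewrite ler_wpM2l ?exprn_ge0//.
  have h1 : (Ex P (fun t => sup_norm (V i t) ^+ 8) +
      Ex P (fun t => sup_norm (Z i t) ^+ 8)) / sg <= Cb * B ^+ 8 * L ^+ 8 / sg.
    by rewrite ler_wpM2r// invr_ge0 ltW.
  have h2 : sg * (fine (P (G i)) + fine (P (G i))) <= sg * ((r ^+ 8)^-1 + (r ^+ 8)^-1).
    by rewrite ler_wpM2l ?(ltW sg0)// lerD.
  apply: (@le_trans _ _ (2^-1 * (Cb * B ^+ 8 * L ^+ 8 / sg +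
      sg * ((r ^+ 8)^-1 + (r ^+ 8)^-1)))).
    by rewrite ler_wpM2l// lerD.
  rewrite le_eqVlt; apply/orP; left; apply/eqP; rewrite -m2 /sg /K.
  by field; rewrite !gt_eqF.
have := @bound Y W l a2 a3 M tau alpha (Ca * delta) p0 l01 _ alpha0 _ _ _ _ _ _ _ _ _ _ _
  (vscale b y).
have -> : l^-1 = L by rewrite /l invrK m2.
move=> main; apply: (le_trans (main _ _ _ _ _ _ _ _ _ _ _ _)) => //.
- by rewrite mulr_ge0// ltW.
- by move=> i; apply: centered4_vscale => //; have [] := moment8 i.
- by move=> i; apply: centered4_vscale => //; have [] := moment8 i.
- move=> i; apply: (small_vscale (measurable_funPT (V i)) c_ge0 (mG i)) => //.
  exact: VG.
- move=> i; apply: (small_vscale (measurable_funPT (Z i)) c_ge0 (mG i)) => //.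
  exact: ZG.
- move=> j k; rewrite /Y /W /a2 (eq_bigr (fun i => c ^+ 2 *
    (mom2 P (V i) j k - mom2 P (Z i) j k))).
    rewrite -mulr_sumr normrM ger0_norm ?exprn_ge0// ler_wpM2l ?exprn_ge0//.
  by move=> i _; rewrite mulrBr -!mom2_vscale//; have [] := moment8 i.
- move=> j k q; rewrite /Y /W /a3 (eq_bigr (fun i => c ^+ 3 *
    (mom3 P (V i) j k q - mom3 P (Z i) j k q))).
    rewrite -mulr_sumr normrM ger0_norm ?exprn_ge0// ler_wpM2l ?exprn_ge0//.
  by move=> i _; rewrite mulrBr -!mom3_vscale//; have [] := moment8 i.
- move=> j; rewrite /Y /W /M (eq_bigr (fun i => c ^+ 4 *
    (mom4 P (V i) j + mom4 P (Z i) j))).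
    rewrite -mulr_sumr ler_wpM2l ?exprn_ge0//.
  by move=> i _; rewrite mulrDr -!mom4_vscale//; have [] := moment8 i.
- apply: (le_trans (ler_sum _ (fun i _ => tail_i i))).
  rewrite sumr_const card_ord -mulr_natl -r2 le_eqVlt; apply/orP; left; apply/eqP.
  by rewrite /tau mulrCA.
- apply: le_trans small; rewrite -mulrA ler_wpM2l ?(le_trans ler01 C1)//.
  by apply: rate_coefficients => //; exact: ltW.
- move=> z t t0; pose z0 := vscale b^-1 z.
  have := condA z0 (divr_gt0 t0 b0); rewrite !PZ -EFinB lee_fin.
  have -> : vscale b z0 = z.
    by apply: eq_from_tnth => j; rewrite !tnth_vscale mulVKf// gt_eqF.
  have -> : vscale b (vec_shift z0 (t / b)) = vec_shift z t.
    apply: eq_from_tnth => j; rewrite tnth_vscale !tnth_vec_shift tnth_vscale.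
    by rewrite mulrDr mulVKf ?gt_eqF// mulrCA mulfV ?mulr1// gt_eqF.
  move/le_trans; apply; rewrite mulrDr lerD2r le_eqVlt; apply/orP; left; apply/eqP.
  by rewrite /alpha; field; rewrite gt_eqF.
rewrite !lerD//.
  have -> : 9 * L * alpha = 9 * (L * alpha) by ring.
  rewrite -mulrA ler_wpM2l//.
  have -> : L * alpha = Ca / c0 * th * (Num.sqrt (ln p%:R) / m).
    by rewrite /alpha bE -m2; field; rewrite !gt_eqF.
  rewrite ler_piMr ?mulr_ge0 ?invr_ge0 ?(ltW Ca0) ?(ltW c00) ?(ltW th0)//.
  by rewrite ler_pdivrMr// mul1r ler_wsqrtr.
rewrite ler_wpM2l// -mulrA ler_wpM2l ?(le_trans ler01 C1)//.
exact: rate_tail.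
Qed.

Lemma clt_bound y :
  `|fine (P (sum_le_event V y)) - fine (P (sum_le_event Z y))| <=
  (1 + 9 * (Ca / c0) + 3 * Ca + 2 * (C * (Cb / 2 + 1))) * (th + delta).
Proof.
set X := 9 * (Ca / c0); set U := 2 * (C * (Cb / 2 + 1)).
have X0 : 0 <= X by rewrite mulr_ge0// divr_ge0// ltW.
have U0 : 0 <= U.
  by rewrite /U !mulr_ge0 ?addr_ge0 ?divr_ge0 ?(ltW Cb0)// (le_trans ler01 C1).
have t0 := ltW th0; have a0 := ltW Ca0.
have [th1|/ltW th1] := leP th 1.
  apply: (le_trans (clt_small_rate y th1)).
  have := mulr_ge0 X0 delta0; have := mulr_ge0 U0 delta0.
  have := mulr_ge0 a0 t0.
  have -> : 9 * (Ca / c0) * th + 3 * (Ca * delta) + 2 * (C * ((Cb / 2 + 1) * th)) =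
    X * th + 3 * (Ca * delta) + U * th by rewrite /U /X; ring.
  have -> : (1 + X + 3 * Ca + U) * (th + delta) = th + delta + X * th + X * delta
    + 3 * (Ca * th) + 3 * (Ca * delta) + U * th + U * delta by ring.
  move: (X * th) (X * delta) (Ca * th) (Ca * delta) (U * th) (U * delta).
  by have := delta0; move=> *; lra.
have PV1 (X' : 'I_n -> {RV P >-> p.-tuple R}) : measurable (sum_le_event X' y) ->
    0 <= fine (P (sum_le_event X' y)) <= 1.
  move=> mE; rewrite fine_ge0//= -lee_fin fineK ?fin_num_measure//.
  exact: probability_le1.
have hV := PV1 _ (measurable_sum_le_event V y (leq_trans (isT : (0 < 3)%N) n3)).
have hZ := PV1 _ (measurable_sum_le_event Z y (leq_trans (isT : (0 < 3)%N) n3)).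
move: (fine _) (fine _) hV hZ => x z /andP[x0 x1] /andP[z0 z1].
apply: (@le_trans _ _ 1);  first by rewrite ler_norml; lra.
have -> : (1 + X + 3 * Ca + U) * (th + delta) =
  th + (delta + (X + 3 * Ca + U) * (th + delta)) by ring.
apply: (le_trans th1); rewrite lerDl addr_ge0// mulr_ge0 ?addr_ge0//.
by rewrite mulr_ge0.
Qed.

End assembly.

Theorem theorem3p1 (R : realType) (Cv Cp Cb Ca Cm : R) :
  0 < Cv -> 1 <= Cp -> 0 < Cb -> 0 < Ca ->
  exists C : R,
  forall (d : measure_display) (T : measurableType d) (P : probability T R)
    (n p : nat) (B delta : R) (V Z : 'I_n -> {RV P >-> p.-tuple R}),
  (3 <= n)%N -> (2 <= p)%N -> 1 <= B -> 0 <= delta ->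
  mutually_independent (joint_family V Z) ->
  (forall (i : 'I_n) (j : 'I_p),
    ('E_P[component (V i) j] = 0)%E /\
    ('E_P[component (Z i) j] = 0)%E) ->
  (* Condition V *)
  (forall j : 'I_p,
    (((n%:R)^-1)%:E *
      \sum_(i < n) 'E_P[fun w =>
        (component (V i) j w ^+ 4 + component (Z i) j w ^+ 4)%R]
     <= (Cv * B ^+ 2)%:E)%E) ->
  (* Condition P *)
  (forall i : 'I_n,
    (P [set w | (Cp * B * ln (p * n)%:R
                 < Num.max (sup_norm (V i w)) (sup_norm (Z i w)))%R]
     <= ((n%:R ^+ 4)^-1)%:E)%E) ->
  (* Condition B *)
  (forall i : 'I_n,
    ('E_P[fun w => (sup_norm (V i w) ^+ 8 + sup_norm (Z i w) ^+ 8)%R]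
     <= (Cb * B ^+ 8 * ln (p * n)%:R ^+ 8)%:E)%E) ->
  (* Condition A *)
  (forall (y : p.-tuple R) (t : R), 0 < t ->
    (P (sum_le_event Z (vec_shift y t)) - P (sum_le_event Z y)
     <= (Ca * (t * Num.sqrt (ln p%:R) + delta))%:E)%E) ->
  (\big[maxe/-oo]_(j < p) \big[maxe/-oo]_(k < p)
     `| ((Num.sqrt n%:R)^-1)%:E *
        \sum_(i < n) ('E_P[fun w =>
                         (component (V i) j w * component (V i) k w)%R] -
                      'E_P[fun w =>
                         (component (Z i) j w * component (Z i) k w)%R]) |
   <= (Cm * B * Num.sqrt (ln (p * n)%:R))%:E)%E ->
  (\big[maxe/-oo]_(j < p) \big[maxe/-oo]_(k < p) \big[maxe/-oo]_(l < p)
     `| ((Num.sqrt n%:R)^-1)%:E *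
        \sum_(i < n)
          ('E_P[fun w => (component (V i) j w * component (V i) k w
                          * component (V i) l w)%R] -
           'E_P[fun w => (component (Z i) j w * component (Z i) k w
                          * component (Z i) l w)%R]) |
   <= (Cm * B ^+ 2 * Num.sqrt (ln (p * n)%:R ^+ 3))%:E)%E ->
  (ereal_sup [set `|P (sum_le_event V y) - P (sum_le_event Z y)|
             | y in [set: p.-tuple R]]
   <= (C * ((B ^+ 2 * ln (p * n)%:R ^+ 5 / n%:R) `^ (4^-1) + delta))%:E)%E.
Proof.
move=> Cv0 Cp1 Cb0 Ca0; have [C C1 bound] := interp_orthant_bound R.
have C0 : 0 <= C by rewrite (le_trans ler01).
(* [c0] has to be small for two reasons: outside the exceptional event the scaled
   vectors must have norm at most one, and the factor in front of the unknown
   distance must be at most 1/4. *)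
pose D := 4 * C * (2 * `|Cm| + Cv).
have D0 : 0 <= D by rewrite /D !mulr_ge0 ?addr_ge0 ?mulr_ge0// ltW.
have E1 : 1 <= Cp + D + 1 by lra.
have E0 : 0 < Cp + D + 1 by lra.
pose c0 := (Cp + D + 1)^-1.
have c00 : 0 < c0 by rewrite invr_gt0.
have c01 : c0 <= 1 by rewrite invf_le1.
have c0p : c0 * Cp <= 1 by rewrite ler_pdivrMl// mulr1; lra.
have small : C * (c0 * (2 * `|Cm| + Cv)) <= 4^-1.
  have -> : C * (c0 * (2 * `|Cm| + Cv)) = 4^-1 * (c0 * D) by rewrite /D; field.
  by rewrite ler_piMr// ler_pdivrMl// mulr1; lra.
exists (1 + 9 * (Ca / c0) + 3 * Ca + 2 * (C * (Cb / 2 + 1))).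
move=> d T P n p B delta V Z n3 p2 B1 delta0 ind mean0 condV condP condB condA cond2 cond3.
have [indV indZ] := joint_family_indep ind.
have main := clt_bound n3 p2 B1 delta0 Cv0 Cp1 Cb0 Ca0 indV indZ mean0 condV condP
  condB condA cond2 cond3 C1 c00 c01 c0p small (bound d T P p 'I_n).
apply: ge_ereal_sup => _ [y _ <-].
have fV := fin_num_measure P _ (measurable_sum_le_event V y (leq_trans (isT : (0 < 3)%N) n3)).
have fZ := fin_num_measure P _ (measurable_sum_le_event Z y (leq_trans (isT : (0 < 3)%N) n3)).
by rewrite -(fineK fV) -(fineK fZ) -EFinB abse_EFin lee_fin; exact: main.
Qed.
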